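(* Let $g:\mathbb{N}\to\mathbb{R}_+$ be a function with $g(N)\to\infty$ as $N\to\infty$ and $g(N)\le N$. Then the ordinary JSQ policy and the JSQ$(d(N))$ scheme, started from the same occupancy state, are $g(N)$-alike if one of the following holds: (i) $g(N)$ is of exact order $N$ (i.e. $g(N)=\Theta(N)$) and $d(N)\to\infty$ as $N\to\infty$; (ii) $g(N)=o(N)$ and $$d(N)\left(\frac{N}{g(N)}\log\Big(\frac{N}{g(N)}\Big)\right)^{-1}\to\infty\quad\text{as }N\to\infty.$$
   Context: System: for each $N\ge1$ there are $N$ identical server pools and a single dispatcher. Tasks arrive as a Poisson process of rate $\lambda(N)$. Tasks cannot be queued: each arriving task is immediately assigned to a server pool and starts execution at once. Execution times are independent exponential with unit mean and do not depend on the number of other tasks in service (all tasks at a pool are executed in parallel). Each pool can hold at most $B$ simultaneous tasks, $B\in\{1,2,\ldots\}\cup\{\infty\}$; a task assigned to a pool already holding $B$ tasks is permanently discarded. It is assumed that $\lambda(N)/N\to\lambda$ with $0<\lambda\le B$. JSQ$(d(N))$ scheme ($1\le d(N)\le N$): each arriving task is assigned to the server pool with the minimum number of active tasks among $d(N)$ server pools selected uniformly at random (independently at each arrival; ties broken arbitrarily). The case $d(N)=N$ is the ordinary JSQ policy. For a scheme $\Pi$, $Q_i^{\Pi}(t)$ is the number of server pools with at least $i$ active tasks at time $t$ in the $N$-th system under $\Pi$ (dependence on $N$ suppressed). $g(N)$-alike: two schemes $\Pi_1,\Pi_2$ (parameterized by $N$) are $g(N)$-alike if there exists a common probability space such that for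 any fixed $T\ge0$ and all $i\ge1$, $\sup_{t\in[0,T]}g(N)^{-1}|Q_i^{\Pi_1}(t)-Q_i^{\Pi_2}(t)|\to0$ in probability as $N\to\infty$. *)

(* Defs.v *)
From HB Require Import structures.
From mathcomp Require Import all_boot all_order all_algebra finmap.
From mathcomp Require Import all_classical all_reals all_analysis.
Import Order.TTheory GRing.Theory Num.Theory.
Import numFieldNormedType.Exports.

Set Implicit Arguments.
Unset Strict Implicit.
Unset Printing Implicit Defensive.

Local Open Scope classical_set_scope.
Local Open Scope ring_scope.

(* x v is the number of active tasks at pool v. *)
Definition config (N : nat) := {ffun 'I_N -> nat}.

(* The capacity B of a pool; [None] stands for B = oo. *)
Definition capacity := option nat.

Definition has_room (B : capacity) (n : nat) : bool :=
  if B is Some b then (n < b)%N else true.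

Definition within_capacity (B : capacity) (N : nat) (x : config N) : Prop :=
  forall (b : nat) (v : 'I_N), B = Some b -> (x v <= b)%N.

(* An assignment scheme, for every number N of pools: how many pools are
   sampled at each arrival, and the (possibly randomized) rule that picks a pool
   from a uniform mark w in [0,1], the rank k of the arrival, the configuration x
   it finds and the sampled set S.  The rule returns an option because 'I_0 is
   empty; a task for which it returns [None] is discarded. *)
Record scheme (R : realType) := Scheme {
  sample_size : nat -> nat;
  rule : forall N : nat, R -> nat -> config N -> {set 'I_N} -> option 'I_N;
  rule_measurable : forall (N k : nat) (x : config N) (S : {set 'I_N})
    (o : option 'I_N), measurable [set w : R | rule w k x S = o] }.

(* JSQ(d(N)): d(N) pools are sampled and the task goes to a least loaded one of
   them.  Nothing else is required of [rule], so that ties are broken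
   arbitrarily. *)
Definition is_JSQd (R : realType) (d : nat -> nat) (Pi : scheme R) : Prop :=
  forall N : nat, (0 < N)%N ->
    sample_size Pi N = d N /\
    forall (w : R) (k : nat) (x : config N) (S : {set 'I_N}), S != finset.set0 ->
      exists v : 'I_N, [/\ rule Pi w k x S = Some v, v \in S &
        forall v' : 'I_N, v' \in S -> (x v <= x v')%N].

Definition is_JSQ (R : realType) (Pi : scheme R) : Prop :=
  is_JSQd (fun N => N) Pi.

(* One sample of the primitive data of a system with N pools: for the k-th
   arriving task, the time elapsed since the previous arrival, the sampled pools,
   the tie-breaking mark and the execution time; and the remaining execution time
   of the j-th task present at pool v at time 0. *)
Record input (R : realType) (N : nat) := Input {
  gap : nat -> R;
  sampled : nat -> {set 'I_N};
  mark : nat -> R;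
  work : nat -> R;
  residual : 'I_N -> nat -> R }.

Definition arrival_time (R : realType) (N : nat) (u : input R N) (k : nat) : R :=
  \sum_(j < k.+1) gap u j.

Definition initial_active (R : realType) (N : nat) (x0 : config N)
    (u : input R N) (t : R) (v : 'I_N) : nat :=
  (\sum_(j < x0 v) (t < residual u v j)%R)%N.

Definition in_service (R : realType) (N : nat) (u : input R N) (k : nat) (t : R) :
    bool :=
  arrival_time u k <= t < arrival_time u k + work u k.

(* Configuration at time t when only the first [size ds] arrivals are taken into
   account, the k-th one having been sent to the pool [nth None ds k] ([None] if
   it was discarded). *)
Definition config_after (R : realType) (N : nat) (x0 : config N) (u : input R N)
    (ds : seq (option 'I_N)) (t : R) : config N :=
  [ffun v => (initial_active x0 u t v +
    \sum_(k < size ds) ((nth None ds k == Some v) && in_service u k t))%N].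

Definition place (R : realType) (B : capacity) (Pi : scheme R) (N : nat)
    (x0 : config N) (u : input R N) (ds : seq (option 'I_N)) : option 'I_N :=
  let k := size ds in
  let x := config_after x0 u ds (arrival_time u k) in
  if rule Pi (mark u k) k x (sampled u k) is Some v then
    if has_room B (x v) then Some v else None
  else None.

Fixpoint placements (R : realType) (B : capacity) (Pi : scheme R) (N : nat)
    (x0 : config N) (u : input R N) (n : nat) : seq (option 'I_N) :=
  if n is m.+1 then
    let ds := placements B Pi x0 u m in rcons ds (place B Pi x0 u ds)
  else [::].

Definition placement (R : realType) (B : capacity) (Pi : scheme R) (N : nat)
    (x0 : config N) (u : input R N) (k : nat) : option 'I_N :=
  place B Pi x0 u (placements B Pi x0 u k).

(* [fset_set A] is the finite set A, or the empty set when A is infinite; the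
   latter has probability zero below, since arrival times almost surely tend to
   infinity. *)
Definition load (R : realType) (B : capacity) (Pi : scheme R) (N : nat)
    (x0 : config N) (u : input R N) (t : R) (v : 'I_N) : nat :=
  (initial_active x0 u t v +
   #|` fset_set [set k : nat | placement B Pi x0 u k = Some v /\
                              in_service u k t] |)%N.

Definition at_least (N : nat) (x : 'I_N -> nat) (i : nat) : nat :=
  #|[set v : 'I_N | (i <= x v)%N]%SET|.

(* The process written Q_i(t) in the queueing literature. *)
Definition occupancy (R : realType) (B : capacity) (Pi : scheme R) (N : nat)
    (x0 : config N) (u : input R N) (i : nat) (t : R) : nat :=
  at_least (load B Pi x0 u t) i.

Definition same_occupancy (N : nat) (x y : config N) : Prop :=
  forall i : nat, at_least x i = at_least y i.

(* Mutual independence of a family of classes of events: product rule over every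
   finite subfamily. *)
Definition mutually_independent (R : realType) (d : measure_display)
    (T : measurableType d) (P : probability T R) (I : Type)
    (F : I -> set (set T)) : Prop :=
  forall (n : nat) (s : 'I_n -> I) (E : 'I_n -> set T), injective s ->
    (forall j : 'I_n, F (s j) (E j)) ->
    (P (\big[setI/setT]_(j < n) E j) = \prod_(j < n) P (E j))%E.

Inductive source (N : nat) : Type :=
  | Gap of nat
  | Sampled of nat
  | Mark of nat
  | Work of nat
  | Residual of 'I_N & nat.

Arguments Gap {N}.
Arguments Sampled {N}.
Arguments Mark {N}.
Arguments Work {N}.

(* The sigma-algebra generated by one of the primitive random variables; the
   finite type {set 'I_N} carries the discrete sigma-algebra. *)
Definition source_events (R : realType) (T : Type) (N : nat)
    (U : T -> input R N) (s : source N) : set (set T) :=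
  match s with
  | Gap k => preimage_set_system setT (fun w => gap (U w) k) measurable
  | Sampled k => preimage_set_system setT (fun w => sampled (U w) k) setT
  | Mark k => preimage_set_system setT (fun w => mark (U w) k) measurable
  | Work k => preimage_set_system setT (fun w => work (U w) k) measurable
  | Residual v j =>
      preimage_set_system setT (fun w => residual (U w) v j) measurable
  end.

Definition has_law (R : realType) (d : measure_display) (T : measurableType d)
    (P : probability T R) (X : T -> R) (mu : set R -> \bar R) : Prop :=
  forall A : set R, measurable A -> P (X @^-1` A) = mu A.

(* The primitive data of the N-th system: Poisson arrivals of rate [rate],
   uniformly random samples of [m] pools, unit-mean exponential execution times
   (hence, by lack of memory, unit-mean exponential remaining execution times of
   the tasks initially present), all independent. *)
Record is_input (R : realType) (rate : R) (m : nat) (d : measure_display)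
    (T : measurableType d) (P : probability T R) (N : nat)
    (U : T -> input R N) : Prop := IsInput {
  input_measurable : forall s : source N, source_events U s `<=` measurable;
  input_independent : mutually_independent P (source_events U);
  gap_law : forall k : nat,
    has_law P (fun w => gap (U w) k) (exponential_prob rate);
  sampled_law : forall (k : nat) (S : {set 'I_N}),
    P [set w | sampled (U w) k = S] =
      (if #|S| == m then ('C(N, m)%:R)^-1 else 0)%:E;
  mark_law : forall k : nat,
    has_law P (fun w => mark (U w) k) (uniform_prob (@ltr01 R));
  work_law : forall k : nat,
    has_law P (fun w => work (U w) k) (exponential_prob 1);
  residual_law : forall (v : 'I_N) (j : nat),
    has_law P (fun w => residual (U w) v j) (exponential_prob 1) }.

(* Convergence to 0 in probability of nonnegative X_N.  The outer measure
   [mu_ext P] agrees with P on measurable sets; it makes the definition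
   meaningful without having to know that an uncountable supremum is
   measurable. *)
Definition cvg_in_probability0 (R : realType) (d : measure_display)
    (T : measurableType d) (P : probability T R) (X : nat -> T -> \bar R) : Prop :=
  forall e : R, 0 < e ->
    mu_ext P [set w | (e%:E < X N w)%E] @[N --> \oo] --> (0 : \bar R).

(* The two systems may depend on each other in any way: U1 N and U2 N are only
   required to have the right law separately. *)
Definition alike (R : realType) (g : nat -> R) (rate : nat -> R) (B : capacity)
    (Pi1 Pi2 : scheme R) (x1 x2 : forall N : nat, config N) : Prop :=
  exists (d : measure_display) (T : measurableType d) (P : probability T R)
         (U1 U2 : forall N : nat, T -> input R N),
    (forall N : nat, (0 < N)%N ->
       is_input (rate N) (sample_size Pi1 N) P (U1 N) /\
       is_input (rate N) (sample_size Pi2 N) P (U2 N)) /\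
    forall (t0 : R) (i : nat), 0 <= t0 -> (1 <= i)%N ->
      cvg_in_probability0 P (fun N w =>
        ereal_sup [set ((g N)^-1 *
            `| (occupancy B Pi1 (x1 N) (U1 N w) i t)%:R
             - (occupancy B Pi2 (x2 N) (U2 N w) i t)%:R |)%:E
          | t in `[0, t0]]).

(* Main.v *)
Require Import Defs.
From HB Require Import structures.
From mathcomp Require Import all_boot all_order all_algebra finmap.
From mathcomp Require Import all_classical all_reals all_analysis.
From mathcomp Require Import perm measurable_realfun zify ring lra.
Import Order.TTheory GRing.Theory Num.Theory.
Import numFieldNormedType.Exports.

Set Implicit Arguments.
Unset Strict Implicit.
Unset Printing Implicit Defensive.

Local Open Scope classical_set_scope.
Local Open Scope ring_scope.

(* Truncated sums L_m = sum_v min(x_v, m) of the two configurations are compared.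
   JSQ maximizes the growth of every L_m, and a JSQ(d) arrival loses at most one
   unit against it; but as long as the JSQ(d) sample meets the n.+1 least loaded
   pools, the inequality L_m(JSQ) <= L_m(JSQ(d)) + m n survives, since all but n
   pools are then at least as high as the one receiving the task.  Departures
   preserve both inequalities when the tasks in service are matched in the
   order of the heights of their pools and matched tasks leave together: by the
   identity (m+1) L_m - m L_(m+1) = #(tasks in pools of height at most m), a
   bound that is tight at m, together with the same bound at m+1, compares the
   numbers of tasks in low pools in the direction that preserves it.  Since Q_i
   is the increment of L_m at m = i, this yields |Q_i - Q_i'| <= i (n + b), with
   b the number of bad arrivals, those whose sample misses the n.+1 pools.

   The matching changes with time while the execution times must be attached to
   tasks once and for all.  Time is cut into cells so short that each of them
   contains at most one event, and each execution time is assembled, by lack of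
   memory, from fresh exponential clocks, one for each cell; in each cell the
   clocks of the first system are those of the second one, permuted by a
   matching that depends only on the clocks of earlier cells.  This permutation
   preserves the law of the clocks.

   A sample misses the n.+1 least loaded pools with probability at most
   exp(-(n+1) d / N), so Markov's inequality bounds the number of bad arrivals;
   with n of order g(N) the bound is (N/g) exp(-c g d / N), which tends to 0 in
   both regimes. *)

(** * Measures on the line and on sequence spaces *)

(** One coupling has to serve every horizon, level and tolerance, so the number of recorded
    arrivals, the cell width and the number of cells depend on [N] alone. The width is chosen last:
    two given event times are [delta]-close with probability of order [delta], and the number of
    pairs of events does not depend on [delta], so crowding becomes negligible however many cells
    result. The three exceptional events (two events close together, too many arrivals, too many bad
    samples) concern the second system only. Its clocks are never permuted, so they can be bounded
    for raw independent clocks; the first system enters only through a pathwise bound outside these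
    events. Discarded tasks and padding tasks keep running their clocks. Both systems then have
    equally many tasks in service whatever they discard, which is what permits a one-to-one
    matching. The probability space is built from a single uniform number: its binary digits are
    fair coins, and a coin sequence can be split again and again to feed countably many exponential
    clocks. *)

Lemma measure_ray_unique (R : realType) (m1 m2 : {measure set R -> \bar R}) :
  (forall a, m1 `]a, +oo[%classic = m2 `]a, +oo[%classic) ->
  (forall a, m1 `]a, +oo[%classic < +oo)%E ->
  forall A, measurable A -> m1 A = m2 A.
Proof.
move=> m12 mfin A mA.
apply: (@measure_unique _ R R (@RGenOInfty.G R)
  (fun k => `](- k%:R), +oo[%classic)) => //.
- exact: RGenOInfty.measurableE.
- move=> _ _ [x ->] [y ->]; exists (Num.max x y).
  apply/seteqP; split=> z /=; rewrite !in_itv/= !andbT gt_max.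
    by move=> [-> ->].
  by move/andP.
- by move=> k; exists (- k%:R).
- rewrite -subTset => x _; exists (Num.truncn `|x|).+1 => //=.
  rewrite in_itv/= andbT ltrNl.
  by apply: (le_lt_trans (ler_norm _)); rewrite normrN truncnS_gt.
- by move=> _ [x ->].
Qed.

Lemma uniform_probE (R : realType) (U : set R) : measurable U ->
  uniform_prob (@ltr01 R) U = lebesgue_measure (U `&` `[0, 1]%classic).
Proof.
move=> mU; rewrite /uniform_prob integral_uniform_pdf.
have mUI : measurable (U `&` `[0, 1]%classic) by exact: measurableI.
rewrite (eq_integral (fun=> 1%:E)) ?integral_cst ?mul1e//.
move=> x /[1!inE] -[_ /=]; rewrite in_itv/= /uniform_pdf => ->.
by rewrite subr0 invr1.
Qed.

Lemma uniform_prob_ray (R : realType) (a : R) :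
  uniform_prob (@ltr01 R) `]a, +oo[%classic = (1 - Num.max 0 (Num.min a 1))%:E.
Proof.
rewrite uniform_probE//.
have [a0|a0] := ltP a 0.
  rewrite (_ : _ `&` _ = `[0, 1]%classic).
    rewrite lebesgue_measure_itv/= lte01 oppr0 adde0 min_l ?max_l ?subr0 ?ltW//.
    by rewrite (lt_trans a0).
  apply/setIidPr => x /=; rewrite !in_itv/= => /andP[x0 _].
  by rewrite (lt_le_trans a0).
rewrite (_ : _ `&` _ = `]a, 1]%classic); last first.
  apply/seteqP; split => x /=; rewrite !in_itv/= ?andbT.
    by move=> [->] /andP[].
  by move=> /andP[ax ->]; rewrite ax (le_trans a0)// ltW.
rewrite lebesgue_measure_itv/= lte_fin; case: ltP => [a1|a1].
  by rewrite max_r// ltW.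
by rewrite max_r// subrr.
Qed.

Lemma exponential_prob_ray (R : realType) (r a : R) : 0 < r ->
  exponential_prob r `]a, +oo[%classic = (expR (- r * Num.max 0 a))%:E.
Proof.
move=> r0.
have E0 : exponential_prob r `]-oo, 0[%classic = 0%E.
  rewrite /exponential_prob integral0_eq// => x /=; rewrite in_itv/= => x0.
  by rewrite /exponential_pdf patchE ifF// memNset//= in_itv/= andbT leNgt x0.
pose Q := (exponential_distribution_exponential_prob__canonical__probability_measure_Probability r0).
have QE A : exponential_prob r A = Q A by [].
have [a0|a0] := ltP a 0.
  rewrite mulr0 expR0 -setCitvl QE probability_setC//.
  rewrite (_ : Q _ = 0%E) ?sube0//.
  apply/eqP; rewrite eq_le measure_ge0 andbT -E0 QE le_measure ?inE//.
  by apply: subset_itvl; rewrite bnd_simp.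
have Ea : exponential_prob r `[0, a]%classic = (1 - (expR (- r * a))%:E)%E.
  have [a00|a00] := ltP 0 a; first exact: exponential_prob_itv0c.
  have -> : a = 0 by apply/eqP; rewrite eq_le a00.
  by rewrite set_itv1 /exponential_prob integral_set1 mulr0 expR0 subee.
rewrite -setCitvl QE probability_setC//.
have -> : `]-oo, a]%classic = `]-oo, 0[%classic `|` `[0, a]%classic.
  apply/seteqP; split => x /=; rewrite !in_itv/=.
    by move=> xa; have [x0|x0] := ltP x 0; [left|right].
  by move=> [/ltW/le_trans ->//|/andP[]].
have -> : Q (`]-oo, 0[%classic `|` `[0, a]%classic) = (1 - (expR (- r * a))%:E)%E.
  rewrite measureU//.
    by rewrite -[RHS]add0r; congr (_ + _)%R; [exact: E0|exact: Ea].
  apply/seteqP; split => // x /= [] /=; rewrite !in_itv/= => x0 /andP[].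
  by rewrite leNgt x0.
by rewrite -!EFinB opprB addrC subrK.
Qed.

Section rectangles.
Context (I : choiceType) d (Y : measurableType d).

Definition rect (s : seq I) (B : I -> set Y) : set (I -> Y) :=
  [set w | forall c, c \in s -> B c (w c)].

Definition rects : set (set (I -> Y)) :=
  [set A | exists s B, (forall c, measurable (B c)) /\ A = rect s B].

(** The product sigma-algebra, generated by the cylinders that constrain finitely many
    coordinates. *)
Definition seqspace := g_sigma_algebraType rects.

Lemma measurable_rect s B : (forall c, measurable (B c)) ->
  measurable (rect s B : set seqspace).
Proof. by move=> mB; apply: sub_sigma_algebra; exists s, B. Qed.

Lemma measurable_coord c : measurable_fun setT (fun w : seqspace => w c).
Proof.
move=> _ B mB; rewrite setTI.
have -> : (fun w : seqspace => w c) @^-1` B = rect [:: c] (fun=> B).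
  apply/seteqP; split => w /= => [Bw c'|]; first by rewrite inE => /eqP ->.
  by apply; rewrite inE.
exact: measurable_rect.
Qed.

Lemma measurable_seqspace d' (X : measurableType d') (f : X -> seqspace) :
  (forall c, measurable_fun setT (fun x => f x c)) -> measurable_fun setT f.
Proof.
move=> mf; apply: (@measurability _ _ X seqspace setT f rects) => //.
move=> _ [_ [s [B [mB ->]]] <-]; rewrite setTI.
have -> : f @^-1` rect s B =
    \big[setI/setT]_(c <- s) ((fun x => f x c) @^-1` B c).
  apply/seteqP; split => x /=.
    move=> Bx; elim: s Bx => [|c s IH] Bx; rewrite ?big_nil// big_cons; split.
      by apply: Bx; rewrite inE eqxx.
    by apply: IH => c' c's; apply: Bx; rewrite inE c's orbT.
  elim: s => [|c s IH]; first by [].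
  rewrite big_cons => -[Bc /IH{}IH] c'; rewrite inE => /orP[/eqP ->//|].
  exact: IH.
elim: s => [|c s IH]; first by rewrite big_nil.
by rewrite big_cons; apply: measurableI => //; rewrite -[X in measurable X]setTI;
   apply: mf.
Qed.

(** Repetitions in [s] do not change [rect s B], so duplicate-free lists suffice; these are the
    lists on which product formulas hold. *)
Lemma seqspace_measure_unique (R : realType)
    (m1 m2 : {measure set seqspace -> \bar R}) :
  (forall s B, uniq s -> (forall c, measurable (B c)) ->
    m1 (rect s B) = m2 (rect s B)) ->
  (m1 setT < +oo)%E -> forall A, measurable A -> m1 A = m2 A.
Proof.
move=> m12 m1T A mA.
apply: (@measure_unique _ R seqspace rects (fun=> setT)) => //.
- move=> _ _ [s1 [B1 [mB1 ->]]] [s2 [B2 [mB2 ->]]].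
  exists (s1 ++ s2), (fun c => (if c \in s1 then B1 c else setT) `&`
                              (if c \in s2 then B2 c else setT)).
  split=> [c|]; first by apply: measurableI; case: ifP.
  apply/seteqP; split => w /=.
    by move=> [w1 w2] c _; split; case: ifPn => // ?; [exact: w1|exact: w2].
  by move=> W; split=> c cs; have := W c; rewrite mem_cat cs ?orbT => /(_ isT) [].
- by move=> _; exists [::], (fun=> setT); split=> //; apply/seteqP; split.
- by apply/seteqP; split => // x _; exists 0%N.
- move=> _ [s [B [mB ->]]]; rewrite (_ : rect s B = rect (undup s) B) ?m12 ?undup_uniq//.
  by apply/seteqP; split => w Bw c; [rewrite mem_undup|rewrite -mem_undup]; exact: Bw.
Qed.

End rectangles.


Section laws.
Variable R : realType.

(* The library's [uniform_prob] and [exponential_prob] are measures on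
   [measurableTypeR R]; these are the same set functions, as measures on [R]. *)
Fact laws_key : unit. Proof. exact: tt. Qed.
Definition unif : set R -> \bar R :=
  locked_with laws_key (uniform_prob (@ltr01 R)).
Definition expo : set R -> \bar R := locked_with laws_key (exponential_prob 1).

Lemma unif_def : unif = uniform_prob (@ltr01 R).
Proof. by rewrite /unif unlock. Qed.
Lemma expo_def : expo = exponential_prob 1.
Proof. by rewrite /expo unlock. Qed.

Let U : probability (measurableTypeR R) R := uniform_prob (@ltr01 R).
Let E : probability (measurableTypeR R) R :=
  exponential_distribution_exponential_prob__canonical__probability_measure_Probability
    (@ltr01 R).

Let unif0 : unif set0 = 0%E. Proof. by rewrite unif_def; exact: (measure0 U). Qed.
Let unif_ge0 A : (0 <= unif A)%E. Proof. by rewrite unif_def; exact: (measure_ge0 U). Qed.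
Let unif_add : semi_sigma_additive unif.
Proof. by rewrite unif_def; exact: (@measure_semi_sigma_additive _ _ _ U). Qed.
HB.instance Definition _ := isMeasure.Build _ R R unif unif0 unif_ge0 unif_add.
Let unif_setT : unif setT = 1%E. Proof. by rewrite unif_def; exact: (probability_setT U). Qed.
HB.instance Definition _ := Measure_isProbability.Build _ R R unif unif_setT.

Let expo0 : expo set0 = 0%E. Proof. by rewrite expo_def; exact: (measure0 E). Qed.
Let expo_ge0 A : (0 <= expo A)%E. Proof. by rewrite expo_def; exact: (measure_ge0 E). Qed.
Let expo_add : semi_sigma_additive expo.
Proof. by rewrite expo_def; exact: (@measure_semi_sigma_additive _ _ _ E). Qed.
HB.instance Definition _ := isMeasure.Build _ R R expo expo0 expo_ge0 expo_add.
Let expo_setT : expo setT = 1%E. Proof. by rewrite expo_def; exact: (probability_setT E). Qed.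
HB.instance Definition _ := Measure_isProbability.Build _ R R expo expo_setT.

End laws.
Arguments unif {R}.
Arguments expo {R}.

Lemma expo_ray (R : realType) (a : R) :
  expo `]a, +oo[%classic = (expR (- Num.max 0 a))%:E.
Proof. by rewrite expo_def exponential_prob_ray// mulN1r. Qed.

Lemma pushforward_measureP d1 d2 (T1 : measurableType d1) (T2 : measurableType d2)
  (R : realType) (m : {measure set T1 -> \bar R}) (f : T1 -> T2) :
  measurable_fun setT f ->
  exists m' : {measure set T2 -> \bar R}, forall A, m' A = m (f @^-1` A).
Proof.
move=> mf; exists (measure_function_pushforward__canonical__measure_function_Measure m mf).
by [].
Qed.

(** * The doubling map and the first binary digit *)

Section doubling.
Context {R : realType}.

(** The leading binary digit and the shift of the expansion. The point 1 is fixed by [dbl], so the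
    closed unit interval is stable. *)
Definition half_bit (x : R) : bool := 2^-1 <= x.
Definition dbl (x : R) : R := 2 * x - (half_bit x)%:R.

Lemma measurable_half_bit : measurable_fun setT half_bit.
Proof. by apply: measurable_fun_ler. Qed.

Lemma measurable_dbl : measurable_fun setT dbl.
Proof.
apply: measurable_funB; first by apply: measurable_funM.
rewrite (_ : (fun x => _) = (fun x => if half_bit x then 1 else 0)).
  by apply: measurable_fun_ifT => //; exact: measurable_half_bit.
by apply/funext => x; case: half_bit.
Qed.

Lemma unif_itv (b1 b2 : bool) (a c : R) : 0 <= a -> a <= c -> c <= 1 ->
  unif [set` Interval (BSide b1 a) (BSide b2 c)] = (c - a)%:E.
Proof.
move=> a0 ac c1; rewrite unif_def uniform_probE//.
have [E|H] := eqVneq a c.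
  rewrite E subrr; apply/eqP; rewrite eq_le measure_ge0 andbT.
  apply: (@le_trans _ _ (lebesgue_measure [set c])); last first.
    by rewrite lebesgue_measure_set1.
  rewrite le_measure ?inE//; first exact: measurableI.
  move=> x [/= + _]; rewrite in_itv /= => H.
  apply/eqP; rewrite eq_le; move: H; case: (b1); case: (b2) => /= /andP[h1 h2];
    by apply/andP; split => //; exact: ltW.
rewrite (_ : _ `&` _ = [set` Interval (BSide b1 a) (BSide b2 c)]).
  by rewrite lebesgue_measure_itv/= lte_fin lt_neqAle H ac.
apply/setIidPl => x /=; rewrite !in_itv /= => /andP[x1 x2]; apply/andP; split.
  by apply: (le_trans a0); case: b1 x1 => // /ltW.
by apply: le_trans c1; case: b2 x2 => // /ltW.
Qed.

Lemma unif_out (A : set R) : measurable A -> A `&` `[0, 1]%classic = set0 -> unif A = 0%E.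
Proof. by move=> mA A0; rewrite unif_def uniform_probE// A0 measure0. Qed.

Lemma unif_in (A B : set R) : measurable A -> measurable B ->
  A `&` `[0, 1]%classic = B `&` `[0, 1]%classic -> unif A = unif B.
Proof. by move=> mA mB AB; rewrite unif_def !uniform_probE// AB. Qed.

(** Each half of the unit interval is stretched affinely over the whole of it, so the digit is
    independent of the shifted number, which is again uniform. *)
Lemma dbl_law (b : bool) (A : set R) : measurable A ->
  unif ((half_bit @^-1` [set b]) `&` (dbl @^-1` A)) = (2^-1%:E * unif A)%E.
Proof.
move=> mA.
have mhb : measurable (half_bit @^-1` [set b]).
  by rewrite -[X in measurable X]setTI; exact: measurable_half_bit.
have mdb B : measurable B -> measurable (dbl @^-1` B).
  by move=> mB; rewrite -[X in measurable X]setTI; exact: measurable_dbl.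
have [m1 m1E] := pushforward_measureP (mrestr unif mhb) measurable_dbl.
have half_ge0 : 0 <= 2^-1 :> R by rewrite invr_ge0.
pose m2 : {measure set R -> \bar R} := mscale (NngNum half_ge0) unif.
have m2E B : m2 B = (2^-1%:E * unif B)%E by [].
rewrite -m2E setIC.
transitivity (m1 A); first by rewrite m1E.
apply: (@measure_ray_unique R m1 m2 _ _ A mA) => a; last first.
  rewrite m1E /mrestr; apply: (@le_lt_trans _ _ 1%E); last by rewrite ltry.
  by apply: probability_le1; apply: measurableI => //; exact: mdb.
rewrite m1E m2E /mrestr [in RHS]unif_def uniform_prob_ray.
rewrite -EFinM.
have S : (dbl @^-1` `]a, +oo[%classic) `&` half_bit @^-1` [set b] =
    [set x : R | (a + b%:R) / 2 < x] `&` half_bit @^-1` [set b].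
  apply/seteqP; split => x [/= + xb]; rewrite in_itv/= andbT /dbl xb => h; split => //=;
  lra.
rewrite [LHS](congr1 unif S).
have mS : measurable ([set x : R | (a + b%:R) / 2 < x] `&` half_bit @^-1` [set b]).
  by rewrite -S; apply: measurableI => //; exact: mdb.
have half_bitE x : half_bit x = (2^-1 <= x) by [].
clear m1 m1E m2 m2E S; case: b mS mhb => /= mS mhb.
- have [a0|a0] := ltP a 0.
    rewrite max_l ?subr0 ?mulr1; last by rewrite ge_min ltW.
    rewrite (unif_in (B := `[2^-1, 1]%classic)) ?unif_itv//; [by congr EFin; lra|lra..|].
    apply/seteqP; split=> x /=; rewrite !in_itv/= half_bitE.
      by move=> [[h1 h2] /andP[h3 h4]]; rewrite h2 h3 h4.
    move=> [/andP[h1 h2] /andP[h3 h4]]; rewrite h1 h2 h3; split => //.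
    by split => //; lra.
  have [a1|a1] := ltP a 1.
    rewrite max_r//.
    rewrite (unif_in (B := `](a + 1) / 2, 1]%classic)) ?unif_itv//; [by congr EFin; lra|lra..|].
    apply/seteqP; split=> x /=; rewrite !in_itv/= half_bitE.
      by move=> [[-> _] /andP[-> ->]].
    move=> [/andP[h1 h2] /andP[h3 _]]; rewrite h1 h2 h3; split => //.
    by split => //; apply/idP; lra.
  rewrite max_r// subrr mulr0 unif_out//.
  apply/seteqP; split=> x //=; rewrite !in_itv/= half_bitE.
  by move=> [[h _] /andP[_ h1]]; lra.
- have [a0|a0] := ltP a 0.
    rewrite max_l ?subr0 ?mulr1; last by rewrite ge_min ltW.
    rewrite (unif_in (B := `[0, 2^-1[%classic)) ?unif_itv//; [by congr EFin; lra|lra..|].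
    apply/seteqP; split=> x /=; rewrite !in_itv/= half_bitE.
      by move=> [[_ /negbT]]; rewrite -ltNge => -> /andP[-> ->].
    move=> [/andP[h1 h] /andP[_ h2]]; rewrite h1 h2; split => //.
    by split; [lra|apply/negbTE; rewrite -ltNge].
  have [a1|a1] := ltP a 1.
    rewrite max_r//.
    rewrite (unif_in (B := `]a / 2, 2^-1[%classic)) ?unif_itv//; [by congr EFin; lra|lra..|].
    apply/seteqP; split=> x /=; rewrite !in_itv/= half_bitE.
      by move=> [[h /negbT]]; rewrite -ltNge => -> /andP[-> ->]; split=> //; rewrite andbT; lra.
    move=> [/andP[h h'] /andP[h1 h2]]; rewrite h1 h2; split => //.
    by split; [lra|apply/negbTE; rewrite -ltNge].
  rewrite max_r// subrr mulr0 unif_out//.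
  apply/seteqP; split=> x //=; rewrite !in_itv/= half_bitE.
  by move=> [[h /negbT]]; rewrite -ltNge => h2 /andP[_ h1]; lra.
Qed.

End doubling.

(** * A family of independent exponential variables *)

Lemma pushforward_probabilityP d1 d2 (T1 : measurableType d1)
  (T2 : measurableType d2) (R : realType) (P : probability T1 R) (f : T1 -> T2) :
  measurable_fun setT f ->
  exists P' : probability T2 R, forall A, P' A = P (f @^-1` A).
Proof.
move=> mf; pose X : {mfun T1 >-> T2} := HB.pack f (isMeasurableFun.Build _ _ _ _ f mf).
by exists (distribution P X).
Qed.

Lemma measurable_preimT d1 d2 (T1 : measurableType d1) (T2 : measurableType d2)
  (f : T1 -> T2) (A : set T2) :
  measurable_fun setT f -> measurable A -> measurable (f @^-1` A).
Proof. by move=> mf mA; rewrite -[X in measurable X]setTI; exact: mf. Qed.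

Section orbit.
Context d1 d2 (T : measurableType d1) (Y : measurableType d2) (R : realType).
Variables (Q : probability T R) (nu : probability Y R) (b : T -> Y) (f : T -> T).
Hypotheses (mb : measurable_fun setT b) (mf : measurable_fun setT f).
Hypothesis bfE : forall A B, measurable A -> measurable B ->
  Q (b @^-1` B `&` f @^-1` A) = (nu B * Q A)%E.

Lemma measurable_iter n : measurable_fun setT (iter n f).
Proof.
elim: n => [|n IH]; first exact: measurable_id.
exact: measurableT_comp mf IH.
Qed.

Lemma measurable_orbit n : measurable_fun setT (fun x => b (iter n f x)).
Proof. exact: measurableT_comp mb (measurable_iter n). Qed.

(** By [bfE], [b] has law [nu] and is independent of [f], which preserves [Q]; peeling off the first
    observation leaves the same problem for the orbit of [f x]. *)
Lemma orbit_prefix n (B : nat -> set Y) : (forall i, measurable (B i)) ->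
  Q [set x | forall i, (i < n)%N -> B i (b (iter i f x))] =
    (\prod_(i < n) nu (B i))%E /\
  measurable [set x | forall i, (i < n)%N -> B i (b (iter i f x))].
Proof.
elim: n B => [|n IH] B mB.
  rewrite big_ord0 (_ : [set x | _] = setT) ?probability_setT//.
  by apply/seteqP; split.
have [IHE IHm] := IH (fun i => B i.+1) (fun i => mB i.+1).
have -> : [set x | forall i, (i < n.+1)%N -> B i (b (iter i f x))] =
   b @^-1` (B 0%N) `&`
   f @^-1` [set x | forall i, (i < n)%N -> B i.+1 (b (iter i f x))].
  apply/seteqP; split => x /=.
    move=> H; split; first exact: (H 0%N).
    by move=> i ilt; rewrite -iterSr; exact: (H i.+1).
  by move=> [H0 H] [|i]//= ilt; rewrite -iterS iterSr; exact: H.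
split; first by rewrite bfE// IHE big_ord_recl.
by apply: measurableI; exact: measurable_preimT.
Qed.

Lemma orbit_iid (I : countType) : exists P : probability (seqspace I Y) R,
  (forall s B, uniq s -> (forall c, measurable (B c)) ->
    P (rect s B) = (\prod_(c <- s) nu (B c))%E) /\
  forall A, P A = Q ((fun x (c : I) => b (iter (choice.pickle c) f x)) @^-1` A).
Proof.
pose w x (c : I) := b (iter (choice.pickle c) f x).
have mw : measurable_fun setT (w : T -> seqspace I Y).
  by apply: measurable_seqspace => c; exact: measurable_orbit.
have [P PE] := pushforward_probabilityP Q mw.
exists P; split; last exact: PE.
move=> s B us mB; rewrite PE.
pose n := (\max_(c <- s) (choice.pickle c).+1)%N.
have ltn c : c \in s -> (choice.pickle c < n)%N.
  by move=> cs; rewrite /n (big_rem c)//= leq_max leqnn.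
(* Indices that code no element of [s] get the full set, hence a factor 1 in the product. *)
pose B' j := if pickle_inv j is Some c then if c \in s then B c else setT else setT.
have mB' j : measurable (B' j).
  by rewrite /B'; case: pickle_inv => [c|//]; case: ifP.
have -> : w @^-1` (rect s B) =
   [set x | forall i, (i < n)%N -> B' i (b (iter i f x))].
  apply/seteqP; split => x /= H.
    move=> i _; rewrite /B'; case E: pickle_inv => [c|//]; case: ifPn => // cs.
    have := @pickle_invK I i; rewrite E /= => <-; exact: H.
  move=> c cs; have := H (choice.pickle c) (ltn c cs).
  by rewrite /B' pickleK_inv cs.
rewrite (orbit_prefix n mB').1.
rewrite -(big_mkord xpredT (fun j => nu (B' j))).
have E1 j : j \notin map choice.pickle s -> nu (B' j) = 1%E.
  rewrite /B'; case E: pickle_inv => [c|]; rewrite ?probability_setT//.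
  case: ifPn => cs; rewrite ?probability_setT// => /negP[]; apply/mapP; exists c => //.
  by have := @pickle_invK I j; rewrite E.
rewrite (bigID (mem (map choice.pickle s)))/= [X in (_ * X)%E]big1 ?mule1; last first.
  by move=> j /E1.
rewrite -big_filter (perm_big (map choice.pickle s))/=; last first.
  apply: uniq_perm.
  - by rewrite filter_uniq// iota_uniq.
  - by rewrite map_inj_uniq//; exact: pcan_inj pickleK.
  - move=> j; rewrite mem_filter mem_index_iota /=; apply/andP/idP => [[]//|js].
    by split => //; case/mapP: js => c cs ->; exact: ltn.
rewrite big_map big_seq [RHS]big_seq; apply: eq_bigr => c cs.
by rewrite /B' pickleK_inv cs.
Qed.

End orbit.

Section independence_extension.
Context d (T : measurableType d) (I : choiceType) d' (Y : measurableType d').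
Context (R : realType) (Q : probability T R) (f : T -> seqspace I Y).
Hypothesis mf : measurable_fun setT f.

(** For fixed [A] both sides are finite measures in [C]. Used twice, once per factor, this extends
    independence from pairs of rectangles to pairs of events. *)
Lemma indep_rect_ext (A : set T) : measurable A ->
  (forall s B, uniq s -> (forall c, measurable (B c)) ->
    Q (A `&` f @^-1` (rect s B)) = (Q A * Q (f @^-1` (rect s B)))%E) ->
  forall C, measurable C -> Q (A `&` f @^-1` C) = (Q A * Q (f @^-1` C))%E.
Proof.
move=> mA H C mC.
have [m1 m1E] := pushforward_measureP (mrestr Q mA) mf.
have [q qE] := pushforward_measureP Q mf.
have QA0 : 0 <= fine (Q A) by rewrite fine_ge0.
have QAE : (fine (Q A))%:E = Q A by rewrite fineK// fin_num_measure.
pose m2 : {measure set (seqspace I Y) -> \bar R} := mscale (NngNum QA0) q.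
have m2E B : m2 B = (Q A * Q (f @^-1` B))%E by rewrite -QAE -qE.
have m1E' B : m1 B = Q (A `&` f @^-1` B) by rewrite m1E /mrestr setIC.
rewrite -m1E' -m2E; apply: (@seqspace_measure_unique I _ Y R m1 m2) => //.
- by move=> s B us mB; rewrite m1E' m2E H.
- by rewrite m1E' (le_lt_trans (probability_le1 _ _)) ?ltry//= preimage_setT setIT.
Qed.

End independence_extension.

(** * Splitting a sequence of fair coins *)

Section coins.
Variable R : realType.
Local Notation coinspace := (seqspace nat bool).

Lemma half_bit_dbl_law (P : probability bool R) :
  (forall B, P B = unif ((@half_bit R) @^-1` B)) ->
  forall A B, measurable A -> measurable B ->
  unif ((@half_bit R) @^-1` B `&` (@dbl R) @^-1` A) = (P B * unif A)%E.
Proof.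
move=> PE A B mA _.
have P1 b : P [set b] = 2^-1%:E.
  rewrite PE -[X in unif X]setIT -(preimage_setT dbl) dbl_law//.
  by rewrite probability_setT mule1.
have mdA : measurable ((@dbl R) @^-1` A).
  exact: measurable_preimT measurable_dbl mA.
have mhb b : measurable ((@half_bit R) @^-1` [set b]).
  exact: measurable_preimT measurable_half_bit _.
have [Bt|Bt] := pselect (B true); have [Bf|Bf] := pselect (B false).
- have -> : B = setT by apply/seteqP; split => // -[].
  rewrite probability_setT mul1e preimage_setT setTI.
  have -> : (@dbl R) @^-1` A = (half_bit @^-1` [set true] `&` dbl @^-1` A) `|`
                       (half_bit @^-1` [set false] `&` dbl @^-1` A).
    rewrite -setIUl; apply/seteqP; split => x /=; last by case.
    by move=> Ax; split=> //; case: half_bit; [left|right].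
  transitivity (2^-1%:E * unif A + 2^-1%:E * unif A)%E.
    rewrite -{1}(dbl_law true mA) -(dbl_law false mA); apply: measureU; [exact: measurableI..|].
    by apply/seteqP; split => x //= -[[-> _] []].
  rewrite -ge0_muleDl ?lee_fin ?invr_ge0// -EFinD.
  by rewrite (_ : 2^-1 + 2^-1 = 1) ?mul1e//; lra.
- have -> : B = [set true] by apply/seteqP; split => [[]|_ ->].
  by rewrite dbl_law// P1.
- have -> : B = [set false] by apply/seteqP; split => [[]|_ ->].
  by rewrite dbl_law// P1.
- have -> : B = set0 by apply/seteqP; split => [[]|].
  by rewrite preimage_set0 set0I !measure0 mul0e.
Qed.

Definition evens (s : nat -> bool) (n : nat) : bool := s n.*2.
Definition odds (s : nat -> bool) (n : nat) : bool := s n.*2.+1.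

Lemma measurable_evens : measurable_fun setT (evens : coinspace -> coinspace).
Proof. by apply: measurable_seqspace => c; exact: measurable_coord. Qed.

Lemma measurable_odds : measurable_fun setT (odds : coinspace -> coinspace).
Proof. by apply: measurable_seqspace => c; exact: measurable_coord. Qed.

(** A pair of rectangles, one on even and one on odd indices, is a single rectangle on the merged
    index list. The odd factor is then extended to all events, and the even one after it. *)
Lemma evens_odds_indep (nu : probability bool R) (P : probability coinspace R) :
  (forall s B, uniq s -> (forall c, measurable (B c)) ->
    P (rect s B) = (\prod_(c <- s) nu (B c))%E) ->
  forall C D : set coinspace, measurable C -> measurable D ->
  P (evens @^-1` C `&` odds @^-1` D) = (P C * P D)%E.
Proof.
move=> PE.
have evE s (B : nat -> set bool) : evens @^-1` (rect s B) =
    rect (map double s) (fun k => B k./2).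
  apply/seteqP; split => x /= H c.
    by move=> /mapP[c' cs ->]; rewrite doubleK; exact: H.
  by move=> cs; have := H c.*2; rewrite doubleK; apply; exact: map_f.
have oddE s (B : nat -> set bool) : odds @^-1` (rect s B) =
    rect (map (fun k => k.*2.+1) s) (fun k => B k./2).
  apply/seteqP; split => x /= H c.
    by move=> /mapP[c' cs ->]; rewrite /= uphalf_double; exact: H.
  move=> cs; have := H c.*2.+1; rewrite /= uphalf_double; apply.
  by apply/mapP; exists c.
have Pev (C : set coinspace) : measurable C -> P (evens @^-1` C) = P C.
  have [m mE'] := pushforward_measureP P measurable_evens.
  have mE B : m B = P (evens @^-1` B) by exact: mE'.
  move=> mC; rewrite -mE; apply: (@seqspace_measure_unique nat _ bool R m P) => //.
    move=> s B us mB; transitivity (\prod_(c <- s) nu (B c))%E; last first.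
      by symmetry; exact: PE.
    rewrite mE evE PE//.
      by rewrite big_map; apply: eq_bigr => c _; rewrite doubleK.
    by rewrite map_inj_uniq//; exact: double_inj.
  by rewrite mE preimage_setT probability_setT ltry.
have Pod (C : set coinspace) : measurable C -> P (odds @^-1` C) = P C.
  have [m mE'] := pushforward_measureP P measurable_odds.
  have mE B : m B = P (odds @^-1` B) by exact: mE'.
  move=> mC; rewrite -mE; apply: (@seqspace_measure_unique nat _ bool R m P) => //.
    move=> s B us mB; transitivity (\prod_(c <- s) nu (B c))%E; last first.
      by symmetry; exact: PE.
    rewrite mE oddE PE//.
      by rewrite big_map; apply: eq_bigr => c _; rewrite /= uphalf_double.
    by rewrite map_inj_uniq// => i j [] /double_inj.
  by rewrite mE preimage_setT probability_setT ltry.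
have rectrect s1 B1 s2 B2 : uniq s1 -> uniq s2 ->
    (forall c, measurable (B1 c)) -> (forall c, measurable (B2 c)) ->
    P (evens @^-1` (rect s1 B1) `&` odds @^-1` (rect s2 B2)) =
    (P (rect s1 B1) * P (rect s2 B2))%E.
  move=> us1 us2 mB1 mB2; rewrite evE oddE.
  rewrite (_ : _ `&` _ = rect (map double s1 ++ map (fun k => k.*2.+1) s2)
     (fun k => if odd k then B2 k./2 else B1 k./2)); last first.
    apply/seteqP; split => x /=.
      move=> [H1 H2] c; rewrite mem_cat => /orP[] /mapP[k ks ->] /=.
        by rewrite odd_double; apply: H1; exact: map_f.
      by rewrite odd_double; apply: (H2 k.*2.+1); apply/mapP; exists k.
    move=> H; split=> _ /mapP[k ks ->].
      have := H k.*2; rewrite odd_double; apply.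
      by rewrite mem_cat map_f.
    have := H k.*2.+1; rewrite /= odd_double; apply.
    by rewrite mem_cat; apply/orP; right; apply/mapP; exists k.
  rewrite !PE//.
  - rewrite big_cat/= !big_map; congr (_ * _)%E; apply: eq_bigr => k _.
      by rewrite odd_double doubleK.
    by rewrite /= odd_double/= uphalf_double.
  - rewrite cat_uniq (map_inj_uniq double_inj) us1/= map_inj_uniq ?us2 ?andbT//.
      apply/hasPn => _ /mapP[k ks ->]; apply/mapP => -[k' _ /(congr1 odd)] /=.
      by rewrite !odd_double.
    by move=> i j [] /double_inj.
have rectD s1 B1 (D : set coinspace) : uniq s1 -> (forall c, measurable (B1 c)) -> measurable D ->
    P (evens @^-1` (rect s1 B1) `&` odds @^-1` D) = (P (rect s1 B1) * P D)%E.
  move=> us1 mB1 mD.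
  have mR := @measurable_rect nat _ bool s1 B1 mB1.
  rewrite -(Pod D)// -(Pev (rect s1 B1))//.
  apply: indep_rect_ext => //; first exact: measurable_odds.
    exact: (measurable_preimT measurable_evens mR).
  move=> s2 B2 us2 mB2; rewrite rectrect// Pev// Pod//.
  exact: measurable_rect.
move=> C D mC mD.
rewrite setIC muleC -(Pod D)// -(Pev C)//.
apply: indep_rect_ext => //; first exact: measurable_evens.
  exact: (measurable_preimT measurable_odds mD).
move=> s1 B1 us1 mB1; rewrite setIC rectD// muleC Pod// Pev//.
exact: measurable_rect.
Qed.

End coins.

Definition iid_exponential (I : choiceType) (R : realType)
    (P : probability (seqspace I R) R) : Prop :=
  forall s B, uniq s -> (forall c, measurable (B c)) ->
    P (rect s B) = (\prod_(c <- s) expo (B c))%E.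

(** * From coins to exponential variables *)

Section binary_expansion.
Variable R : realType.
Local Notation coinspace := (seqspace nat bool).

Definition binary_part (n : nat) (s : nat -> bool) : R :=
  \sum_(k < n) (s k)%:R / 2 ^+ k.+1.

Lemma binary_part_nd s : {homo binary_part^~ s : m n / (m <= n)%N >-> m <= n}.
Proof.
apply/nondecreasing_seqP => n; rewrite /binary_part big_ord_recr/= lerDl.
by rewrite mulr_ge0// invr_ge0 exprn_ge0.
Qed.

Lemma binary_part_le1 n s : binary_part n s <= 1 - (2 ^+ n)^-1.
Proof.
elim: n => [|n IH]; first by rewrite /binary_part big_ord0 expr0 invr1 subrr.
rewrite /binary_part big_ord_recr/=; apply: le_trans (lerD IH (_ : _ <= (2 ^+ n.+1)^-1)) _.
  by rewrite ler_piMl ?invr_ge0 ?exprn_ge0//; case: (s n).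
by rewrite exprS invfM; lra.
Qed.

Definition binary (s : nat -> bool) : R := limn (binary_part^~ s).

Lemma cvg_binary s : binary_part^~ s @ \oo --> binary s.
Proof.
apply: nondecreasing_is_cvgn; first exact: binary_part_nd.
exists 1 => _ [n _ <-]; apply: le_trans (binary_part_le1 _ _) _.
by rewrite gerBl invr_ge0 exprn_ge0.
Qed.

Lemma measurable_binary : measurable_fun setT (binary : coinspace -> R).
Proof.
apply: (@measurable_fun_cvg _ coinspace R setT binary_part binary); last first.
  by move=> s _; exact: cvg_binary.
move=> n; rewrite /binary_part; apply: measurable_sum => k.
apply: measurable_funM => //.
rewrite (_ : (fun x : nat -> bool => _) = (fun x => if x k then 1 else 0)).
  by apply: measurable_fun_ifT => //; exact: measurable_coord.
by apply/funext => x; case: (x k).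
Qed.

Definition bits (x : R) (n : nat) : bool := half_bit (iter n dbl x).

Lemma dbl_ge0_le1 (x : R) : 0 <= x <= 1 -> 0 <= dbl x <= 1.
Proof.
rewrite /dbl /half_bit => /andP[x0 x1]; case: (leP 2^-1 x) => h /=.
  by apply/andP; split; lra.
by rewrite subr0; apply/andP; split; lra.
Qed.

(** After [n] digits the remainder is the [n]-th iterate of [dbl] divided by [2 ^+ n], and the
    iterate stays in the unit interval. *)
Lemma binary_bits (x : R) : 0 <= x <= 1 -> binary (bits x) = x.
Proof.
move=> x01; apply: cvg_lim => //.
have H n : 0 <= iter n dbl x <= 1 /\
    x = binary_part n (bits x) + iter n dbl x / 2 ^+ n.
  elim: n => [|n [IH0 IHE]].
    by rewrite /binary_part big_ord0 add0r expr0 divr1.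
  split.
    exact: dbl_ge0_le1.
  rewrite /binary_part big_ord_recr/= -/(binary_part n (bits x)) {1}IHE -addrA.
  congr (_ + _); rewrite /dbl -/(bits x n) exprS invfM mulrBl.
  by field; rewrite expf_neq0.
apply/cvgrPdist_le => e e0.
near=> n.
have [/andP[h0 h1] E] := H n.
rewrite {1}E addrC addKr ger0_norm ?divr_ge0 ?exprn_ge0//.
apply: (@le_trans _ _ ((2 ^+ n)^-1)).
  by rewrite ler_piMl ?invr_ge0 ?exprn_ge0.
have n2 : n%:R < 2 ^+ n :> R by rewrite -natrX ltr_nat ltn_expl.
apply: (@le_trans _ _ n%:R^-1).
  by rewrite lef_pV2 ?posrE ?exprn_gt0// ?ltr0n ?ltW//; near: n; exists 1%N.
rewrite invf_ple ?posrE// ?ltr0n//; last by near: n; exists 1%N.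
by near: n; exact: nbhs_infty_ger.
Unshelve. all: by end_near.
Qed.

Lemma unif_neg_ln (B : set R) : measurable B ->
  unif ((fun x => - ln x) @^-1` B) = expo B.
Proof.
move=> mB.
have mln : measurable_fun setT (fun x : R => - ln x).
  exact: measurableT_comp (@measurable_ln R).
have [m mE'] := pushforward_measureP (@unif R) mln.
have mE A : m A = unif ((fun x => - ln x) @^-1` A) by exact: mE'.
rewrite -mE; apply: (@measure_ray_unique R m (@expo R)) => // a; last first.
  rewrite mE; apply: (@le_lt_trans _ _ 1%E); last by rewrite ltry.
  by apply: probability_le1; exact: measurable_preimT.
rewrite mE; transitivity ((expR (- Num.max 0 a))%:E); last by symmetry; exact: expo_ray.
have mS : measurable ((fun x : R => - ln x) @^-1` `]a, +oo[%classic).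
  exact: measurable_preimT.
have [a0|a0] := ltP a 0.
  rewrite oppr0 expR0 (unif_in (B := `[0, 1]%classic))//.
    by rewrite unif_itv// subr0.
  apply/seteqP; split => x /=; rewrite !in_itv/= andbT => -[_ /andP[x0 x1]].
    by rewrite x0 x1.
  rewrite x0 x1; split => //; apply: (lt_le_trans a0).
  by rewrite oppr_ge0 ln_le0.
rewrite (unif_in (B := `]0, expR (- a)[%classic))//.
  rewrite unif_itv// ?subr0// ?expR_ge0//.
  by rewrite -expR0 ler_expR oppr_le0.
apply/seteqP; split => x /=; rewrite !in_itv/= ?andbT => -[h /andP[x0 x1]];
  rewrite x0 x1; split => //.
  have [x00|x00] := ltP 0 x.
    by rewrite -[x]lnK ?posrE// ltr_expR ltrNr.
  (* At 0 the logarithm takes the conventional value 0, which the ray from [a >= 0] excludes. *)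
  by move: h; rewrite ln0// oppr0 ltNge a0.
by move/andP: h => [x00 h]; rewrite ltrNr -ltr_expR lnK ?posrE.
Qed.

(** The orbit construction is used twice: on a uniform number, with [dbl], to get fair coins; then
    on coin sequences, where the even coins give one exponential variable [X] and the odd ones a
    fresh sequence to continue with. *)
Lemma exponential_iid (I : countType) :
  exists P : probability (seqspace I R) R, iid_exponential P.
Proof.
have [fair fairE] := pushforward_probabilityP (@unif R) (@measurable_half_bit R).
have [P1 [P1iid P1E]] := orbit_iid (@measurable_half_bit R) (@measurable_dbl R)
  (half_bit_dbl_law fairE) nat.
pose X (s : coinspace) := - ln (binary s).
have mX : measurable_fun setT X.
  by apply: measurableT_comp => //; exact: measurableT_comp (@measurable_ln R) measurable_binary.
have XE B : measurable B -> P1 (X @^-1` B) = expo B.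
  move=> mB; rewrite P1E -unif_neg_ln//.
  have mln : measurable_fun setT (fun x : R => - ln x).
    exact: measurableT_comp (@measurable_ln R).
  apply: unif_in.
  - apply: (@measurable_preimT _ _ _ coinspace (fun x (c : nat) => half_bit (iter (choice.pickle c) dbl x)) (X @^-1` B)).
      by apply: measurable_seqspace => c; exact: (measurable_orbit (@measurable_half_bit R) (@measurable_dbl R)).
    exact: measurable_preimT.
  - exact: measurable_preimT.
  - apply/seteqP; split => x [/= + x01]; rewrite /X (binary_bits x01) => xB; split=> //.
have law (A : set coinspace) B : measurable A -> measurable B ->
    P1 ((fun s => X (evens s)) @^-1` B `&` odds @^-1` A) = (expo B * P1 A)%E.
  move=> mA mB; rewrite -(XE B mB) -(evens_odds_indep P1iid)//.
  exact: measurable_preimT.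
have mXe : measurable_fun setT (fun s : coinspace => X (evens s)).
  exact: measurableT_comp mX measurable_evens.
have [P [PE _]] := orbit_iid mXe measurable_odds law I.
by exists P.
Qed.

End binary_expansion.

(** * Transformations preserving the law of independent exponentials *)

Lemma expo_memoryless (R : realType) (l : R) (C : set R) : 0 <= l -> measurable C ->
  expo [set x | l < x /\ C (x - l)] = ((expR (- l))%:E * expo C)%E.
Proof.
move=> l0 mC.
have mray : measurable `]l, +oo[%classic by [].
have msub : measurable_fun setT (fun x : R => x - l) by exact: measurable_funB.
have [m mE'] := pushforward_measureP (mrestr (@expo R) mray) msub.
have mE A : m A = expo [set x | l < x /\ A (x - l)].
  rewrite mE' /mrestr; congr expo; apply/seteqP; split=> x /=; rewrite in_itv/= andbT.
    by case.
  by case.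
have e0 : 0 <= expR (- l) by exact: expR_ge0.
pose m2 : {measure set R -> \bar R} := mscale (NngNum e0) (@expo R).
have m2E A : m2 A = ((expR (- l))%:E * expo A)%E by [].
rewrite -mE -m2E; apply: (@measure_ray_unique R m m2) => // a; last first.
  rewrite mE; apply: (@le_lt_trans _ _ 1%E); last by rewrite ltry.
  apply: probability_le1; rewrite (_ : [set x | l < x /\ _ (x - l)] = `]l, +oo[%classic `&`
    (fun x : R => x - l) @^-1` `]a, +oo[%classic).
    apply: measurableI => //; apply: measurable_preimT => //.
  by apply/seteqP; split=> x /=; rewrite !in_itv/= !andbT.
rewrite mE m2E (_ : [set x | _] = `](l + Num.max 0 a), +oo[%classic).
  rewrite !expo_ray.
  rewrite -EFinM -expRD; congr (expR _)%:E.
  rewrite [Num.max 0 (l + _)]max_r ?addr_ge0// ?le_max ?lexx//.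
  by rewrite opprD.
apply/seteqP; split=> x /=; rewrite !in_itv/= !andbT -ltrBrDl gt_max subr_gt0.
  by move=> [-> ->].
by move=> /andP[-> ->].
Qed.

(* When the first clock outlasts [l], its residue is a fresh clock, which trades
   places with the second one. *)
Definition swap_beyond (R : realType) (l : R) (p : R * R) : R * R :=
  if p.1 <= l then p else (l + p.2, p.1 - l).

Lemma swap_beyond_expo (R : realType) (l : R) : 0 <= l ->
  measurable_fun setT (swap_beyond l) /\
  forall A, measurable A ->
    (expo \x expo)%E (swap_beyond l @^-1` A) = ((@expo R) \x (@expo R))%E A.
Proof.
move=> l0.
have msw : measurable_fun setT (swap_beyond l).
  apply: measurable_fun_ifT => //; first exact: measurable_fun_ler.
  apply/measurable_fun_pairP; split; first exact: measurable_funD.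
  exact: measurable_funB.
split; first exact: msw.
move=> A mA.
have [m mE'] := pushforward_measureP ((@expo R) \x (@expo R))%E msw.
have mE X : m X = (expo \x expo)%E (swap_beyond l @^-1` X) by exact: mE'.
rewrite -mE; symmetry; apply: product_measure_unique => // B C mB mC.
rewrite mE.
have mBl : measurable (B `&` `]-oo, l]%classic) by exact: measurableI.
have mBr : measurable (B `&` `]l, +oo[%classic) by exact: measurableI.
have msub : measurable_fun setT (fun x : R => x - l) by exact: measurable_funB.
have madd : measurable_fun setT (fun x : R => l + x) by exact: measurable_funD.
have mCl : measurable [set x | l < x /\ C (x - l)].
  rewrite (_ : [set x | _] = `]l, +oo[ `&` (fun x : R => x - l) @^-1` C).
    by apply: measurableI => //; exact: measurable_preimT.
  by apply/seteqP; split=> x /=; rewrite in_itv/= andbT.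
have mBs : measurable [set y | B (l + y)] by exact: (measurable_preimT madd mB).
(* The two pieces correspond to a first clock that rings by [l] and to one that outlasts it. *)
have -> : swap_beyond l @^-1` (B `*` C) =
    ((B `&` `]-oo, l]%classic) `*` C) `|`
    ([set x | l < x /\ C (x - l)] `*` [set y | B (l + y)]).
  apply/seteqP; split=> -[x y] /=; rewrite /swap_beyond/= in_itv/=.
    by case: leP => h /= [Bx Cy]; [left|right].
  case: leP => h /= -[[]|[]]; first by move=> [].
  - by case.
  - by case.
  - by move=> [_ Cx] Bx.
transitivity (expo B * expo C)%E; last by [].
set V := [set x | l < x /\ C (x - l)]; set V' := [set y | B (l + y)].
transitivity ((expo \x expo) ((B `&` `]-oo, l]%classic) `*` C) +
    (expo \x expo) (V `*` V'))%E.
  apply: measureU; [exact: measurableX..|].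
  apply/seteqP; split=> -[x y] //= [[[_ +] _] [[+ _] _]].
  by rewrite in_itv/= leNgt => /negP.
transitivity (expo (B `&` `]-oo, l]%classic) * expo C + expo V * expo V')%E.
  by congr (_ + _)%E; exact: product_measure1E.
rewrite /V expo_memoryless//.
have -> : expo B = (expo (B `&` `]-oo, l]%classic) + expo (B `&` `]l, +oo[%classic))%E.
  rewrite -measureU//; first by rewrite -setIUr itv_setU_setT setIT.
  apply/seteqP; split=> x //= [[_ +] [_]]; rewrite !in_itv/= andbT leNgt.
  by move=> /negP.
(* Memorylessness is used in both directions: the factor [expR (- l)] produced by the first clock is
   what turns the law of the shifted second clock back into [expo] of [B] beyond [l]. *)
have -> : B `&` `]l, +oo[%classic = [set x | l < x /\ [set y | B (l + y)] (x - l)].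
  apply/seteqP; split=> x /=; rewrite in_itv/= andbT addrC subrK; first by case.
  by case.
rewrite expo_memoryless// ge0_muleDl ?mule_ge0//.
by rewrite -muleA (muleC (expo C)) muleA.
Qed.

Lemma xsectionP T1 T2 (A : set (T1 * T2)) x y : xsection A x y = A (x, y).
Proof. by apply/propext; rewrite /xsection /= inE. Qed.

Section preserves.
Context d (T : measurableType d) (R : realType) (P : probability T R).

Definition preserves (f : T -> T) : Prop :=
  measurable_fun setT f /\ forall A, measurable A -> P (f @^-1` A) = P A.

Lemma preserves_id : preserves id.
Proof. by split. Qed.

Lemma preserves_comp f g : preserves f -> preserves g -> preserves (f \o g).
Proof.
move=> [mf fE] [mg gE]; split; first exact: measurableT_comp mf mg.
by move=> A mA; rewrite comp_preimage gE ?fE//; exact: measurable_preimT.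
Qed.

(** The transformation may depend on the point as long as it does not alter the information used to
    choose it: on each event [pick w = j] it is the map [f j], and this event is its own
    preimage. *)
Lemma preserves_choose (J : finType) (pick : T -> J) (f : J -> T -> T) :
  (forall j, preserves (f j)) -> (forall j, measurable [set w | pick w = j]) ->
  (forall j w, pick (f j w) = pick w) -> preserves (fun w => f (pick w) w).
Proof.
move=> fP mD fpick.
have finJ : finite_set [set: J] by exact: finite_finset.
have sumE A : measurable A ->
    P A = (\sum_(j \in [set: J]) P (A `&` [set w | pick w = j]))%E.
  move=> mA; rewrite -measure_fin_bigcup//.
  - by congr (P _); apply/seteqP; split=> w; [exists (pick w)|move=> [j _ []]].
  - by move=> i j _ _ [w [[_ /= <-] [_ /= <-]]].
  - by move=> j _; exact: measurableI.
have preE A j : (fun w => f (pick w) w) @^-1` A `&` [set w | pick w = j] =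
    f j @^-1` (A `&` [set w | pick w = j]).
  apply/seteqP; split=> w /=; first by move=> [+ pw]; rewrite fpick pw.
  by rewrite fpick => -[+ pw]; rewrite pw.
have mf : measurable_fun setT (fun w => f (pick w) w).
  move=> _ A mA; rewrite setTI.
  rewrite (_ : _ @^-1` _ = \bigcup_(j in [set: J])
      (f j @^-1` (A `&` [set w | pick w = j]))).
    apply: fin_bigcup_measurable => // j _.
    by apply: (measurable_preimT (fP j).1); exact: measurableI.
  apply/seteqP; split=> w /=.
    by move=> Aw; exists (pick w) => //; rewrite -preE.
  by move=> [j _]; rewrite -preE => -[].
split=> // A mA; rewrite (sumE A)// (sumE (_ @^-1` _)); last exact: measurable_preimT.
apply: eq_fsbigr => j _; rewrite preE (fP j).2//.
exact: measurableI.
Qed.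

End preserves.

Section iid_sequence.
Context (I : choiceType) (R : realType) (P : probability (seqspace I R) R).
Hypothesis Piid : iid_exponential P.

Local Notation T := (seqspace I R).

Definition upd (w : I -> R) (c : I) (x : R) : I -> R :=
  fun c' => if c' == c then x else w c'.

Lemma preserves_reindex (s s' : I -> I) : cancel s s' ->
  preserves P (fun w c => w (s c)).
Proof.
move=> sK.
have ms : measurable_fun setT ((fun w c => w (s c)) : T -> T).
  by apply: measurable_seqspace => c; exact: measurable_coord.
split=> // A mA.
have [m mE'] := pushforward_measureP P ms.
have mE X : m X = P ((fun w c => w (s c)) @^-1` X) by exact: mE'.
rewrite -mE; apply: (@seqspace_measure_unique I _ R R m P) => //.
  move=> r B ur mB; rewrite mE.
  transitivity (\prod_(c <- r) expo (B c))%E; last by symmetry; exact: Piid.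
  rewrite (_ : _ @^-1` _ = rect (map s r) (B \o s')); last first.
    apply/seteqP; split=> w /= H c; last first.
      by move=> cr; have := H (s c); rewrite /= sK; apply; exact: map_f.
    by move=> /mapP[c' cr ->]; rewrite /= sK; exact: H.
  rewrite Piid; [|by rewrite (map_inj_uniq (can_inj sK))|by move=> c; exact: mB].
  by rewrite big_map; apply: eq_bigr => c _ /=; rewrite sK.
by rewrite mE preimage_setT probability_setT ltry.
Qed.

Lemma preserves_coordwise (f : R -> R) : measurable_fun setT f ->
  (forall B, measurable B -> expo (f @^-1` B) = expo B) ->
  preserves P (fun w c => f (w c)).
Proof.
move=> mf fE.
have ms : measurable_fun setT ((fun w c => f (w c)) : T -> T).
  by apply: measurable_seqspace => c; apply: measurableT_comp => //; exact: measurable_coord.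
split=> // A mA.
have [m mE'] := pushforward_measureP P ms.
have mE X : m X = P ((fun w c => f (w c)) @^-1` X) by exact: mE'.
rewrite -mE; apply: (@seqspace_measure_unique I _ R R m P) => //.
  move=> r B ur mB; rewrite mE.
  transitivity (\prod_(c <- r) expo (B c))%E; last by symmetry; exact: Piid.
  transitivity (\prod_(c <- r) expo (f @^-1` (B c)))%E.
    by apply: Piid => // c; exact: measurable_preimT.
  by apply: eq_bigr => c _; exact: fE.
by rewrite mE preimage_setT probability_setT ltry.
Qed.

Lemma expo_prob_coord c B : measurable B -> P [set w | B (w c)] = expo B.
Proof.
move=> mB; have := @Piid [:: c] (fun=> B) isT (fun=> mB).
rewrite big_seq1 => <-; congr (P _); apply/seteqP; split=> w /= H; last first.
  by apply: H; rewrite inE.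
by move=> c'; rewrite inE => /eqP ->.
Qed.

Lemma measurable_upd2 a b :
  measurable_fun setT (fun p : T * (R * R) => upd (upd p.1 a p.2.1) b p.2.2 : T).
Proof.
apply: measurable_seqspace => c; rewrite /upd.
case: (c == b); first by apply: measurableT_comp => //; exact: measurable_snd.
case: (c == a); first by apply: measurableT_comp => //; apply: measurableT_comp => //; exact: measurable_snd.
by apply: measurableT_comp (measurable_coord c) _; exact: measurable_fst.
Qed.

Let expo2 : probability (R * R)%type R := (expo \x expo)%E.

(** Resampling two coordinates does not change the law. With Fubini this reduces a map acting on two
    coordinates to a map of the plane. *)
Lemma upd2_law a b (A : set T) : a != b -> measurable A ->
  (P \x expo2)%E ((fun p => upd (upd p.1 a p.2.1) b p.2.2) @^-1` A) = P A.
Proof.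
move=> ab mA.
pose PQ : probability (T * (R * R))%type R := (P \x expo2)%E.
have [m mE'] := pushforward_measureP PQ (measurable_upd2 a b).
have mE X : m X = (P \x expo2)%E ((fun p => upd (upd p.1 a p.2.1) b p.2.2) @^-1` X) by exact: mE'.
rewrite -mE; apply: (@seqspace_measure_unique I _ R R m P) => //; last first.
  have -> : m setT = 1%E by rewrite mE'; exact: (probability_setT PQ).
  by rewrite ltry.
move=> s B us mB.
pose r := [seq c <- s | (c != a) && (c != b)].
(* Listing [a] and [b] explicitly, with the full set where [s] leaves them free, makes the preimage
   a product set. *)
pose B' c := if c \in s then B c else setT.
have mB' c : measurable (B' c) by rewrite /B'; case: ifP.
have ur : uniq [:: a, b & r].
  by rewrite /= !inE negb_or ab !mem_filter !eqxx /= andbF/= filter_uniq.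
have E : rect s B = rect [:: a, b & r] B'.
  apply/seteqP; split=> w /= H c; rewrite ?inE.
    by move=> _; rewrite /B'; case: ifP => // cs; exact: H.
  move=> cs; have := H c; rewrite /B' cs; apply.
  by rewrite !inE mem_filter cs andbT; case: eqVneq => //= _; case: eqVneq.
rewrite E mE.
have -> : (fun p : T * (R * R) => upd (upd p.1 a p.2.1) b p.2.2) @^-1` (rect [:: a, b & r] B') =
    rect r B' `*` (B' a `*` B' b).
  apply/seteqP; split=> -[w [x y]] /=.
    move=> H; split; last first.
      split; [have := H a|have := H b]; rewrite !inE eqxx ?orbT => /(_ isT).
        by rewrite /upd (negbTE ab) eqxx.
      by rewrite /upd eqxx.
    move=> c cr; have := H c; rewrite !inE cr !orbT => /(_ isT).
    by move: cr; rewrite /upd mem_filter => /andP[/andP[/negbTE -> /negbTE ->]].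
  move=> [H [Ha Hb]] c; rewrite /upd !inE; case: eqVneq => [->|ca] /=.
    by rewrite (negbTE ab).
  by case: eqVneq => [->//|cb] /=; exact: H.
rewrite product_measure1E//; last 2 first.
- exact: measurable_rect.
- exact: measurableX.
transitivity (\prod_(c <- [:: a, b & r]) expo (B' c))%E; last by symmetry; exact: Piid.
rewrite !big_cons muleA muleC; congr (_ * _)%E; first exact: product_measure1E.
by apply: Piid => //; move: ur => /= /and3P[].
Qed.

Definition swap_coords (l : T -> R) (a b : I) (w : T) : T :=
  let p := swap_beyond (l w) (w a, w b) in upd (upd w a p.1) b p.2.

Lemma swap_coords_upd (l : T -> R) a b w x y : a != b ->
  (forall w x, l (upd w a x) = l w) -> (forall w x, l (upd w b x) = l w) ->
  swap_coords l a b (upd (upd w a x) b y) =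
    upd (upd w a (swap_beyond (l w) (x, y)).1) b (swap_beyond (l w) (x, y)).2.
Proof.
move=> ab la lb; rewrite /swap_coords lb la /upd (negbTE ab) !eqxx.
by apply/funext => c; case: (c == b); case: (c == a).
Qed.

(** Once the other coordinates are frozen, [l] is a constant and [swap_beyond_expo] applies on each
    section. *)
Lemma preserves_swap_coords (l : T -> R) a b : a != b ->
  measurable_fun setT l -> (forall w, 0 <= l w) ->
  (forall w x, l (upd w a x) = l w) -> (forall w x, l (upd w b x) = l w) ->
  preserves P (swap_coords l a b).
Proof.
move=> ab ml l0 la lb.
have mS : measurable_fun setT (swap_coords l a b).
  apply: measurable_seqspace => c; rewrite /swap_coords /swap_beyond /upd.
  have ma := @measurable_coord I _ R a; have mb := @measurable_coord I _ R b.
  have mle : measurable_fun setT (fun w : T => w a <= l w) by exact: measurable_fun_ler.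
  case: (c == b).
    rewrite (_ : (fun _ => _) = (fun w : T => if w a <= l w then w b else w a - l w)).
      by apply: measurable_fun_ifT => //; exact: measurable_funB.
    by apply/funext => w /=; case: ifP.
  case: (c == a); last exact: measurable_coord.
  rewrite (_ : (fun _ => _) = (fun w : T => if w a <= l w then w a else l w + w b)).
    by apply: measurable_fun_ifT => //; exact: measurable_funD.
  by apply/funext => w /=; case: ifP.
split; first exact: mS.
move=> A mA.
rewrite -(upd2_law ab mA) -(upd2_law ab (measurable_preimT mS mA)).
rewrite /product_measure1; apply: eq_integral => w _ /=.
have mX := measurable_preimT (measurable_upd2 a b) mA.
have E := (swap_beyond_expo (l0 w)).2 _ (measurable_xsection w mX).
apply: etrans; last exact: E.
rewrite /product_measure1; apply: eq_integral => x _ /=; congr (expo _).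
apply/funext => y.
by rewrite !xsectionP /= swap_coords_upd// xsectionP.
Qed.

Lemma measurable_upd c : measurable_fun setT (fun p : T * R => upd p.1 c p.2 : T).
Proof.
apply: measurable_seqspace => c'; rewrite /upd.
case: (c' == c); first exact: measurable_snd.
by apply: measurableT_comp (measurable_coord c') _; exact: measurable_fst.
Qed.

Lemma upd_law c (A : set T) : measurable A ->
  (P \x expo)%E ((fun p => upd p.1 c p.2) @^-1` A) = P A.
Proof.
move=> mA.
pose PQ : probability (T * R)%type R := (P \x expo)%E.
have [m mE'] := pushforward_measureP PQ (measurable_upd c).
have mE X : m X = (P \x expo)%E ((fun p => upd p.1 c p.2) @^-1` X) by exact: mE'.
rewrite -mE; apply: (@seqspace_measure_unique I _ R R m P) => //; last first.
  have -> : m setT = 1%E by rewrite mE'; exact: (probability_setT PQ).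
  by rewrite ltry.
move=> s B us mB.
pose r := [seq c' <- s | c' != c].
pose B' c' := if c' \in s then B c' else setT.
have mB' c' : measurable (B' c') by rewrite /B'; case: ifP.
have ur : uniq [:: c & r].
  by rewrite /= mem_filter !eqxx/= filter_uniq.
have E : rect s B = rect [:: c & r] B'.
  apply/seteqP; split=> w /= H c'; rewrite ?inE.
    by move=> _; rewrite /B'; case: ifP => // cs; exact: H.
  move=> cs; have := H c'; rewrite /B' cs; apply.
  by rewrite !inE mem_filter cs andbT; case: eqVneq.
rewrite E mE.
have -> : (fun p : T * R => upd p.1 c p.2) @^-1` (rect [:: c & r] B') =
    rect r B' `*` B' c.
  apply/seteqP; split=> -[w x] /=.
    move=> H; split; last first.
      by have := H c; rewrite !inE eqxx ?orbT => /(_ isT); rewrite /upd eqxx.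
    move=> c' cr; have := H c'; rewrite !inE cr !orbT => /(_ isT).
    by move: cr; rewrite /upd mem_filter => /andP[/negbTE ->].
  move=> [H Hc] c'; rewrite /upd !inE; case: eqVneq => [->//|cc'] /=.
  exact: H.
rewrite product_measure1E//; last exact: measurable_rect.
transitivity (\prod_(c' <- [:: c & r]) expo (B' c'))%E; last by symmetry; exact: Piid.
rewrite big_cons muleC; congr (_ * _)%E.
by apply: Piid => //; move: ur => /= /andP[].
Qed.

Lemma prob_le_coord c (A : set T) (q : \bar R) : measurable A -> (0 <= q)%E ->
  (forall w, measurable [set x | A (upd w c x)] ->
     expo [set x | A (upd w c x)] <= q)%E -> (P A <= q)%E.
Proof.
move=> mA q0 Aq; rewrite -(upd_law c mA) /product_measure1.
have mX := measurable_preimT (measurable_upd c) mA.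
apply: (@le_trans _ _ (\int[P]_w q)%E).
  apply: ge0_le_integral => //.
  - exact: measurable_fun_xsection.
  - move=> w _ /=.
    have -> : xsection ((fun p : T * R => upd p.1 c p.2) @^-1` A) w =
        [set x | A (upd w c x)].
      by apply/seteqP; split=> x; rewrite xsectionP.
    apply: Aq; have := measurable_xsection w mX.
    by congr measurable; apply/seteqP; split=> x; rewrite xsectionP.
have -> : (\int[P]_w q = q * P setT)%E by exact: integral_cst.
by rewrite probability_setT mule1.
Qed.

End iid_sequence.

(** * Truncated sums and the matching of tasks *)

Section heights.
Variable N : nat.
Implicit Types h : 'I_N -> nat.

Definition trunc_sum (m : nat) h : nat := (\sum_v minn (h v) m)%N.
Definition low_tasks (m : nat) h : nat := (\sum_(v | (h v <= m)%N) h v)%N.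
Definition add_task h (v : 'I_N) : 'I_N -> nat := fun w => (h w + (w == v))%N.

Lemma trunc_sum_le m h : (trunc_sum m h <= m * N)%N.
Proof.
rewrite -[X in (_ * X)%N]card_ord mulnC -sum_nat_const leq_sum// => v _.
exact: geq_minr.
Qed.

Lemma trunc_sumS m h : trunc_sum m.+1 h = (trunc_sum m h + at_least h m.+1)%N.
Proof.
rewrite /at_least -sum1_card [X in (_ + X)%N]big_mkcond -big_split/=.
by apply: eq_bigr => v _; rewrite inE; case: leqP; lia.
Qed.

Lemma low_tasksE m h :
  (low_tasks m h + m * trunc_sum m.+1 h = m.+1 * trunc_sum m h)%N.
Proof.
rewrite /low_tasks /trunc_sum big_mkcond !big_distrr/= -big_split/=.
apply: eq_bigr => v _; case: leqP => hm; first by rewrite !(minn_idPl _) //; lia.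
rewrite !(minn_idPr _) //; lia.
Qed.

Lemma trunc_sum_add m h v : trunc_sum m (add_task h v) = (trunc_sum m h + (h v < m))%N.
Proof.
rewrite /trunc_sum (bigD1 v)//= [in RHS](bigD1 v)//= /add_task eqxx.
rewrite (eq_bigr (fun w => minn (h w) m)); last by move=> w /negbTE ->; rewrite addn0.
lia.
Qed.

Lemma trunc_sum_cap m b h : (forall v, h v <= b)%N -> (trunc_sum m h <= minn m b * N)%N.
Proof.
move=> hb; rewrite -[X in (_ * X)%N]card_ord mulnC -sum_nat_const leq_sum// => v _.
by have := hb v; lia.
Qed.

Lemma trunc_sum_ge m b n h : (#|[set w | h w < b]%SET| <= n)%N ->
  (minn m b * N <= trunc_sum m h + minn m b * n)%N.
Proof.
move=> hn; apply: (@leq_trans (trunc_sum m h + minn m b * #|[set w | h w < b]%SET|)%N).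
  rewrite -[X in (_ * X <= _)%N]card_ord mulnC -sum_nat_const mulnC.
  rewrite -sum_nat_const [X in (_ + X)%N]big_mkcond -big_split/= leq_sum// => v _.
  by rewrite inE; case: ifP; lia.
by rewrite leq_add2l leq_mul2l hn orbT.
Qed.

(** The slack has to be linear in [m]: in the identity of [low_tasksE] its contributions
    [m.+1 * (m * c)] and [m * (m.+1 * c)] cancel, so a bound tight at [m] still compares the low
    tasks. *)
Definition dominates (c : nat) h1 h2 : Prop := forall m,
  (trunc_sum m h2 <= trunc_sum m h1)%N /\ (trunc_sum m h1 <= trunc_sum m h2 + m * c)%N.

Lemma dominates_occupancy c h1 h2 i : dominates c h1 h2 -> (0 < i)%N ->
  (at_least h1 i <= at_least h2 i + i * c)%N /\ (at_least h2 i <= at_least h1 i + i * c)%N.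
Proof.
case: i => // i D _; have := D i; have := D i.+1; rewrite !trunc_sumS; nia.
Qed.

Definition receive (B : capacity) h v : 'I_N -> nat :=
  if has_room B (h v) then add_task h v else h.

Definition capped (B : capacity) h : Prop := forall b v, B = Some b -> (h v <= b)%N.

Lemma capped_receive B h v : capped B h -> capped B (receive B h v).
Proof.
move=> hB b w Bb; rewrite /receive; have := hB b w Bb.
by case: ifP => //; rewrite Bb /add_task/=; case: eqVneq => [->|_]; lia.
Qed.

Lemma trunc_sum_receive m B h v :
  trunc_sum m (receive B h v) = (trunc_sum m h + (has_room B (h v) && (h v < m)))%N.
Proof.
by rewrite /receive; case: ifP => //= _; rewrite ?trunc_sum_add ?addn0.
Qed.

Lemma has_roomN B k : has_room B k = false -> exists2 b, B = Some b & (b <= k)%N.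
Proof. by case: B => //= b; rewrite ltnNge => /negbFE bk; exists b. Qed.

(** If the lowest pool of system 1 has height at least [m], its sum is already the maximum [m * N].
    Otherwise system 1 gains a unit, unless its lowest pool is full; then all its pools are full and
    no configuration within capacity has a larger sum. *)
Lemma dominates_arrival_low B c h1 h2 v1 v2 : capped B h1 -> capped B h2 ->
  (forall w, h1 v1 <= h1 w)%N -> dominates c h1 h2 ->
  forall m, (trunc_sum m (receive B h2 v2) <= trunc_sum m (receive B h1 v1))%N.
Proof.
move=> cap1 cap2 min1 D m.
have full a : (forall w, a <= h1 w)%N -> (minn m a * N <= trunc_sum m h1)%N.
  move=> ha; have := @trunc_sum_ge m a 0 h1; rewrite muln0 addn0; apply.
  by rewrite leqn0 cards_eq0; apply/eqP/setP => w; rewrite !inE ltnNge ha.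
have [ma|am] := leqP m (h1 v1).
  have := full _ min1; rewrite (minn_idPl ma) => F.
  apply: (leq_trans (trunc_sum_le _ _)); apply: (leq_trans F).
  by rewrite trunc_sum_receive leq_addr.
rewrite [X in (_ <= X)%N]trunc_sum_receive am andbT.
case R1 : has_room.
  by rewrite trunc_sum_receive; have [] := D m; case: (_ && _); lia.
have [b Bb bv] := has_roomN R1; rewrite addn0.
have bw w : (b <= h1 w)%N by apply: leq_trans bv (min1 w).
apply: leq_trans (full _ bw); apply: trunc_sum_cap => v.
exact: (capped_receive v2 cap2).
Qed.

(** If system 2 gains a unit the bound is clear. If not, the receiving pool is full or has height at
    least [m], and all but [n] pools are at least as high as it; so system 2 is within [m * n] of
    the largest possible sum. *)
Lemma dominates_arrival B n c h1 h2 v1 v2 : capped B h1 -> capped B h2 ->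
  (forall w, h1 v1 <= h1 w)%N -> (#|[set w | h2 w < h2 v2]%SET| <= n)%N -> (n <= c)%N ->
  dominates c h1 h2 -> dominates c (receive B h1 v1) (receive B h2 v2).
Proof.
move=> cap1 cap2 min1 low2 nc D m; split; first exact: (dominates_arrival_low v2 cap1 cap2 min1 D).
have [_ U] := D m.
have [room2|noroom] := boolP (has_room B (h2 v2) && (h2 v2 < m)%N).
  by rewrite !trunc_sum_receive room2; case: (_ && _); lia.
have -> : trunc_sum m (receive B h2 v2) = trunc_sum m h2.
  by rewrite trunc_sum_receive (negbTE noroom) addn0.
(* The level at which both sums saturate: [m] itself, or what [m] becomes when truncated at the
   capacity. *)
pose m' := minn m (h2 v2).
have F := @trunc_sum_ge m _ _ _ low2.
suff : (trunc_sum m (receive B h1 v1) <= m' * N)%N.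
  have : (m' * n <= m * c)%N by apply: leq_mul => //; exact: geq_minl.
  by rewrite /m'; lia.
move: noroom; rewrite negb_and -leqNgt => /orP[/negbTE R2|mh].
  have [b Bb bv] := has_roomN R2.
  have -> : m' = minn m b by rewrite /m'; have := cap2 b v2 Bb; lia.
  by apply: trunc_sum_cap => v; exact: (capped_receive v1 cap1).
by rewrite /m' (minn_idPl mh); exact: trunc_sum_le.
Qed.

(** An arrival changes a truncated sum by at most one, and raising [c] by one pays [m] units; at
    [m = 0] both sums vanish. *)
Lemma dominates_arrival_bad B c h1 h2 v1 v2 : capped B h1 -> capped B h2 ->
  (forall w, h1 v1 <= h1 w)%N -> dominates c h1 h2 ->
  dominates c.+1 (receive B h1 v1) (receive B h2 v2).
Proof.
move=> cap1 cap2 min1 D m; split; first exact: (dominates_arrival_low v2 cap1 cap2 min1 D).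
have [_ U] := D m; rewrite !trunc_sum_receive mulnS.
move: (m * c)%N U => mc U.
have := leq_b1 (has_room B (h1 v1) && (h1 v1 < m)%N).
by case: m U => [|m] U; rewrite ?ltn0 ?andbF; lia.
Qed.

Lemma dominates_departure c h1 h2 h1' h2' (d1 d2 : nat -> bool) :
  (forall m, trunc_sum m h1 = trunc_sum m h1' + d1 m)%N ->
  (forall m, trunc_sum m h2 = trunc_sum m h2' + d2 m)%N ->
  (forall m, (low_tasks m h1 <= low_tasks m h2)%N -> d1 m -> d2 m) ->
  (forall m, (low_tasks m h2 <= low_tasks m h1)%N -> d2 m -> d1 m) ->
  dominates c h1 h2 -> dominates c h1' h2'.
Proof.
move=> E1 E2 d12 d21 D m.
have := D m; have := D m.+1; have := low_tasksE m h1; have := low_tasksE m h2.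
have := d12 m; have := d21 m; have := E1 m; have := E2 m.
case: (d1 m); case: (d2 m) => e2 e1 i21 i12 l2 l1 [a1 b1] [a b]; rewrite ?addn0 in e1 e2; split; try lia.
  (* Only system 1 loses a unit: the lower bound fails only if it was tight, and then the lower
     bound at [m.+1] forces system 2 to lose one too. *)
  have [lt|le] := ltnP (trunc_sum m h2) (trunc_sum m h1); first by lia.
  have eq : trunc_sum m h1 = trunc_sum m h2 by lia.
  by suff /i12/(_ isT) : (low_tasks m h1 <= low_tasks m h2)%N by []; nia.
(* Only system 2 loses a unit: the same argument with the upper bounds at [m] and [m.+1]. *)
have [lt|le] := ltnP (trunc_sum m h1) (trunc_sum m h2 + m * c); first by lia.
have eq : trunc_sum m h1 = (trunc_sum m h2 + m * c)%N by lia.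
by suff /i21/(_ isT) : (low_tasks m h2 <= low_tasks m h1)%N by []; nia.
Qed.

End heights.

(** * Matching in the order of the keys *)

Section matching.
Variable T : finType.
Implicit Types k : T -> nat.

Definition order_coupled k1 k2 (p : {perm T}) : Prop := forall r,
  ((#|[set c | k1 c <= r]%SET| <= #|[set c | k2 c <= r]%SET|)%N ->
     forall c, (k1 c <= r -> k2 (p c) <= r)%N) /\
  ((#|[set c | k2 c <= r]%SET| <= #|[set c | k1 c <= r]%SET|)%N ->
     forall c, (k2 (p c) <= r -> k1 c <= r)%N).

Lemma sorted_key_nth k (s : seq T) x0 i r : sorted (fun x y => k x <= k y)%N s ->
  (i < size s)%N -> (k (nth x0 s i) <= r)%N = (i < count (fun x => k x <= r)%N s)%N.
Proof.
move=> ss si.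
have tr : transitive (fun x y => k x <= k y)%N by move=> y x z; exact: leq_trans.
move: ss; rewrite (sorted_pairwise tr) -{1}(cat_take_drop i s) (drop_nth x0 si).
rewrite pairwise_cat /= => /and3P[/allrelP lo _ /andP[/allP hi _]].
rewrite -{2}(cat_take_drop i s) (drop_nth x0 si) count_cat /=.
have sz : size (take i s) = i by rewrite size_takel// ltnW.
case: (leqP (k (nth x0 s i)) r) => h.
  have /eqP -> : count (fun x => k x <= r)%N (take i s) == i.
    rewrite -{2}sz -all_count; apply/allP => x xs.
    by apply: leq_trans h; apply: lo => //; rewrite inE eqxx.
  by apply/esym; lia.
have -> : count (fun x => k x <= r)%N (drop i.+1 s) = 0%N.
  apply/eqP; rewrite -leqn0 leqNgt -has_count; apply/hasPn => x xs.
  by rewrite -ltnNge; apply: leq_trans h (hi _ xs).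
rewrite !addn0; apply/esym/negbTE; rewrite -leqNgt -{2}sz; exact: count_size.
Qed.

(** Elements of equal rank in the two sorted lists are matched. The elements with key at most [r]
    form a prefix of each list, so the shorter prefix is carried into the longer one. *)
Lemma matching_ex k1 k2 : exists p : {perm T}, order_coupled k1 k2 p.
Proof.
pose sr k := sort (fun x y => k x <= k y)%N (enum T).
have szE k : size (sr k) = #|T| by rewrite size_sort -cardE.
have inE' k c : c \in sr k by rewrite mem_sort mem_enum.
have uE k : uniq (sr k) by rewrite sort_uniq enum_uniq.
have srt k : sorted (fun x y => k x <= k y)%N (sr k).
  by apply: sort_sorted => x y; exact: leq_total.
have cnt k r : count (fun x => k x <= r)%N (sr k) = #|[set c | (k c <= r)%N]%SET|.
  rewrite cardE -size_filter; apply/perm_size/uniq_perm.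
  - by rewrite filter_uniq.
  - exact: enum_uniq.
  - by move=> c; rewrite mem_filter mem_enum inE inE' andbT.
pose f c := nth c (sr k2) (index c (sr k1)).
have ilt c : (index c (sr k1) < size (sr k2))%N.
  by rewrite szE -(szE k1) index_mem inE'.
have finj : injective f.
  move=> c c'; rewrite /f (set_nth_default c') ?ilt// => /eqP.
  rewrite nth_uniq ?ilt ?uE// => /eqP /(congr1 (nth c (sr k1))).
  by rewrite !nth_index ?inE'.
exists (perm finj) => r; split=> H c; rewrite permE.
  rewrite -{1}(nth_index c (inE' k1 c)) sorted_key_nth ?index_mem ?inE'//.
  by rewrite sorted_key_nth// !cnt => /leq_trans; apply.
rewrite -{2}(nth_index c (inE' k1 c)) sorted_key_nth//.
by rewrite sorted_key_nth ?index_mem ?inE'// !cnt => /leq_trans; apply.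
Qed.

(** Keys are finite functions because these form a countable type; measurability of the matching
    then follows from that of the keys. *)
Definition matching (k1 k2 : {ffun T -> nat}) : {perm T} :=
  sval (cid (matching_ex k1 k2)).

Lemma matchingP (k1 k2 : {ffun T -> nat}) : order_coupled k1 k2 (matching k1 k2).
Proof. exact: svalP. Qed.

End matching.

(** * Comparison of two coupled systems *)

Section tasks.
Context (R : realType) (N K M : nat).

(** Only the first [K] arrivals and [M] initial slots per pool are recorded, so that tasks form a
    finite type and can be permuted. *)
Definition task : finType := ('I_K + 'I_N * 'I_M)%type.
Definition ntask : nat := #|{: task}|.
Implicit Types (u : input R N) (c : task) (t : R) (x : config N)
  (ds : seq (option 'I_N)).

Definition trank c : nat := enum_rank c.

Lemma trank_inj : injective trank.
Proof. by move=> c c' /val_inj; exact: enum_rank_inj. Qed.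

Definition birth u c : R := if c is inl k then arrival_time u k else 0.
Definition duration u c : R :=
  match c with inl k => work u k | inr vj => residual u vj.1 vj.2 end.
Definition death u c : R := birth u c + duration u c.
Definition alive u t c : bool := birth u c <= t < death u c.

(* [None] for the tasks that do not occupy a pool: those discarded at their
   arrival, and the padding [j >= x v] of the list of initial tasks. *)
Definition assigned x ds c : option 'I_N :=
  match c with
  | inl k => nth None ds k
  | inr vj => if (vj.2 < x vj.1)%N then Some vj.1 else None
  end.

Definition in_pool x ds v (A : {set task}) : {set task} :=
  [set c in A | assigned x ds c == Some v]%SET.
Definition alive_set u t : {set task} := [set c | alive u t c]%SET.
Definition height x u ds t (v : 'I_N) : nat := #|in_pool x ds v (alive_set u t)|.

Lemma height_le x u ds t v : (height x u ds t v <= ntask)%N.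
Proof. exact: max_card. Qed.

Lemma heightE x u ds t v : (forall w, x w <= M)%N -> (size ds <= K)%N -> 0 <= t ->
  height x u ds t v = config_after x u ds t v.
Proof.
move=> xM dsK t0; rewrite /height /in_pool /config_after ffunE.
rewrite -sum1_card big_mkcond big_sumType /= addnC; congr (_ + _)%N.
  pose F w (j : 'I_M) := (if inr (w, j) \in
    in_pool x ds v (alive_set u t) then 1 else 0)%N.
  transitivity (\sum_p F p.1 p.2)%N; first by apply: eq_bigr => -[].
  rewrite -(pair_bigA _ F)/= /F /in_pool.
  rewrite (bigD1 v)//= [X in (_ + X)%N]big1 ?addn0; last first.
    move=> w wv; apply: big1 => j _; rewrite !inE /=; case: ifP => // /andP[_].
    by case: ifP => // _ /eqP[] /eqP; rewrite (negbTE wv).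
  rewrite /initial_active (big_ord_widen M (fun j => (t < residual u v j)%R : nat))//.
  rewrite [RHS]big_mkcond/=; apply: eq_bigr => j _; rewrite !inE /alive /death /=.
  by rewrite t0 add0r; case: (j < x v)%N; rewrite ?eqxx; case: (t < _).
rewrite (big_ord_widen K (fun k => ((nth None ds k == Some v) && in_service u k t) : nat))//.
rewrite [RHS]big_mkcond/=; apply: eq_bigr => k _; rewrite !inE /alive /death /in_service/=.
case: ltnP => [_|kds]; first by rewrite andbC; case: (_ && _).
by rewrite nth_default// andbF.
Qed.

(* Tasks are matched in the order of their keys: first those in service, by the
   height of their pool, then the discarded ones, the dead ones, and the unborn
   ones, whose keys are distinct so that they are matched with themselves. *)
Definition key x u ds t : {ffun task -> nat} := [ffun c =>
  if alive u t c then
    if assigned x ds c is Some v then height x u ds t v else ntask.+1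
  else if birth u c <= t then ntask.+2 else (ntask.+3 + trank c)%N].

Lemma key_pool x u ds t c r : (r <= ntask)%N ->
  (key x u ds t c <= r)%N =
  alive u t c && (if assigned x ds c is Some v then height x u ds t v <= r else false)%N.
Proof.
move=> rT; rewrite ffunE; case: ifP => /= _; last first.
  by case: ifP => _; apply/negbTE; rewrite -ltnNge; lia.
by case: assigned => [v//|]; apply/negbTE; rewrite -ltnNge; lia.
Qed.

(** No height exceeds [ntask], so at these levels only tasks occupying a pool are counted; grouping
    them by pool gives [low_tasks]. *)
Lemma key_low_tasks x u ds t r : (r <= ntask)%N ->
  #|[set c | key x u ds t c <= r]%N%SET| = low_tasks r (height x u ds t).
Proof.
move=> rT; rewrite /low_tasks -sum1_card big_mkcond/=.
under [RHS]eq_bigr => v _ do rewrite /height -sum1_card big_mkcond/=.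
rewrite [RHS]exchange_big/=; apply: eq_bigr => c _; rewrite inE key_pool//.
case E : (assigned x ds c) => [v|]; last first.
  by rewrite andbF big1// => v _; rewrite !inE E/= andbF.
case: ifP => [/andP[al hv]|h].
  rewrite (bigD1 v)//= !inE al E eqxx/= big1 ?addn0// => w /andP[_ wv].
  by rewrite !inE E al/= (inj_eq Some_inj) eq_sym (negbTE wv).
rewrite big1// => w hw; rewrite !inE E (inj_eq Some_inj).
by case: eqVneq => [vw|]; rewrite ?andbF// andbT; move: h; rewrite vw hw andbT => ->.
Qed.

Lemma key_alive x u ds t c : (key x u ds t c <= ntask.+1)%N = alive u t c.
Proof.
rewrite ffunE; case: ifP => _; last by case: ifP => _; apply/negbTE; rewrite -ltnNge; lia.
apply/idP; case: assigned => [v|]//; exact: leq_trans (height_le x u ds t v) _.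
Qed.

Lemma key_born x u ds t c : (key x u ds t c <= ntask.+2)%N = (birth u c <= t).
Proof.
have [al|nal] := boolP (alive u t c).
  rewrite (leq_trans _ (leqnSn _)) ?key_alive//; by case/andP: al => ->.
by rewrite ffunE (negbTE nal); case: ifP => _; rewrite ?leqnn//;
  apply/negbTE; rewrite -ltnNge; lia.
Qed.

Lemma key_unborn x u ds t c : t < birth u c ->
  key x u ds t c = (ntask.+3 + trank c)%N.
Proof. by move=> tb; rewrite ffunE /alive leNgt tb. Qed.

Section coupled_keys.
Variables (x1 x2 : config N) (u1 u2 : input R N) (ds1 ds2 : seq (option 'I_N)).
Variables (t : R) (p : {perm task}).
Hypothesis same_births : forall c, birth u1 c = birth u2 c.
Hypothesis same_number : #|alive_set u1 t| = #|alive_set u2 t|.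
Hypothesis coupled : order_coupled (key x1 u1 ds1 t) (key x2 u2 ds2 t) p.

(** At level [ntask.+1] the keys single out the tasks in service; the two counts are equal, so both
    halves of the coupling apply. *)
Lemma coupled_alive c : alive u1 t c = alive u2 t (p c).
Proof.
have E x u ds : [set c | key x u ds t c <= ntask.+1]%N%SET = alive_set u t.
  by apply/setP => c'; rewrite !inE key_alive.
have [H1 H2] := coupled ntask.+1; rewrite !E same_number in H1 H2.
apply/idP/idP; rewrite -(key_alive x1 u1 ds1) -(key_alive x2 u2 ds2).
  exact: H1.
exact: H2.
Qed.

(** From level [ntask.+2] on, the sublevel sets of the two systems coincide because the births do.
    The coupling is therefore an equivalence at each such level. *)
Lemma coupled_unborn c : t < birth u2 c -> p c = c.
Proof.
move=> tb.
have E r : (ntask.+2 <= r)%N -> forall c',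
    (key x1 u1 ds1 t c' <= r)%N = (key x2 u2 ds2 t c' <= r)%N.
  move=> hr c'; have [b|b] := leP (birth u2 c') t.
    by rewrite !(leq_trans _ hr)// key_born ?same_births.
  by rewrite !key_unborn// same_births.
have iffr r : (ntask.+2 <= r)%N -> forall c',
    (key x1 u1 ds1 t c' <= r)%N = (key x2 u2 ds2 t (p c') <= r)%N.
  move=> hr c'; have [H1 H2] := coupled r.
  have e : [set c | key x1 u1 ds1 t c <= r]%N%SET = [set c | key x2 u2 ds2 t c <= r]%N%SET.
    by apply/setP => d; rewrite !inE E.
  by rewrite e in H1 H2; apply/idP/idP; [exact: H1|exact: H2].
have k1 : key x1 u1 ds1 t c = (ntask.+3 + trank c)%N.
  by rewrite key_unborn// same_births.
(* Two consecutive levels pin down the key of [p c], and unborn keys are distinct. *)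
have le : (key x2 u2 ds2 t (p c) <= ntask.+3 + trank c)%N.
  by rewrite -iffr ?k1//; lia.
have gt : (ntask.+2 + trank c < key x2 u2 ds2 t (p c))%N.
  by rewrite ltnNge -iffr ?k1; lia.
have pu : t < birth u2 (p c).
  by rewrite ltNge -(key_born x2 u2 ds2) -ltnNge; lia.
apply: trank_inj.
by move: le gt; rewrite (key_unborn _ _ pu); lia.
Qed.

End coupled_keys.

Lemma card_in_pool_setU1 x ds v (A : {set task}) c : c \notin A ->
  #|in_pool x ds v (c |: A)| = (#|in_pool x ds v A| + (assigned x ds c == Some v))%N.
Proof.
move=> cA; have [Ec|Ec] := boolP (assigned x ds c == Some v).
  have -> : in_pool x ds v (c |: A) = c |: in_pool x ds v A.
    apply/setP => d; rewrite !inE; case: eqVneq => [->|_]//=; by rewrite Ec.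
  by rewrite cardsU1 !inE (negbTE cA)/= add1n addn1.
rewrite addn0; congr #|pred_of_set _|; apply/setP => d; rewrite !inE.
by case: eqVneq => [->|_]//=; rewrite (negbTE Ec) andbF.
Qed.

Lemma alive_antitone u s t c : birth u c <= s -> s <= t -> alive u t c -> alive u s c.
Proof. by move=> bs st /andP[_ td]; rewrite /alive bs (le_lt_trans st td). Qed.

End tasks.

Lemma size_placements (R : realType) B (Pi : scheme R) N (x : config N) (u : input R N) n :
  size (placements B Pi x u n) = n.
Proof. by elim: n => //= n IH; rewrite size_rcons IH. Qed.

Lemma nth_placements (R : realType) B (Pi : scheme R) N (x : config N) (u : input R N) n k :
  (k < n)%N -> nth None (placements B Pi x u n) k = placement B Pi x u k.
Proof.
elim: n => //= n IH; rewrite nth_rcons size_placements ltnS leq_eqVlt.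
by move=> /orP[/eqP ->|kn]; rewrite ?ltnn ?eqxx// kn IH.
Qed.

Section arrivals.
Context (R : realType) (N : nat) (u : input R N).
Hypothesis gap_gt0 : forall k, 0 < gap u k.

Lemma arrival_timeS k : arrival_time u k.+1 = arrival_time u k + gap u k.+1.
Proof. by rewrite /arrival_time big_ord_recr. Qed.

Lemma arrival_time_lt k l : (k < l)%N -> arrival_time u k < arrival_time u l.
Proof.
elim: l => // l IH; rewrite ltnS leq_eqVlt arrival_timeS => /orP[/eqP ->|/IH kl].
  by rewrite ltrDl.
by apply: lt_trans kl _; rewrite ltrDl.
Qed.

Lemma arrival_time_gt0 k : 0 < arrival_time u k.
Proof.
have g0 : 0 < arrival_time u 0 by rewrite /arrival_time big_ord_recl big_ord0 addr0.
case: k => // k; exact: lt_trans (arrival_time_lt (ltn0Sn k)).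
Qed.

(** Before arrival [K] only earlier arrivals can be in service, so the set counted by [load] is
    finite and [fset_set] has its intended value. *)
Lemma loadE K M B (Pi : scheme R) (x : config N) t v :
  (forall w, x w <= M)%N -> 0 <= t -> t < arrival_time u K ->
  load B Pi x u t v = @height R N K M x u (placements B Pi x u K) t v.
Proof.
move=> xM t0 tK; rewrite heightE ?size_placements// /config_after ffunE /load.
congr (_ + _)%N; rewrite size_placements.
pose p k := (placement B Pi x u k == Some v) && in_service u k t.
have kK k : in_service u k t -> (k < K)%N.
  move=> /andP[ak _]; rewrite ltnNge; apply/negP; rewrite leq_eqVlt => /orP[/eqP Kk|Kk].
    by move: tK; rewrite Kk ltNge ak.
  by have := arrival_time_lt Kk; rewrite ltNge (le_trans ak)// ltW.
have -> : [set k | placement B Pi x u k = Some v /\ in_service u k t] =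
    [set` [fset k in [seq k <- iota 0 K | p k]]%fset].
  apply/seteqP; split=> k /=; rewrite inE mem_filter mem_iota /p add0n.
    by move=> [-> s]; rewrite eqxx s kK.
  by move=> /andP[/andP[/eqP -> ->]].
rewrite set_fsetK card_fseq undup_id ?filter_uniq ?iota_uniq//.
rewrite size_filter -sum1_count big_mkcond -(big_mkord xpredT (fun k => ((nth None _ k == Some v) && in_service u k t) : nat)).
rewrite /index_iota subn0 big_seq [RHS]big_seq; apply: eq_bigr => k.
by rewrite mem_iota add0n => /andP[_ kk]; rewrite nth_placements// /p; case: ifP.
Qed.

End arrivals.

Definition in_low_pool (N m : nat) (h : 'I_N -> nat) (o : option 'I_N) : bool :=
  if o is Some v then (h v <= m)%N else false.

(** * An arrival or a departure in one system *)

Section one_system.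
Context (R : realType) (B : capacity) (N K M : nat) (Pi : scheme R).
Context (x : config N) (u : input R N).
Hypothesis xM : forall w, (x w <= M)%N.
Hypothesis gap_gt0 : forall k, 0 < gap u k.

Local Notation task := (task N K M).
Local Notation ds := (placements B Pi x u K).
Local Notation aset := (alive_set K M u).
Local Notation h := (height K M x u ds).

(** Only [k] placements are taken into account, so the state at the arrival instant leaves out the
    arriving task. *)
Definition seen k : config N :=
  config_after x u (placements B Pi x u k) (arrival_time u k).

Lemma seenE (k : 'I_K) s : s <= arrival_time u k ->
  (inl k : task) \notin aset s ->
  aset (arrival_time u k) = (inl k : task) |: aset s ->
  forall v, seen k v = h s v.
Proof.
move=> sk ks E v; rewrite /seen -(@heightE R N K M)//; last 2 first.
- by rewrite size_placements ltnW.
- exact: ltW (arrival_time_gt0 gap_gt0 _).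
rewrite /height E card_in_pool_setU1//= nth_default ?size_placements// addn0.
congr #|pred_of_set _|; apply/setP => c; rewrite !inE; apply: andb_id2l => ca.
case: c ca => //= k' k's.
have kk' : k' != k by apply: contraNneq ks => <-; rewrite inE.
have ltk : (k' < k)%N.
  rewrite ltn_neqAle kk'/= leqNgt; apply/negP => kltk'.
  move: k's => /andP[/= k's _].
  by have := arrival_time_lt gap_gt0 kltk'; rewrite ltNge (le_trans k's).
by rewrite !nth_placements.
Qed.

Lemma height_arrival (k : 'I_K) s t v0 : s <= arrival_time u k ->
  (inl k : task) \notin aset s ->
  aset (arrival_time u k) = (inl k : task) |: aset s ->
  aset t = (inl k : task) |: aset s ->
  rule Pi (mark u k) k (seen k) (sampled u k) = Some v0 ->
  h t = receive B (h s) v0.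
Proof.
move=> sk ks Ek Et ruleE; apply/funext => v.
rewrite {1}/height Et card_in_pool_setU1//= nth_placements// /placement /place.
rewrite size_placements -/(seen k) ruleE /receive -(seenE sk ks Ek).
case: ifP => hr; last by rewrite addn0.
by rewrite /add_task (inj_eq Some_inj) eq_sym.
Qed.

Lemma height_departure (c : task) s t : c \in aset s -> aset t = aset s :\ c ->
  forall m, trunc_sum m (h s) =
    (trunc_sum m (h t) + in_low_pool m (h s) (assigned x ds c))%N.
Proof.
move=> cs E m.
have cE : aset s = c |: aset t by rewrite E finset.setD1K.
have ct : c \notin aset t by rewrite E !inE eqxx.
have hE v : h s v = (h t v + (assigned x ds c == Some v))%N.
  by rewrite /height {1}cE card_in_pool_setU1.
case Ec : (assigned x ds c) => [v|].
  have -> : h s = add_task (h t) v.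
    by apply/funext => w; rewrite hE Ec /add_task (inj_eq Some_inj) eq_sym.
  by rewrite trunc_sum_add /in_low_pool /add_task eqxx addn1.
have -> : h s = h t by apply/funext => w; rewrite hE Ec addn0.
by rewrite addn0.
Qed.

End one_system.

(** * Two systems followed cell by cell *)

Section two_systems.
Context (R : realType) (B : capacity) (N K M n : nat) (Pi1 Pi2 : scheme R) (d : nat -> nat).
Context (x1 x2 : config N) (u1 u2 : input R N).
Hypotheses (N_gt0 : (0 < N)%N) (JSQ1 : is_JSQ Pi1) (JSQ2 : is_JSQd d Pi2).
Hypotheses (xM1 : forall w, (x1 w <= M)%N) (xM2 : forall w, (x2 w <= M)%N).
Hypotheses (gapE : forall k, gap u1 k = gap u2 k) (gap_gt0 : forall k, 0 < gap u2 k).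
Hypotheses (sampled1 : forall k, sampled u1 k = [set: 'I_N]%SET)
  (sampled2 : forall k, sampled u2 k != finset.set0).

Local Notation task := (task N K M).
Local Notation ds1 := (placements B Pi1 x1 u1 K).
Local Notation ds2 := (placements B Pi2 x2 u2 K).
Local Notation h1 := (height K M x1 u1 ds1).
Local Notation h2 := (height K M x2 u2 ds2).
Local Notation aset1 := (alive_set K M u1).
Local Notation aset2 := (alive_set K M u2).

(** Formulated without the chosen pool, so that it depends on the sample and on the state found, but
    not on how ties are broken. *)
Definition bad k : bool :=
  (n < #|[set w | [forall (v | v \in sampled u2 k), seen B Pi2 x2 u2 k w < seen B Pi2 x2 u2 k v]%N]%SET|)%N.

Definition nbad t : nat := (\sum_(k < K) ((arrival_time u2 k <= t)%R && bad k))%N.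

(** The tasks in service include the discarded ones, so that their numbers can stay equal when only
    one system discards. *)
Definition synced t : Prop :=
  [/\ dominates (n + nbad t) (h1 t) (h2 t), #|aset1 t| = #|aset2 t|,
      capped B (h1 t) & capped B (h2 t)].

Lemma same_births (c : task) : birth u1 c = birth u2 c.
Proof.
by case: c => //= k; rewrite /arrival_time; apply: eq_bigr => j _; exact: gapE.
Qed.

Let gap_gt01 k : 0 < gap u1 k. Proof. by rewrite gapE. Qed.

Lemma JSQ_rule (k : nat) (y : config N) : exists2 v,
  rule Pi1 (mark u1 k) k y (sampled u1 k) = Some v & forall w, (y v <= y w)%N.
Proof.
have [_ /(_ (mark u1 k) k y (sampled u1 k))] := JSQ1 N_gt0.
have -> : sampled u1 k != finset.set0.
  by rewrite sampled1; apply/set0Pn; exists (Ordinal N_gt0); rewrite inE.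
by move=> /(_ isT) [v [E _ H]]; exists v => // w; apply: H; rewrite sampled1 inE.
Qed.

Lemma JSQd_rule (k : nat) : exists2 v,
  rule Pi2 (mark u2 k) k (seen B Pi2 x2 u2 k) (sampled u2 k) = Some v &
  bad k = (n < #|[set w | seen B Pi2 x2 u2 k w < seen B Pi2 x2 u2 k v]%N%SET|)%N.
Proof.
have [_ /(_ (mark u2 k) k (seen B Pi2 x2 u2 k) (sampled u2 k) (sampled2 k))] := JSQ2 N_gt0.
move=> [v [E vs H]]; exists v => //; rewrite /bad; congr (_ < #|pred_of_set _|)%N.
apply/setP => w; rewrite !inE; apply/forall_inP/idP => [/(_ v vs)//|wv v' v's].
exact: leq_trans wv (H v' v's).
Qed.

Section cell.
Variables (a b : R) (p : {perm task}).
Hypotheses (a_ge0 : 0 <= a).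
Hypothesis coupled : order_coupled (key K M x1 u1 ds1 a) (key K M x2 u2 ds2 a) p.
Hypothesis same_deaths : forall c t, a <= t <= b ->
  alive u1 a c -> alive u2 a (p c) -> alive u1 t c = alive u2 t (p c).
Hypothesis same_deaths_new : forall c t, a < birth u2 c -> birth u2 c <= t -> t <= b ->
  p c = c -> alive u1 t c = alive u2 t c.
Hypothesis one_birth : forall k k' : 'I_K, a < arrival_time u2 k <= b ->
  a < arrival_time u2 k' <= b -> k = k'.
Hypothesis no_birth_death : forall (k : 'I_K) (c : task), a < arrival_time u2 k <= b ->
  a < death u2 c <= b -> False.
Hypothesis one_death : forall c c' : task, a < death u2 c <= b ->
  a < death u2 c' <= b -> c = c'.
Hypothesis duration_gt0 : forall c : task, 0 < duration u2 c.

Lemma birth_gt_inl (c : task) : a < birth u2 c -> exists2 k, c = inl k & a < arrival_time u2 k.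
Proof. by case: c => [k ak|vj /= a0]; [exists k|rewrite ltNge a_ge0 in a0]. Qed.

Lemma synced_step t : a <= t <= b -> synced a -> synced t.
Proof.
move=> /andP[at_ tb] [D E cap1 cap2].
have cA := coupled_alive E coupled.
have cU (c : task) : a < birth u2 c -> p c = c by apply: (coupled_unborn same_births E coupled).
(* If task [k] arrives in the cell, nothing else happens there: from its arrival on, each set of
   tasks in service is the one at [a] with [k] added. *)
have [[k /andP[ak kt]]|noarr] := pselect (exists k : 'I_K, a < arrival_time u2 k <= t).
  have kb : a < arrival_time u2 k <= b by rewrite ak (le_trans kt).
  have step s : arrival_time u2 k <= s -> s <= t ->
      aset2 s = inl k |: aset2 a /\ aset1 s = inl k |: aset1 a.
    move=> ks st; have as_ : a <= s by apply: le_trans ks; exact: ltW.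
    have sb : s <= b by exact: le_trans tb.
    have nodeath (c : task) : alive u2 a c -> s < death u2 c.
      move=> /andP[_ ad]; rewrite ltNge; apply/negP => ds.
      by apply: (no_birth_death kb (c := c)); rewrite ad (le_trans ds).
    have newb (c : task) : a < birth u2 c -> birth u2 c <= s -> c = inl k.
      move=> ac cs; have [k' ck ak'] := birth_gt_inl ac; rewrite ck; congr inl.
      apply: one_birth => //; rewrite ak'/=; move: cs; rewrite ck /= => cs.
      exact: le_trans sb.
    have ka2 : alive u2 s (inl k : task).
      rewrite /alive /= ks ltNge; apply/negP => ds.
      apply: (no_birth_death kb (c := inl k)); rewrite (le_trans ds sb) andbT.
      by apply: lt_trans ak _; rewrite /death /= ltrDl; exact: (duration_gt0 (inl k)).
    have ka1 : alive u1 s (inl k : task).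
      by rewrite same_deaths_new//; exact: cU.
    have A2 : aset2 s = inl k |: aset2 a.
      apply/setP => c; rewrite !inE; have [->|ck] := eqVneq c (inl k) => //=.
      apply/idP/idP => [al|al]; last first.
        rewrite /alive nodeath// andbT; apply: le_trans as_; by case/andP: al.
      have [ca|ac] := leP (birth u2 c) a; first exact: alive_antitone al.
      by have /andP[cs _] := al; rewrite (newb c ac cs) eqxx in ck.
    split=> //; apply/setP => c; rewrite !inE; have [->|ck] := eqVneq c (inl k) => //=.
    apply/idP/idP => [al|al].
      have [ca|ac] := leP (birth u1 c) a; first exact: alive_antitone al.
      rewrite same_births in ac; have /andP[cs _] := al; rewrite same_births in cs.
      by rewrite (newb c ac cs) eqxx in ck.
    rewrite same_deaths ?as_ -?cA//.
    rewrite /alive nodeath -?cA// andbT; apply: le_trans as_.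
    by have := al; rewrite cA => /andP[].
  have k2 : (inl k : task) \notin aset2 a by rewrite !inE /alive /= leNgt ak.
  have AE : arrival_time u1 k = arrival_time u2 k := same_births (inl k).
  have k1 : (inl k : task) \notin aset1 a by rewrite !inE /alive /= AE leNgt ak.
  have [K2 K1] := step _ (lexx _) kt.
  have [T2 T1] := step _ kt (lexx _).
  have [v1 rule1 min1] := JSQ_rule k (seen B Pi1 x1 u1 k).
  have [v2 rule2 badE] := JSQd_rule k.
  have ak1 : a <= arrival_time u1 k by rewrite AE ltW.
  have K1' : aset1 (arrival_time u1 k) = inl k |: aset1 a by rewrite AE.
  have S1 := seenE B Pi1 xM1 gap_gt01 ak1 k1 K1'.
  have S2 := seenE B Pi2 xM2 gap_gt0 (ltW ak) k2 K2.
  rewrite /synced T1 T2 !cardsU1 k1 k2 E.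
  rewrite (height_arrival xM1 gap_gt01 ak1 k1 K1' T1 rule1).
  rewrite (height_arrival xM2 gap_gt0 (ltW ak) k2 K2 T2 rule2).
  have nbadE : nbad t = (nbad a + bad k)%N.
    rewrite /nbad (bigD1 k)//= [in RHS](bigD1 k)//= kt leNgt ak/= add0n addnC.
    congr (_ + _)%N; apply: eq_bigr => k' kk'; congr (nat_of_bool (_ && _)).
    apply/idP/idP => [k't|]; last by move=> /le_trans; apply.
    rewrite leNgt; apply/negP => ak'; move: kk'.
    by rewrite (@one_birth k' k)// ?eqxx// ak' (le_trans k't).
  have min1' w : (h1 a v1 <= h1 a w)%N by rewrite -!S1.
  split => //; [|exact: capped_receive..].
  rewrite nbadE; case Bk : (bad k).
    by rewrite addn1 addnS; apply: dominates_arrival_bad.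
  rewrite addn0; apply: (@dominates_arrival _ B n) => //; last exact: leq_addr.
  move: Bk; rewrite badE => /negbT; rewrite -leqNgt.
  by under eq_finset => w do rewrite !S2.
have nob (c : task) : a < birth u2 c -> birth u2 c <= t -> False.
  by move=> ac ct; have [k ck ak] := birth_gt_inl ac; apply: noarr; exists k; rewrite ak; move: ct; rewrite ck.
have nbadE : nbad t = nbad a.
  rewrite /nbad; apply: eq_bigr => k _; congr (nat_of_bool (_ && _)).
  apply/idP/idP => [kt|/le_trans]; last exact.
  by rewrite leNgt; apply/negP => ak; apply: noarr; exists k; rewrite ak.
have old1 (c : task) : alive u1 t c -> alive u1 a c.
  move=> al; apply: (alive_antitone _ at_ al); rewrite leNgt same_births; apply/negP => ac.
  by case/andP: al; rewrite same_births => ct _; exact: nob ac ct.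
have old2 (c : task) : alive u2 t c -> alive u2 a c.
  move=> al; apply: (alive_antitone _ at_ al); rewrite leNgt; apply/negP => ac.
  by case/andP: al => ct _; exact: nob ac ct.
have AA (c : task) : alive u1 t c = alive u2 t (p c).
  apply/idP/idP => al.
    by rewrite -same_deaths ?at_ -?cA ?old1.
  by rewrite same_deaths ?at_ ?cA ?old2.
(* The only possible change is now one departure [c2], accompanied by that of its partner [c1] in
   system 1. *)
have [[c2 /andP[al2 dead2]]|nodeath] := pselect (exists c2 : task, alive u2 a c2 && ~~ alive u2 t c2).
  have surv (c : task) : alive u2 a c -> c != c2 -> alive u2 t c.
    have cell (c' : task) : alive u2 a c' -> ~~ alive u2 t c' -> a < death u2 c' <= b.
      move=> /andP[b1 b2]; rewrite /alive (le_trans b1 at_)/= -leNgt b2 => dt.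
      exact: le_trans tb.
    move=> al; apply: contraNT => dead; apply/eqP/one_death; exact: cell.
  pose c1 := (p^-1)%g c2.
  have pc1 : p c1 = c2 by rewrite /c1 permKV.
  have A2 : aset2 t = aset2 a :\ c2.
    apply/setP => c; rewrite !inE; have [->|cc2] := eqVneq c c2; first exact/negbTE.
    by apply/idP/idP => [/old2//|/surv]; apply.
  have A1 : aset1 t = aset1 a :\ c1.
    apply/setP => c; rewrite !inE AA cA; have [->|cc1] := eqVneq c c1.
      by rewrite pc1; exact/negbTE.
    have pcc2 : p c != c2 by rewrite -pc1 (inj_eq perm_inj).
    by apply/idP/idP => [/old2//|/surv]; apply.
  have c2a : c2 \in aset2 a by rewrite inE.
  have c1a : c1 \in aset1 a by rewrite inE cA pc1.
  have H1 := height_departure B Pi1 x1 c1a A1.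
  have H2 := height_departure B Pi2 x2 c2a A2.
  (* Heights are at most [ntask], so [m] can be lowered to a level at which the keys encode
     heights. *)
  have lowE (x : config N) u ds m :
      low_tasks m (height K M x u ds a) = low_tasks (minn m (ntask N K M)) (height K M x u ds a).
    by apply: eq_bigl => v; rewrite leq_min height_le andbT.
  have rT m : (minn m (ntask N K M) <= ntask N K M)%N by exact: geq_minr.
  have kE (x : config N) u ds (c : task) m : alive u a c ->
      in_low_pool m (height K M x u ds a) (assigned x ds c) =
      (key K M x u ds a c <= minn m (ntask N K M))%N.
    move=> al; rewrite key_pool// al/= /in_low_pool; case: assigned => // v.
    by rewrite leq_min height_le andbT.
  split.
  - rewrite nbadE.
    refine (dominates_departure H1 H2 _ _ D) => m.
      rewrite lowE (lowE x2 u2) -!key_low_tasks// => le12.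
      rewrite !kE ?cA ?pc1// -pc1; have [+ _] := coupled (minn m (ntask N K M)).
      by apply.
    rewrite lowE (lowE x1 u1) -!key_low_tasks// => le12.
    rewrite !kE ?cA ?pc1// -pc1; have [_ +] := coupled (minn m (ntask N K M)).
    by apply.
  - by have := cardsD1 c1 (aset1 a); have := cardsD1 c2 (aset2 a); rewrite A1 A2 c1a c2a E; lia.
  - move=> b' v Bb; apply: leq_trans (cap1 b' v Bb); apply/subset_leq_card/fintype.subsetP => c.
    by rewrite A1 !inE => /andP[/andP[_ ->] ->].
  - move=> b' v Bb; apply: leq_trans (cap2 b' v Bb); apply/subset_leq_card/fintype.subsetP => c.
    by rewrite A2 !inE => /andP[/andP[_ ->] ->].
have A2 : aset2 t = aset2 a.
  apply/setP => c; rewrite !inE; apply/idP/idP => [/old2//|al].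
  by apply: contrapT => dead; apply: nodeath; exists c; rewrite al; apply/negP.
have A1 : aset1 t = aset1 a.
  apply/setP => c; rewrite !inE AA cA; have /setP/(_ (p c)) := A2.
  by rewrite !inE.
by rewrite /synced nbadE /height A1 A2; split.
Qed.

End cell.

Lemma height0 (x : config N) (u : input R N) ds v : (forall w, x w <= M)%N ->
  (forall k, 0 < gap u k) -> (forall c : task, 0 < duration u c) -> (size ds <= K)%N ->
  height K M x u ds 0 v = x v.
Proof.
move=> xM g0 d0 dsK; rewrite heightE// /config_after ffunE.
rewrite [X in (_ + X)%N]big1 ?addn0; last first.
  move=> k _; rewrite /in_service leNgt arrival_time_gt0//= andbF//.
rewrite /initial_active (eq_bigr (fun=> 1%N)); first by rewrite sum1_card card_ord.
move=> j _; have jM : (j < M)%N by apply: leq_trans (ltn_ord j) (xM v).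
by have /= -> := d0 (inr (v, Ordinal jM)).
Qed.

Lemma trunc_sum_occ (h h' : 'I_N -> nat) m :
  (forall i, at_least h i = at_least h' i) -> trunc_sum m h = trunc_sum m h'.
Proof.
move=> E; elim: m => [|m IH]; last by rewrite !trunc_sumS IH E.
by rewrite /trunc_sum !big1// => v _; rewrite minn0.
Qed.

Hypotheses (duration1_gt0 : forall c : task, 0 < duration u1 c)
  (duration2_gt0 : forall c : task, 0 < duration u2 c).

(** At time 0 the tasks in service are all the initial slots, padding included, in both systems.
    Truncated sums are sums of occupancies, so [dominates] holds without slack. *)
Lemma synced0 : within_capacity B x1 -> within_capacity B x2 -> same_occupancy x1 x2 ->
  synced 0.
Proof.
move=> w1 w2 occ.
have E1 : h1 0 = x1 by apply/funext => v; rewrite height0 ?size_placements.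
have E2 : h2 0 = x2 by apply/funext => v; rewrite height0 ?size_placements.
rewrite /synced E1 E2; split.
- by move=> m; rewrite (trunc_sum_occ m occ) leqnn leq_addr.
- congr #|pred_of_set _|; apply/setP => -[k|vj]; rewrite !inE /alive /=.
    by rewrite !leNgt !arrival_time_gt0.
  by rewrite lexx /death /= !add0r; have /= -> := duration1_gt0 (inr vj);
     have /= -> := duration2_gt0 (inr vj).
- by move=> b v; exact: w1.
- by move=> b v; exact: w2.
Qed.

Lemma occupancy_bound (J : nat) (g : nat -> R) (p : nat -> {perm task}) (t : R) (i : nat) :
  within_capacity B x1 -> within_capacity B x2 -> same_occupancy x1 x2 ->
  g 0%N = 0 -> (forall j, g j <= g j.+1) ->
  (forall j, (j < J)%N -> order_coupled (key K M x1 u1 ds1 (g j)) (key K M x2 u2 ds2 (g j)) (p j)) ->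
  (forall j c s, (j < J)%N -> g j <= s <= g j.+1 ->
    alive u1 (g j) c -> alive u2 (g j) (p j c) -> alive u1 s c = alive u2 s (p j c)) ->
  (forall j c s, (j < J)%N -> g j < birth u2 c -> birth u2 c <= s -> s <= g j.+1 ->
    p j c = c -> alive u1 s c = alive u2 s c) ->
  (forall j (k k' : 'I_K), (j < J)%N -> g j < arrival_time u2 k <= g j.+1 ->
    g j < arrival_time u2 k' <= g j.+1 -> k = k') ->
  (forall j (k : 'I_K) (c : task), (j < J)%N -> g j < arrival_time u2 k <= g j.+1 ->
    g j < death u2 c <= g j.+1 -> False) ->
  (forall j (c c' : task), (j < J)%N -> g j < death u2 c <= g j.+1 ->
    g j < death u2 c' <= g j.+1 -> c = c') ->
  0 <= t <= g J -> t < arrival_time u2 K -> (0 < i)%N ->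
  (occupancy B Pi1 x1 u1 i t <= occupancy B Pi2 x2 u2 i t + i * (n + nbad t))%N /\
  (occupancy B Pi2 x2 u2 i t <= occupancy B Pi1 x1 u1 i t + i * (n + nbad t))%N.
Proof.
move=> w1 w2 occ g0 gS coupled deaths newdeaths births bd dd /andP[t0 tJ] tK i0.
have g_ge0 j : 0 <= g j by elim: j => [|j IH]; rewrite ?g0//; exact: le_trans (gS j).
have cellstep j s : (j < J)%N -> g j <= s <= g j.+1 -> synced (g j) -> synced s.
  move=> jJ; apply: (@synced_step (g j) (g j.+1) (p j)) => //.
  - exact: coupled.
  - by move=> c s'; exact: deaths.
  - by move=> c s'; exact: newdeaths.
  - by move=> k k'; exact: births.
  - by move=> k c; exact: bd.
  - by move=> c c'; exact: dd.
have sync j : (j <= J)%N -> synced (g j).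
  elim: j => [_|j IH jJ]; first by rewrite g0; exact: synced0.
  by apply: (cellstep j) (IH (ltnW jJ)) => //; rewrite gS lexx.
have synct : synced t.
  (* A cell containing [t]; the index [J] stands for the end point [t = g J]. *)
  have [s sJ /andP[gs ts]] : exists2 j, (j <= J)%N & (g j <= t) && ((j < J)%N ==> (t <= g j.+1)).
    elim: J tJ {coupled deaths newdeaths births bd dd cellstep sync} => [|J' IH] tJ.
      by exists 0%N => //; rewrite g0 t0.
    have [le|lt] := leP t (g J').
      have [j jJ /andP[gj tj]] := IH le; exists j; first exact: leqW.
      rewrite gj /=; apply/implyP => _; move: tj; have [lt|] := ltnP j J'; first by [].
      move=> J'j _; have -> : j = J' by lia.
      exact: le_trans (gS J').
    by exists J' => //; rewrite ltW//=; apply/implyP.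
  move: sJ ts; rewrite leq_eqVlt => /orP[/eqP sJ _|sJ]; last first.
    by rewrite sJ /= => ts; apply: (cellstep s) => //; [rewrite gs ts|exact: sync (ltnW _)].
  have -> : t = g s by apply/eqP; rewrite eq_le gs sJ tJ.
  by apply: sync; rewrite sJ.
have [D _ _ _] := synct.
have := dominates_occupancy D i0.
rewrite /occupancy.
have -> : load B Pi1 x1 u1 t = h1 t.
  apply/funext => v; apply: loadE => //.
  by rewrite (_ : arrival_time u1 K = arrival_time u2 K)// /arrival_time; apply: eq_bigr => j _.
have -> : load B Pi2 x2 u2 t = h2 t by apply/funext => v; exact: loadE.
by [].
Qed.

End two_systems.

(** * Execution times split over time cells *)

Section life.
Context {R : realType}.
Implicit Types (l eta : nat -> R) (b s : R).

(* A duration assembled from one exponential clock [eta j] per time cell: the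
   task dies in cell [j] if its clock there rings before the end of the cell. *)
Fixpoint life l eta (j n : nat) : R :=
  if n is n'.+1 then
    if eta j <= l j then eta j else l j + life l eta j.+1 n'
  else eta j.

Variable delta : R.
Hypothesis delta_gt0 : 0 < delta.

Definition grid (j : nat) : R := j%:R * delta.

(** The part of cell [j] that follows the birth at [b]. It is 0 while the task is unborn, so a
    positive clock cannot ring there. *)
Definition cell_left b (j : nat) : R := Num.max 0 (grid j.+1 - Num.max b (grid j)).

Lemma grid0 : grid 0 = 0. Proof. by rewrite /grid mul0r. Qed.

Lemma gridS j : grid j.+1 = grid j + delta.
Proof. by rewrite /grid -natr1 mulrDl mul1r. Qed.

Lemma grid_leS j : grid j <= grid j.+1.
Proof. by rewrite gridS lerDl ltW. Qed.

Lemma cell_left_ge0 b j : 0 <= cell_left b j.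
Proof. by rewrite le_max lexx. Qed.

Lemma life_gt0 b eta j n : (forall i, 0 < eta i) -> 0 < life (cell_left b) eta j n.
Proof.
move=> eta0; elim: n j => [|n IH] j //=; case: ifP => // _.
by rewrite ltr_wpDl ?cell_left_ge0.
Qed.

(** [Num.max b (grid j)] is the instant from which clock [j] is counted. *)
Lemma max_gridS b j : Num.max b (grid j.+1) = Num.max b (grid j) + cell_left b j.
Proof.
have gg := gridS j; rewrite /cell_left.
have [q [qb qg [qE qc]]] : exists q, [/\ b <= q, grid j <= q & Num.max b (grid j) = q /\
    (q = b \/ q = grid j)].
  exists (Num.max b (grid j)); split; rewrite ?le_max ?lexx ?orbT//.
  by split => //; case: (leP b (grid j)) => _; [right|left].
move: gg qg qE qc; move: (grid j.+1) (grid j) => y z gg qg qE qc.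
rewrite qE !maxEle; clear qE; case: ifPn => h1; case: ifPn => h2; rewrite -?ltNge in h1 h2; case: qc => qc.
all: have d0 := delta_gt0; by [lra|move: h1 h2; rewrite ?subr_lt0 => h1 h2; lra].
Qed.

Lemma cell_left_gt0 b j : 0 < cell_left b j -> b <= grid j.+1.
Proof.
rewrite lt_max ltxx/= subr_gt0 gt_max => /andP[/ltW//].
Qed.

(* The two alternatives are: still alive at the beginning of cell [j], and
   already dead. *)
Lemma life_cell b eta J j : 0 <= b -> (forall i, 0 < eta i) -> (j <= J)%N ->
  b + life (cell_left b) eta 0 J =
    Num.max b (grid j) + life (cell_left b) eta j (J - j) \/
  b <= grid j /\ b + life (cell_left b) eta 0 J <= grid j.
Proof.
move=> b0 eta0; elim: j => [_|j IH jJ].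
  by left; rewrite grid0 max_l// subn0.
case: (IH (ltnW jJ)) => [->|[bj Dj]]; last first.
  by right; split; [exact: le_trans (grid_leS j)|exact: le_trans (grid_leS j)].
have gg := max_gridS b j; rewrite -(subnSK jJ) /=.
case: ifPn => [h|_]; last by left; rewrite gg addrA.
have bj := cell_left_gt0 (lt_le_trans (eta0 j) h).
by right; split => //; move: gg; rewrite (max_r bj) => ->; rewrite lerD2l.
Qed.

(** Within cell [j] only clock [j] matters: if it outlasts the cell, both sides are true up to the
    end of the cell whatever the later clocks. *)
Lemma life_old b eta J j s : 0 <= b -> (forall i, 0 < eta i) -> (j < J)%N ->
  b <= grid j -> grid j < b + life (cell_left b) eta 0 J ->
  grid j <= s <= grid j.+1 ->
  (s < b + life (cell_left b) eta 0 J) = (s < grid j + eta j).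
Proof.
move=> b0 eta0 jJ bj jD /andP[js sj].
case: (life_cell b0 eta0 (ltnW jJ)) => [->|[_]]; last by rewrite leNgt jD.
rewrite max_r// -(subnSK jJ) /=; case: ifPn => // h.
have L := life_gt0 b j.+1 (J - j.+1) eta0.
have E : cell_left b j = delta.
  by rewrite /cell_left gridS (max_r bj) addrC addKr max_r// ltW.
move: h; rewrite E -ltNge => h; rewrite gridS in sj.
by apply/idP/idP => _; lra.
Qed.

Lemma life_new b eta J j s : 0 <= b -> (forall i, 0 < eta i) -> (j < J)%N ->
  grid j < b -> b <= s -> s <= grid j.+1 ->
  (s < b + life (cell_left b) eta 0 J) = (s < b + eta j).
Proof.
move=> b0 eta0 jJ jb bs sj.
case: (life_cell b0 eta0 (ltnW jJ)) => [->|[]]; last by rewrite leNgt jb.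
rewrite max_l ?ltW// -(subnSK jJ) /=; case: ifPn => // h.
have L := life_gt0 b j.+1 (J - j.+1) eta0.
have E : cell_left b j = grid j.+1 - b.
  by rewrite /cell_left max_r; rewrite max_l; lra.
move: h; rewrite E -ltNge => h.
by apply/idP/idP => _; lra.
Qed.

(** Either a common clock before cell [j] rings in time and the two lives are equal, or both tasks
    survive beyond [grid j]. *)
Lemma life_predictable b eta eta' J j s : 0 <= b -> (forall i, 0 < eta i) ->
  (forall i, 0 < eta' i) -> (j <= J)%N -> (forall i, (i < j)%N -> eta i = eta' i) ->
  s <= grid j ->
  (s < b + life (cell_left b) eta 0 J) = (s < b + life (cell_left b) eta' 0 J).
Proof.
move=> b0 eta0 eta0' jJ E sj.
have : life (cell_left b) eta 0 J = life (cell_left b) eta' 0 J \/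
   b + life (cell_left b) eta 0 J =
    Num.max b (grid j) + life (cell_left b) eta j (J - j) /\
   b + life (cell_left b) eta' 0 J =
    Num.max b (grid j) + life (cell_left b) eta' j (J - j).
  elim: j jJ E {sj} => [_ _|j IH jJ E].
    by right; rewrite grid0 max_l// subn0.
  case: (IH (ltnW jJ)) => [i ij|->|[E1 E2]]; [exact: E (ltnW ij)|by left|].
  have gg := max_gridS b j; move: E1 E2; rewrite -(subnSK jJ) /= -E//.
  case: ifPn => _ E1 E2; last by right; rewrite E1 E2 gg !addrA.
  by left; apply: (addrI b); rewrite E1 E2.
case=> [->//|[-> ->]].
have g1 := life_gt0 b j (J - j) eta0; have g2 := life_gt0 b j (J - j) eta0'.
have sm : s <= Num.max b (grid j) by rewrite le_max sj orbT.
by rewrite !(le_lt_trans sm)// ltrDl.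
Qed.

End life.

(* Codes of the exponential clocks driving one system: gaps, samples, marks, and
   for every time cell [j] a row of clocks, one for each task. *)
Definition code : countType := (nat + nat * nat)%type.
Definition clock : countType := (nat + nat + nat + nat * code)%type.

(** * Clocks, their sweeping and their mixing *)

Section clocks.
Context (R : realType).

Local Notation T := (seqspace clock R).

Definition gap_clock (k : nat) : clock := inl (inl (inl k)).
Definition sample_clock (k : nat) : clock := inl (inl (inr k)).
Definition mark_clock (k : nat) : clock := inl (inr k).
Definition row_clock (j : nat) (c : code) : clock := inr (j, c).

(* [expR (- x)] is uniform when [x] is exponential; at [x = 0] the index is out
   of range and the default value is the set of the first [m] pools. *)
Definition pick_set (N m : nat) (x : R) : {set 'I_N} :=
  nth [set v : 'I_N | v < m]%N%SET (enum [set S : {set 'I_N} | #|S| == m]%SET)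
    (Num.truncn (expR (- x) * 'C(N, m)%:R)).

Lemma card_pick_set (N m : nat) (x : R) : (m <= N)%N -> #|pick_set N m x| = m.
Proof.
move=> mN; rewrite /pick_set; set i := Num.truncn _.
have [iN|Ni] := ltnP i (size (enum [set S : {set 'I_N} | #|S| == m]%SET)); last first.
  rewrite nth_default// -[RHS](card_ord m) -sum1_card -[RHS]sum1_card.
  rewrite (big_ord_widen_cond N xpredT (fun=> 1%N) mN).
  by apply: eq_bigl => v; rewrite inE.
by have := mem_nth [set v : 'I_N | v < m]%N%SET iN; rewrite mem_enum inE => /eqP.
Qed.

Lemma pick_set_all (N : nat) (x : R) : pick_set N N x = [set: 'I_N]%SET.
Proof. by apply/eqP; rewrite eqEcard finset.subsetT/= cardsT card_pick_set// card_ord. Qed.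

Lemma pick_set_neq0 (N m : nat) (x : R) : (0 < m <= N)%N -> pick_set N m x != finset.set0.
Proof. by move=> /andP[m0 mN]; rewrite -card_gt0 card_pick_set. Qed.

(** Execution times are read in row 0 alone, so the law of the raw input is immediate; sweeping
    brings the assembled lives to this row. *)
Definition raw_input (rate : R) (N m : nat) (w : T) : input R N :=
  Input (fun k => w (gap_clock k) / rate) (fun k => pick_set N m (w (sample_clock k)))
    (fun k => expR (- w (mark_clock k))) (fun k => w (row_clock 0 (inl k)))
    (fun v j => w (row_clock 0 (inr (val v, j)))).

Section sweeping.
Variables (rate delta : R).

Definition clock_birth (c : code) (w : T) : R :=
  if c is inl k then \sum_(i < k.+1) w (gap_clock i) / rate else 0.

Definition clock_left (c : code) (w : T) : nat -> R := cell_left delta (clock_birth c w).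

(* Carries the whole life of task [c] to its clock in row 0 by a composition of
   law-preserving swaps. *)
Fixpoint sweep (c : code) (n : nat) (w : T) : T :=
  if n is n'.+1 then
    sweep c n' (swap_coords (fun w => clock_left c w n') (row_clock n' c) (row_clock n c) w)
  else w.

Lemma swap_rows_other (l : T -> R) j c w i :
  (forall k, i != row_clock k c) ->
  swap_coords l (row_clock j c) (row_clock j.+1 c) w i = w i.
Proof. by move=> ic; rewrite /swap_coords /upd !(negbTE (ic _)). Qed.

Lemma sweep_other c n w i : (forall k, i != row_clock k c) -> sweep c n w i = w i.
Proof. by move=> ic; elim: n w => //= n IH w; rewrite IH swap_rows_other. Qed.

Lemma clock_birth_ext c w w' : (forall k, w (gap_clock k) = w' (gap_clock k)) ->
  clock_birth c w = clock_birth c w'.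
Proof. by move=> E; case: c => //= k; apply: eq_bigr => i _; rewrite E. Qed.

(** Sweeping runs from the last row down to row 0: folding the last two clocks into one shortens the
    recursion by a cell without changing the life. *)
Lemma life_fold (l eta eta' : nat -> R) j n :
  (forall i, (i < j + n)%N -> eta' i = eta i) ->
  eta' (j + n)%N = life l eta (j + n)%N 1 -> life l eta' j n = life l eta j n.+1.
Proof.
elim: n j => [|n IH] j E En; first by rewrite /= addn0 in En *; rewrite En.
rewrite [LHS]/= [RHS]/= E; last by rewrite addnS ltnS leq_addr.
rewrite IH//; first by move=> i ij; apply: E; rewrite addnS -addSn.
by rewrite addSn -addnS.
Qed.

Lemma sweep_life c n w :
  sweep c n w (row_clock 0 c) = life (clock_left c w) (fun j => w (row_clock j c)) 0 n.
Proof.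
elim: n w => // n IH w; rewrite [sweep _ _ _]/= IH.
set w' := swap_coords _ _ _ _.
have -> : clock_left c w' = clock_left c w.
  by rewrite /clock_left; congr cell_left; apply: clock_birth_ext.
have ne i k : i != k -> row_clock i c != row_clock k c.
  by apply: contra_neq => -[].
apply: life_fold => [i|]; rewrite add0n.
  move=> ni.
  rewrite /w' /swap_coords /upd !(negbTE (ne _ _ _))//.
  - by rewrite neq_ltn ni.
  - by rewrite neq_ltn (ltn_trans ni).
rewrite /w' /swap_coords /upd (negbTE (ne _ _ _)) ?eqxx ?neq_ltn ?leqnn//=.
by rewrite /swap_beyond; case: ifP.
Qed.

Fixpoint sweeps (cs : seq code) (J : nat) (w : T) : T :=
  if cs is c :: cs' then sweep c J (sweeps cs' J w) else w.

Lemma sweeps_other cs J w i : (forall c k, c \in cs -> i != row_clock k c) ->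
  sweeps cs J w i = w i.
Proof.
elim: cs => //= c cs IH ics; rewrite sweep_other; last by move=> k; apply: ics; rewrite inE eqxx.
by apply: IH => c' k c's; apply: ics; rewrite inE c's orbT.
Qed.

Lemma sweeps_life cs J w c : uniq cs -> c \in cs ->
  sweeps cs J w (row_clock 0 c) =
    life (clock_left c w) (fun j => w (row_clock j c)) 0 J.
Proof.
elim: cs => //= c' cs IH /andP[c'cs us]; rewrite inE => /orP[/eqP ->|ccs]; last first.
  rewrite sweep_other ?IH// => k; apply: contraNneq c'cs => -[_ <-]; exact: ccs.
rewrite sweep_life; congr (life (cell_left _ _) _ _ _).
  by apply: clock_birth_ext => k; exact: sweeps_other.
apply/funext => j; apply: sweeps_other => d k dcs.
by apply: contraNneq c'cs => -[_ ->].
Qed.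

End sweeping.

Section task_codes.
Variables (N K M : nat).
Local Notation task := (task N K M).

Definition tcode (c : task) : code :=
  match c with inl k => inl (val k) | inr vj => inr (val vj.1, val vj.2) end.

Lemma tcode_inj : injective tcode.
Proof.
move=> [k|[v j]] [k'|[v' j']] //=; first by case=> /val_inj ->.
by case=> /val_inj -> /val_inj ->.
Qed.

Definition tcodes : seq code := [seq tcode c | c <- enum {: task}].

Lemma tcodes_uniq : uniq tcodes.
Proof. by rewrite map_inj_uniq ?enum_uniq//; exact: tcode_inj. Qed.

Lemma mem_tcodes c : tcode c \in tcodes.
Proof. by apply: map_f; rewrite mem_enum. Qed.

Definition permute_clock (p : {perm task}) (j : nat) (i : clock) : clock :=
  if i is inr (k, c) then
    if (k == j) && (c \in tcodes) then
      if [pick c0 | tcode c0 == c] is Some c0 then row_clock k (tcode (p c0)) else i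
    else i
  else i.

Lemma permute_clock_row p j c : permute_clock p j (row_clock j (tcode c)) =
  row_clock j (tcode (p c)).
Proof.
rewrite /= eqxx mem_tcodes/=; case: pickP => [c0 /eqP/tcode_inj ->//|/(_ c)].
by rewrite eqxx.
Qed.

Lemma permute_clock_other p j i : (forall c, i != row_clock j (tcode c)) ->
  permute_clock p j i = i.
Proof.
case: i => [i|[k c]] // H /=; case: eqVneq => //= kj; case: ifP => // _.
case: pickP => // c0 /eqP c0c; exfalso; move: (H c0); rewrite c0c kj.
by rewrite eqxx.
Qed.

Lemma permute_clockK p j : cancel (permute_clock p j) (permute_clock p^-1 j).
Proof.
move=> i; have [[c ->]|H] := pselect (exists c, i = row_clock j (tcode c)).
  by rewrite !permute_clock_row permK.
have H' c : i != row_clock j (tcode c) by apply/eqP => E; apply: H; exists c.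
by rewrite (permute_clock_other p)// permute_clock_other.
Qed.

Definition permute_row (p : {perm task}) (j : nat) (w : T) : T :=
  fun i => w (permute_clock p j i).

(* The rows from [j] on are those that reveal what happens after time
   [grid delta j]. *)
Definition early (j : nat) (w : T) : T :=
  fun i => if i is inr (k, _) then if (k < j)%N then w i else 1 else w i.

Lemma earlyE j k c (w : T) : (k < j)%N -> early j w (row_clock k c) = w (row_clock k c).
Proof. by rewrite /early /= => ->. Qed.

Lemma early_permute_row p j l w w' : early l w = early l w' ->
  early l (permute_row p j w) = early l (permute_row p j w').
Proof.
move=> E; apply/funext => -[i|[k c]]; first by have := congr1 (@^~ (inl i)) E.
rewrite /early /permute_row; case: ifP => // kl.
have Ek c' : w (inr (k, c')) = w' (inr (k, c')).
  by have := congr1 (@^~ (inr (k, c'))) E; rewrite /= kl.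
rewrite /permute_clock; case: ifP => // _; case: pickP => [c0 _|_]; exact: Ek.
Qed.

Lemma early_permute_row_le p j l w : (l <= j)%N -> early l (permute_row p j w) = early l w.
Proof.
move=> lj; apply/funext => -[i|[k c]] //; rewrite /early /permute_row; case: ifP => // kl.
by rewrite /= (_ : (k == j) = false)//; apply/negbTE; rewrite neq_ltn (leq_trans kl).
Qed.

Section mixing.
Variable pi : nat -> T -> T -> {perm task}.

(* The permutation applied to row [j'] is computed from the earlier rows of the
   mixed clocks (first system) and of the original ones (second system). *)
Fixpoint mix (j : nat) (w : T) : T :=
  if j is j'.+1 then
    mix j' (permute_row (pi j' (early j' (mix j' w)) (early j' w)) j' w)
  else w.

Definition mix_perm (j : nat) (w : T) : {perm task} := pi j (early j (mix j w)) (early j w).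

Lemma mixS j w : mix j.+1 w = mix j (permute_row (mix_perm j w) j w).
Proof. by []. Qed.

Lemma mix_late j l c w : (j <= l)%N -> mix j w (row_clock l c) = w (row_clock l c).
Proof.
elim: j w => [//|j IH] w jl; rewrite mixS.
rewrite IH; last exact: ltnW.
by rewrite /permute_row/= (gtn_eqF jl).
Qed.

Lemma early_mix j l w w' : (j <= l)%N -> early l w = early l w' -> early l (mix j w) = early l (mix j w').
Proof.
elim: j w w' => // j IH w w' jl E; rewrite !mixS.
have earlyj v v' : early l v = early l v' -> early j v = early j v'.
  move=> Ev; apply/funext => -[i|[k c]]; first by have := congr1 (@^~ (inl i)) Ev.
  rewrite /early; case: ifP => // kj.
  by have := congr1 (@^~ (inr (k, c))) Ev; rewrite /= (ltn_trans kj).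
have -> : mix_perm j w = mix_perm j w'.
  rewrite /mix_perm (earlyj _ _ E); congr (pi _ _ _); apply: earlyj; apply: IH => //; exact: ltnW.
by apply: IH; [exact: ltnW|exact: early_permute_row].
Qed.

Lemma mix_perm_ext j w w' : early j w = early j w' -> mix_perm j w = mix_perm j w'.
Proof. by move=> E; rewrite /mix_perm E (early_mix _ E). Qed.

(** The permutation of row [j] ignores that row; this is the invariance that [preserves_choose] asks
    for. *)
Lemma mix_permute_row p j w : mix_perm j (permute_row p j w) = mix_perm j w.
Proof. by apply: mix_perm_ext; exact: early_permute_row_le. Qed.

Lemma mix_row J j c w : (j < J)%N ->
  mix J w (row_clock j (tcode c)) = w (row_clock j (tcode (mix_perm j w c))).
Proof.
elim: J w => // J IH w; rewrite ltnS leq_eqVlt mixS => /orP[/eqP ->|jJ].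
  by rewrite mix_late// /permute_row permute_clock_row.
rewrite IH// (@mix_perm_ext j _ w); last exact/early_permute_row_le/ltnW.
by rewrite /permute_row permute_clock_other// => c'; apply/eqP => -[/eqP]; rewrite ltn_eqF.
Qed.

Lemma mix_other J i w : (forall j c, i != row_clock j (tcode c)) -> mix J w i = w i.
Proof.
by move=> H; elim: J w => // J IH w; rewrite mixS IH /permute_row permute_clock_other.
Qed.

(** Rows before [j] are final after [j] steps, so the permutation of row [j] is computed from the
    clocks that system 1 really uses. *)
Lemma early_mix_le J j w : (j <= J)%N -> early j (mix J w) = early j (mix j w).
Proof.
move=> jJ; apply/funext => -[i|[k c]]; first by rewrite /early !mix_other.
rewrite /early; case: ifP => // kj.
have [[c' [E]]|H] := pselect (exists c', (inr (k, c) : clock) = row_clock k (tcode c')).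
  rewrite E -[inr (k, tcode c')]/(row_clock k (tcode c')).
  by rewrite !mix_row// (leq_trans kj).
rewrite !mix_other// => k' c'; apply/eqP => -[E1 E2]; apply: H; exists c';
  by rewrite /row_clock E2.
Qed.

Lemma mix_gt0 J w : (forall i, 0 < w i) -> forall i, 0 < mix J w i.
Proof. by elim: J w => // J IH w w0 i; rewrite mixS; apply: IH => i'; exact: w0. Qed.

End mixing.

End task_codes.

End clocks.

(** * The coupling *)

Section key_determined.
Context (R : realType) (B : capacity) (N K M : nat) (Pi : scheme R) (x : config N).
Context (u u' : input R N) (t : R).
Hypothesis xM : forall w, (x w <= M)%N.
Hypotheses (gapE : forall k, gap u k = gap u' k) (gap_gt0 : forall k, 0 < gap u k).
Hypotheses (sampledE : forall k, sampled u k = sampled u' k)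
  (markE : forall k, mark u k = mark u' k).
Hypothesis aliveE : forall (c : task N K M) s, s <= t -> alive u s c = alive u' s c.

Let arrivalE k : arrival_time u k = arrival_time u' k.
Proof. by apply: eq_bigr => i _; exact: gapE. Qed.

Let alive_setE s : s <= t -> alive_set K M u s = alive_set K M u' s.
Proof. by move=> st; apply/setP => c; rewrite !inE aliveE. Qed.

Lemma placements_determined k : (k <= K)%N ->
  (forall i, (i < k)%N -> arrival_time u i <= t) ->
  placements B Pi x u k = placements B Pi x u' k.
Proof.
elim: k => // k IH kK H /=.
rewrite -IH ?(ltnW kK)//; last by move=> i ik; apply: H; exact: ltnW.
congr rcons; rewrite /place size_placements.
have -> : config_after x u (placements B Pi x u k) (arrival_time u k) =
    config_after x u' (placements B Pi x u k) (arrival_time u' k).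
  have a0 : 0 <= arrival_time u k by exact: ltW (arrival_time_gt0 gap_gt0 k).
  apply/ffunP => v; rewrite -arrivalE.
  rewrite -!(@heightE R N K M) ?size_placements ?(ltnW kK)//.
  by rewrite /height alive_setE// H.
by rewrite sampledE markE.
Qed.

(** The keys are adapted: an arrival before [t] only sees which tasks are in service up to [t], so
    by induction its placement agrees, and unborn tasks are keyed by their rank alone. *)
Lemma key_determined :
  key K M x u (placements B Pi x u K) t = key K M x u' (placements B Pi x u' K) t.
Proof.
have birthE (c : task N K M) : birth u c = birth u' c by case: c => //= k.
have assignedE (c : task N K M) : alive u t c ->
    assigned x (placements B Pi x u K) c = assigned x (placements B Pi x u' K) c.
  case: c => //= k /andP[/= kt _].
  rewrite !nth_placements// /placement.
  have := @placements_determined k.+1 (ltn_ord k); rewrite /= => E.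
  have H i : (i < k.+1)%N -> arrival_time u i <= t.
    move=> ik; apply: le_trans kt; move: ik.
    by rewrite ltnS leq_eqVlt => /orP[/eqP ->//|/(arrival_time_lt gap_gt0)/ltW].
  by have /rcons_inj[] := E H.
have heightE v : height K M x u (placements B Pi x u K) t v =
    height K M x u' (placements B Pi x u' K) t v.
  congr #|pred_of_set _|; apply/setP => c; rewrite !inE -aliveE//.
  by apply: andb_id2l => /assignedE ->.
apply/ffunP => c; rewrite !ffunE -aliveE// -birthE; case: ifP => // /assignedE ->.
by case: assigned => // v; rewrite heightE.
Qed.

End key_determined.

Section coupled_systems.
Context (R : realType) (B : capacity) (N K M n m J : nat) (rate delta : R).
Context (Pi1 Pi2 : scheme R) (d : nat -> nat) (x1 x2 : config N).

Local Notation T := (seqspace clock R).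
Local Notation task := (task N K M).

Definition system (l : nat) (w : T) : input R N :=
  raw_input rate N l (sweeps rate delta (tcodes N K M) J w).

Definition system_key (Pi : scheme R) (x : config N) (l j : nat) (w : T) :
    {ffun task -> nat} :=
  key K M x (system l w) (placements B Pi x (system l w) K) (grid delta j).

Definition key_match (j : nat) (w1 w2 : T) : {perm task} :=
  matching (system_key Pi1 x1 N j w1) (system_key Pi2 x2 m j w2).

Definition remix : T -> T := mix key_match J.

Hypotheses (rate_gt0 : 0 < rate) (delta_gt0 : 0 < delta).
Hypotheses (N_gt0 : (0 < N)%N) (JSQ1 : is_JSQ Pi1) (JSQ2 : is_JSQd d Pi2).
Hypotheses (m_gt0 : (0 < m)%N) (mN : (m <= N)%N).
Hypotheses (xM1 : forall w, (x1 w <= M)%N) (xM2 : forall w, (x2 w <= M)%N).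

Lemma sweeps_gap w k : sweeps rate delta (tcodes N K M) J w (gap_clock k) = w (gap_clock k).
Proof. by apply: sweeps_other. Qed.

Lemma system_gap l w k : gap (system l w) k = w (gap_clock k) / rate.
Proof. by rewrite /= sweeps_gap. Qed.

Lemma system_sampled l w k : sampled (system l w) k = pick_set N l (w (sample_clock k)).
Proof. by rewrite /= sweeps_other. Qed.

Lemma system_mark l w k : mark (system l w) k = expR (- w (mark_clock k)).
Proof. by rewrite /= sweeps_other. Qed.

Lemma clock_birthE l w (c : task) : clock_birth rate (tcode c) w = birth (system l w) c.
Proof. by case: c => //= k; apply: eq_bigr => i _; rewrite system_gap. Qed.

Lemma system_duration l w (c : task) : duration (system l w) c =
  life (cell_left delta (birth (system l w) c))
    (fun j => w (row_clock j (tcode c))) 0 J.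
Proof.
rewrite -clock_birthE -[RHS]/(life (clock_left rate delta (tcode c) w) _ _ _).
rewrite -(sweeps_life _ _ _ _ (tcodes_uniq N K M) (mem_tcodes c)).
by case: c => [k|[v j]].
Qed.

Section positive.
Variable w : T.
Hypothesis w_gt0 : forall i, 0 < w i.

Lemma system_gap_gt0 l k : 0 < gap (system l w) k.
Proof. by rewrite system_gap divr_gt0. Qed.

Lemma system_birth_ge0 l (c : task) : 0 <= birth (system l w) c.
Proof. by case: c => //= k; apply/ltW/arrival_time_gt0 => i; exact: system_gap_gt0. Qed.

End positive.

Lemma early_gt0 j (w : T) : (forall i, 0 < w i) -> forall i, 0 < early j w i.
Proof. by move=> w0 [i|[k c]] //=; rewrite /early; case: ifP. Qed.

(** By [life_predictable], erasing the rows from [j] on does not affect the keys at [grid delta j];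
    the erased clocks are set to 1, which keeps them positive. *)
Lemma system_key_early Pi (x : config N) l j (w : T) : (forall v, (x v <= M)%N) -> (forall i, 0 < w i) ->
  (j <= J)%N -> system_key Pi x l j (early j w) = system_key Pi x l j w.
Proof.
move=> xM w0 jJ; have cw0 := early_gt0 j w0.
apply: key_determined => //.
- by move=> k; rewrite !system_gap.
- by move=> k; exact: system_gap_gt0.
- by move=> k; rewrite !system_sampled.
- by move=> k; rewrite !system_mark.
move=> c s sj; rewrite /alive /death !system_duration.
have bE : birth (system l (early j w)) c = birth (system l w) c.
  by rewrite -!clock_birthE; exact: clock_birth_ext.
rewrite bE; congr (_ && _).
apply: (@life_predictable _ _ delta_gt0 _ _ _ _ j) => //.
- exact: system_birth_ge0.
- by move=> i ij; rewrite earlyE.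
Qed.

Lemma coupling_bound (w : T) (t : R) (i : nat) :
  (forall i, 0 < w i) ->
  within_capacity B x1 -> within_capacity B x2 -> same_occupancy x1 x2 ->
  let u1 := system N (remix w) in let u2 := system m w in
  (forall j (k k' : 'I_K), (j < J)%N ->
    grid delta j < arrival_time u2 k <= grid delta j.+1 ->
    grid delta j < arrival_time u2 k' <= grid delta j.+1 -> k = k') ->
  (forall j (k : 'I_K) (c : task), (j < J)%N ->
    grid delta j < arrival_time u2 k <= grid delta j.+1 ->
    grid delta j < death u2 c <= grid delta j.+1 -> False) ->
  (forall j (c c' : task), (j < J)%N -> grid delta j < death u2 c <= grid delta j.+1 ->
    grid delta j < death u2 c' <= grid delta j.+1 -> c = c') ->
  0 <= t <= grid delta J -> t < arrival_time u2 K -> (0 < i)%N ->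
  (occupancy B Pi1 x1 u1 i t <=
     occupancy B Pi2 x2 u2 i t + i * (n + nbad B K n Pi2 x2 u2 t))%N /\
  (occupancy B Pi2 x2 u2 i t <=
     occupancy B Pi1 x1 u1 i t + i * (n + nbad B K n Pi2 x2 u2 t))%N.
Proof.
move=> w0 cap1 cap2 same u1 u2 births bd dd tJ tK i0.
have rw0 : forall i, 0 < remix w i by exact: mix_gt0.
have gE k : gap u1 k = gap u2 k.
  by rewrite !system_gap /remix mix_other.
have g0 k : 0 < gap u2 k by exact: system_gap_gt0.
have bE (c : task) : birth u1 c = birth u2 c.
  by case: c => //= k; apply: eq_bigr => k' _; exact: gE.
have rowE j (c : task) : (j < J)%N -> remix w (row_clock j (tcode c)) =
    w (row_clock j (tcode (mix_perm key_match j w c))).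
  exact: mix_row.
have b20 (c : task) : 0 <= birth u2 c by exact: system_birth_ge0.
have dur0 l (v : T) : (forall i, 0 < v i) -> forall c : task, 0 < duration (system l v) c.
  by move=> v0 c; rewrite system_duration; apply: life_gt0.
apply: (@occupancy_bound R B N K M n Pi1 Pi2 d x1 x2 u1 u2 N_gt0 JSQ1 JSQ2 xM1 xM2
  gE g0 _ _ _ _ J (grid delta) (mix_perm key_match ^~ w)) => //.
- by move=> k; rewrite system_sampled pick_set_all.
- by move=> k; rewrite system_sampled pick_set_neq0 ?m_gt0.
- exact: dur0.
- exact: dur0.
- exact: grid0.
- by move=> j; exact: grid_leS.
(* The permutation was computed from early clocks of a partial mix; it is a matching for the true
   keys of both systems. *)
- move=> j jJ; rewrite /mix_perm /key_match.
  rewrite -(early_mix_le _ _ (ltnW jJ)) -/remix.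
  rewrite !system_key_early// ?(ltnW jJ)//.
  exact: matchingP.
(* Matched tasks read the same clock in row [j], and by [life_old] this clock alone decides survival
   within the cell. *)
- move=> j c s jJ /andP[js sj] /andP[b1 d1] /andP[b2 d2].
  move: b1 d1 b2 d2; rewrite /alive /death !system_duration => b1 d1 b2 d2.
  rewrite (le_trans b1 js) (le_trans b2 js)/=.
  rewrite (life_old delta_gt0 _ _ jJ b1 d1) ?js// ?bE//.
  by rewrite (life_old delta_gt0 _ _ jJ b2 d2) ?js// rowE.
- move=> j c s jJ jb bs sj pc.
  rewrite /alive /death !system_duration -/u1 -/u2 bE bs/=.
  by rewrite !(life_new delta_gt0 _ _ jJ jb bs sj)// rowE// pc.
Qed.

End coupled_systems.

(** * Measurability of the dynamics *)

Section dmeas.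
Context d (T : measurableType d).

(** For a countable codomain this is measurability with respect to the discrete sigma-algebra. *)
Definition dmeas (A : Type) (f : T -> A) : Prop :=
  forall y, measurable [set w | f w = y].

Lemma dmeas_cst (A : Type) (a : A) : dmeas (fun=> a).
Proof.
move=> y; have [->|ay] := pselect (a = y).
  by rewrite (_ : [set _ | _] = setT)//; apply/seteqP; split.
by rewrite (_ : [set _ | _] = set0)//; apply/seteqP; split.
Qed.

Lemma dmeas_bind (A : countType) (B : Type) (f : T -> A) (g : A -> T -> B) :
  dmeas f -> (forall a, dmeas (g a)) -> dmeas (fun w => g (f w) w).
Proof.
move=> mf mg y.
rewrite (_ : [set _ | _] = \bigcup_(a in [set: A])
    ([set w | f w = a] `&` [set w | g a w = y])).
  apply: countable_bigcupT_measurable => [|a]; first exact: countableP.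
  by apply: measurableI; [exact: mf|exact: mg].
apply/seteqP; split=> w /=; first by move=> gy; exists (f w).
by move=> [a _ [/= -> ->]].
Qed.

Lemma dmeas_comp (A : countType) (B : Type) (f : T -> A) (h : A -> B) :
  dmeas f -> dmeas (fun w => h (f w)).
Proof.
move=> mf; apply: (dmeas_bind (g := fun a _ => h a) mf) => a; exact: dmeas_cst.
Qed.

Lemma dmeas2 (A B : countType) (C : Type) (f : T -> A) (g : T -> B) (h : A -> B -> C) :
  dmeas f -> dmeas g -> dmeas (fun w => h (f w) (g w)).
Proof.
move=> mf mg; apply: (dmeas_bind (g := fun a w => h a (g w)) mf) => a.
exact: dmeas_comp.
Qed.

Lemma dmeas_bool (b : T -> bool) : measurable [set w | b w] -> dmeas b.
Proof.
move=> mb [] //.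
rewrite (_ : [set _ | _] = ~` [set w | b w]); first exact: measurableC.
by apply/seteqP; split=> w /=; [move=> ->|move/negP/negbTE].
Qed.

Lemma dmeas_boolE (b : T -> bool) : dmeas b -> measurable [set w | b w].
Proof. exact. Qed.

Lemma dmeas_ffun (I : finType) (A : Type) (f : T -> {ffun I -> A}) :
  (forall i, dmeas (fun w => f w i)) -> dmeas f.
Proof.
move=> mf y.
rewrite (_ : [set _ | _] = \bigcap_(i in [set: I]) [set w | f w i = y i]).
  by apply: fin_bigcap_measurable => // i _; exact: mf.
apply/seteqP; split=> w /=; first by move=> <- i.
by move=> H; apply/ffunP => i; exact: H.
Qed.

Lemma dmeas_set (I : finType) (f : T -> {set I}) :
  (forall i, dmeas (fun w => i \in f w)) -> dmeas f.
Proof.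
move=> mf; have : dmeas (fun w => [ffun i => i \in f w]).
  by apply: dmeas_ffun => i y; under eq_set do rewrite ffunE; exact: mf.
move=> /(@dmeas_comp _ _ _ (fun F : {ffun I -> bool} => [set i | F i]%SET)) mF y.
rewrite (_ : [set _ | _] =
  [set w | [set i | [ffun i => i \in f w] i]%SET = y]); first exact: mF.
apply/seteqP; split=> w /= <-; apply/setP => i; by rewrite inE ffunE.
Qed.

Lemma dmeas_sum (I : Type) (r : seq I) (F : I -> T -> nat) :
  (forall i, dmeas (F i)) -> dmeas (fun w => \sum_(i <- r) F i w)%N.
Proof.
move=> mF; elim: r => [|i r IH].
  by move=> y; under eq_set do rewrite big_nil; exact: dmeas_cst.
by move=> y; under eq_set do rewrite big_cons; exact: (dmeas2 addn).
Qed.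

Lemma dmeas_le (R : realType) (f g : T -> R) : measurable_fun setT f ->
  measurable_fun setT g -> dmeas (fun w => f w <= g w).
Proof.
move=> mf mg; apply: dmeas_bool.
have mt : measurable [set true] by [].
exact: (measurable_preimT (measurable_fun_ler mf mg) mt).
Qed.

Lemma dmeas_lt (R : realType) (f g : T -> R) : measurable_fun setT f ->
  measurable_fun setT g -> dmeas (fun w => f w < g w).
Proof.
move=> mf mg; apply: dmeas_bool.
have mt : measurable [set true] by [].
exact: (measurable_preimT (measurable_fun_ltr mf mg) mt).
Qed.

Lemma dmeas_nat (f : T -> nat) : (forall n, dmeas (fun w => (n <= f w)%N)) -> dmeas f.
Proof.
move=> mf n; rewrite (_ : [set _ | _] =
    [set w | (n <= f w)%N] `\` [set w | (n.+1 <= f w)%N]).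
  by apply: measurableD; exact: dmeas_boolE.
apply/seteqP; split=> w /=; first by move=> ->; rewrite ltnn.
by move=> [h /negP]; rewrite -leqNgt => h'; apply/eqP; rewrite eqn_leq h'.
Qed.

End dmeas.

Lemma dmeas_precomp d d' (T : measurableType d) (T' : measurableType d') (A : Type)
  (f : T -> A) (h : T' -> T) : dmeas f -> measurable_fun setT h -> dmeas (fun w => f (h w)).
Proof. by move=> mf mh y; exact: (measurable_preimT mh (mf y)). Qed.

Record dmeas_input (R : realType) d (T : measurableType d) N (U : T -> input R N) : Prop :=
  DmeasInput {
    dmeas_gap : forall k, measurable_fun setT (fun w => gap (U w) k);
    dmeas_sampled : forall k, dmeas (fun w => sampled (U w) k);
    dmeas_mark : forall k, measurable_fun setT (fun w => mark (U w) k);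
    dmeas_work : forall k, measurable_fun setT (fun w => work (U w) k);
    dmeas_residual : forall v j, measurable_fun setT (fun w => residual (U w) v j) }.

Section dynamics.
Context (R : realType) (B : capacity) (N K M : nat) (Pi : scheme R) (x : config N).
Context d (T : measurableType d) (U : T -> input R N).
Hypothesis mU : dmeas_input U.

Lemma measurable_arrival_time k : measurable_fun setT (fun w => arrival_time (U w) k).
Proof. by apply: measurable_sum => i; exact: dmeas_gap. Qed.

Lemma dmeas_config_after ds k :
  dmeas (fun w => config_after x (U w) ds (arrival_time (U w) k)).
Proof.
apply: dmeas_ffun => v; rewrite /config_after => y; under eq_set do rewrite ffunE.
have mA := measurable_arrival_time.
apply: (dmeas2 addn); apply: dmeas_sum => i.
  by apply: dmeas_comp; apply: dmeas_lt => //; exact: dmeas_residual.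
apply: dmeas_comp; apply: (dmeas2 andb); first exact: dmeas_cst.
apply: (dmeas2 andb); first exact: dmeas_le.
apply: dmeas_lt => //; apply: measurable_funD => //; exact: dmeas_work.
Qed.

(** The past placements, the state found and the sample take countably many values; once they are
    fixed, only the mark is left and [rule_measurable] applies. *)
Lemma dmeas_placements n : dmeas (fun w => placements B Pi x (U w) n).
Proof.
elim: n => [|n IH] /=; first exact: dmeas_cst.
apply: (dmeas_bind (g := fun ds w => rcons ds (place B Pi x (U w) ds)) IH) => ds.
apply: dmeas_comp; rewrite /place.
apply: (dmeas_bind (f := fun w => config_after x (U w) ds (arrival_time (U w) (size ds)))
  (g := fun y w => if rule Pi (mark (U w) (size ds)) (size ds) y (sampled (U w) (size ds))
                   is Some v then if has_room B (y v) then Some v else None else None)).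
  exact: dmeas_config_after.
move=> y; apply: (dmeas_comp (f := fun w => rule Pi _ _ _ _)
  (fun o => if o is Some v then if has_room B (y v) then Some v else None else None)).
apply: (dmeas_bind (f := fun w => sampled (U w) (size ds))
  (g := fun S w => rule Pi (mark (U w) (size ds)) (size ds) y S)).
  exact: dmeas_sampled.
move=> S o; exact: measurable_preimT (dmeas_mark mU _) (rule_measurable Pi _ _ _ o).
Qed.

Lemma measurable_birth (c : task N K M) : measurable_fun setT (fun w => birth (U w) c).
Proof. by case: c => [k|vj] /=; [exact: measurable_arrival_time|exact: measurable_cst]. Qed.

Lemma measurable_death (c : task N K M) : measurable_fun setT (fun w => death (U w) c).
Proof.
apply: measurable_funD; first exact: measurable_birth.
by case: c => [k|vj] /=; [exact: dmeas_work|exact: dmeas_residual].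
Qed.

Lemma dmeas_key t : dmeas (fun w => key K M x (U w) (placements B Pi x (U w) K) t).
Proof.
have mb (c : task N K M) : dmeas (fun w => birth (U w) c <= t).
  by apply: dmeas_le => //; exact: measurable_birth.
have ma (c : task N K M) : dmeas (fun w => alive (U w) t c).
  by apply: (dmeas2 andb) => //; apply: dmeas_lt => //; exact: measurable_death.
have mA : dmeas (fun w => alive_set K M (U w) t).
  by apply: dmeas_set => c y; under eq_set do rewrite inE; exact: ma.
apply: dmeas_ffun => c y; under eq_set do rewrite ffunE.
apply: (dmeas_bind (f := fun w => placements B Pi x (U w) K)
  (g := fun ds w => if alive (U w) t c then
      if assigned x ds c is Some v then height K M x (U w) ds t v else (ntask N K M).+1
    else if birth (U w) c <= t then (ntask N K M).+2 else ((ntask N K M).+3 + trank c)%N)).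
  exact: dmeas_placements.
move=> ds; rewrite /height.
apply: (dmeas_bind (f := fun w => alive_set K M (U w) t)
  (g := fun A w => if alive (U w) t c then
      if assigned x ds c is Some v then #|in_pool x ds v A| else (ntask N K M).+1
    else if birth (U w) c <= t then (ntask N K M).+2 else ((ntask N K M).+3 + trank c)%N)) => //.
move=> A; exact: (dmeas2 (fun a b : bool => if a then
      if assigned x ds c is Some v then #|in_pool x ds v A| else (ntask N K M).+1
    else if b then (ntask N K M).+2 else ((ntask N K M).+3 + trank c)%N)).
Qed.

Lemma dmeas_seen k : dmeas (fun w => seen B Pi x (U w) k).
Proof.
apply: (dmeas_bind (f := fun w => placements B Pi x (U w) k)
  (g := fun ds w => config_after x (U w) ds (arrival_time (U w) k))).
  exact: dmeas_placements.
by move=> ds; exact: dmeas_config_after.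
Qed.

Lemma dmeas_bad n k : dmeas (fun w => bad B n Pi x (U w) k).
Proof.
rewrite /bad.
apply: (dmeas2 (f := fun w => seen B Pi x (U w) k) (g := fun w => sampled (U w) k)
  (fun (y : config N) (S : {set 'I_N}) =>
    (n < #|[set w | [forall (v | v \in S), y w < y v]%N]%SET|)%N)).
  exact: dmeas_seen.
exact: dmeas_sampled.
Qed.

End dynamics.

Lemma measurable_expRN (R : realType) : measurable_fun setT (fun x : R => expR (- x)).
Proof. by apply: measurableT_comp => //; exact: measurableT_comp. Qed.

Lemma dmeas_pick_set (R : realType) d (T : measurableType d) (f : T -> R) N m :
  measurable_fun setT f -> dmeas (fun w : T => pick_set N m (f w)).
Proof.
move=> mf; apply: dmeas_comp; apply: dmeas_nat => n.
have E (w : T) : (n <= Num.truncn (expR (- f w) * 'C(N, m)%:R))%N =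
    (n%:R <= expR (- f w) * 'C(N, m)%:R).
  by rewrite truncn_ge_nat// mulr_ge0 ?expR_ge0.
move=> y; under eq_set do rewrite E.
apply: dmeas_le => //; apply: measurable_funM => //.
exact: measurableT_comp (@measurable_expRN R) mf.
Qed.

Section preserving.
Context (R : realType).
Local Notation T := (seqspace clock R).

Lemma dmeas_raw_input rate N m : dmeas_input (raw_input rate N m : T -> input R N).
Proof.
split=> [k|k|k|k|v j] /=; try exact: measurable_coord.
- by apply: measurable_funM => //; exact: measurable_coord.
- by apply: dmeas_pick_set; exact: measurable_coord.
- apply: measurableT_comp => //; apply: measurableT_comp => //; exact: measurable_coord.
Qed.

Lemma measurable_early j : measurable_fun setT (early j : T -> T).
Proof.
apply: measurable_seqspace => -[i|[k c]] /=; first exact: measurable_coord.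
by case: (k < j)%N; [exact: measurable_coord|exact: measurable_cst].
Qed.

Lemma dmeas_input_comp d (X : measurableType d) d' (Y : measurableType d') N
    (U : X -> input R N) (h : Y -> X) :
  dmeas_input U -> measurable_fun setT h -> dmeas_input (U \o h).
Proof.
move=> mU mh; split=> [k|k|k|k|v j] /=.
- exact: measurableT_comp (dmeas_gap mU k) mh.
- exact: dmeas_precomp (dmeas_sampled mU k) mh.
- exact: measurableT_comp (dmeas_mark mU k) mh.
- exact: measurableT_comp (dmeas_work mU k) mh.
- exact: measurableT_comp (dmeas_residual mU v j) mh.
Qed.

Variable P : probability T R.
Hypothesis Piid : iid_exponential P.

Lemma preserves_sweep rate delta c n : preserves P (sweep rate delta c n : T -> T).
Proof.
elim: n => [|n IH]; first exact: preserves_id.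
(* The threshold reads only gap clocks, which the exchange of two row clocks leaves alone. *)
apply: (preserves_comp IH); apply: preserves_swap_coords => //.
- by apply/eqP => -[/eqP]; rewrite ltn_eqF.
- rewrite /clock_left /cell_left; apply: measurable_maxr => //.
  apply: measurable_funB => //; apply: measurable_maxr => //.
  case: c {IH} => [k|vj] /=; last exact: measurable_cst.
  apply: measurable_sum => i; apply: measurable_funM => //; exact: measurable_coord.
- by move=> w; exact: cell_left_ge0.
Qed.

Lemma preserves_sweeps rate delta cs J : preserves P (sweeps rate delta cs J : T -> T).
Proof.
elim: cs => [|c cs IH]; first exact: preserves_id.
by apply: preserves_comp IH; exact: preserves_sweep.
Qed.

Lemma preserves_permute_row N K M (p : {perm task N K M}) j :
  preserves P (permute_row p j : T -> T).
Proof. exact: preserves_reindex (permute_clockK p j). Qed.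

Lemma preserves_mix N K M (pi : nat -> T -> T -> {perm task N K M}) J :
  (forall j (f g : T -> T), measurable_fun setT f -> measurable_fun setT g ->
     dmeas (fun w => pi j (f w) (g w))) ->
  preserves P (mix pi J : T -> T).
Proof.
move=> mpi; elim: J => [|J IH]; first exact: preserves_id.
pose theta (w : T) := permute_row (mix_perm pi J w) J w.
have : preserves P theta.
  apply: (@preserves_choose _ _ _ P _ (mix_perm pi J) (fun p w => permute_row p J w)).
  - by move=> p; exact: preserves_permute_row.
  - apply: mpi; last exact: measurable_early.
    exact: measurableT_comp (measurable_early J) IH.1.
  - by move=> p w; exact: mix_permute_row.
exact: preserves_comp IH.
Qed.

Section systems.
Context (B : capacity) (N K M m J : nat) (rate delta : R).
Context (Pi1 Pi2 : scheme R) (x1 x2 : config N).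

Lemma preserves_remix :
  preserves P (remix B K M m J rate delta Pi1 Pi2 x1 x2 : T -> T).
Proof.
apply: preserves_mix => j f g mf mg; rewrite /key_match.
have mk Pi (x : config N) l (h : T -> T) : measurable_fun setT h ->
    dmeas (fun w => system_key B K M J rate delta Pi x l j (h w)).
  move=> mh; apply: dmeas_key.
  have mS := preserves_sweeps rate delta (tcodes N K M) J.
  exact: (dmeas_input_comp (dmeas_raw_input rate N l) (measurableT_comp mS.1 mh)).
exact: (dmeas2 (@matching (task N K M)) (mk _ _ _ _ mf) (mk _ _ _ _ mg)).
Qed.

End systems.

End preserving.

(** * Laws of the primitive data *)

(** The complement of the open interval is null; restricting to it avoids the conventional values of
    [ln] outside its domain. *)
Lemma unif_eq_inside (R : realType) (A B : set R) : measurable A -> measurable B ->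
  (forall x, 0 < x < 1 -> A x <-> B x) -> unif A = unif B.
Proof.
move=> mA mB AB.
pose I : set R := `]0, 1[%classic.
have mI : measurable I by exact: measurable_itv.
have I1 : unif I = 1%E by rewrite /I unif_itv// subr0.
have inside (C : set R) : measurable C -> unif C = unif (C `&` I).
  move=> mC; have mCI := measurableI _ _ mC mI.
  have mCD : measurable (C `\` I) by exact: measurableD.
  rewrite -[in LHS](setUIDK C I).
  have -> : unif ((C `&` I) `|` (C `\` I)) =
      (unif (C `&` I) + unif (C `\` I))%E.
    apply: measureU => //; apply/seteqP; split=> // x [[_ h] [_]]; exact.
  have -> : unif (C `\` I) = 0%E; last by rewrite adde0.
  apply/eqP; rewrite eq_le measure_ge0 andbT.
  apply: (@le_trans _ _ (unif (~` I))).
    by apply: le_measure; rewrite ?inE//; exact: measurableC.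
  have -> : unif (~` I) = (1 - unif I)%E.
    exact: probability_setC.
  by rewrite I1 subee.
rewrite inside// [RHS]inside//; congr unif; apply/seteqP; split=> x /=.
  by move=> [Ax x01]; split => //; apply/AB => //; move: x01; rewrite in_itv.
by move=> [Bx x01]; split => //; apply/AB => //; move: x01; rewrite in_itv.
Qed.

Lemma expo_expRN (R : realType) (A : set R) : measurable A ->
  expo [set x | A (expR (- x))] = unif A.
Proof.
move=> mA; have mA' : measurable [set x : R | A (expR (- x))].
  exact: measurable_preimT (@measurable_expRN R) mA.
rewrite -unif_neg_ln//; apply: unif_eq_inside => //.
  by apply: measurable_preimT => //; exact: measurableT_comp (@measurable_ln R).
by move=> x /andP[x0 _] /=; rewrite opprK lnK.
Qed.

Lemma expo_scale (R : realType) (rate : R) (A : set R) : 0 < rate -> measurable A ->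
  expo [set x | A (x / rate)] = exponential_prob rate A.
Proof.
move=> r0 mA.
pose Q := (exponential_distribution_exponential_prob__canonical__probability_measure_Probability r0).
have [m mE] : exists m : {measure set R -> \bar R}, forall A, m A = exponential_prob rate A.
  have h0 : exponential_prob rate set0 = 0%E by exact: (measure0 Q).
  have hge B : (0 <= exponential_prob rate B)%E by exact: (measure_ge0 Q).
  have hadd : semi_sigma_additive (exponential_prob rate : set R -> \bar R).
    exact: (@measure_semi_sigma_additive _ _ _ Q).
  pose m : {measure set R -> \bar R} :=
    HB.pack (exponential_prob rate : set R -> \bar R) (isMeasure.Build _ R R _ h0 hge hadd).
  by exists m.
have mdiv : measurable_fun setT (fun x : R => x / rate) by exact: measurable_funM.
have [m1 m1E'] := pushforward_measureP (@expo R) mdiv.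
have m1E B : m1 B = expo [set x | B (x / rate)] by exact: m1E'.
rewrite -m1E -mE; apply: (@measure_ray_unique R m1 m) => // a; last first.
  by rewrite m1E; apply: (@le_lt_trans _ _ 1%E); [apply: probability_le1;
    exact: (measurable_preimT mdiv)|rewrite ltry].
rewrite m1E mE exponential_prob_ray//.
transitivity (expo `](a * rate), +oo[%classic).
  by congr expo; apply/seteqP; split=> x /=; rewrite !in_itv/= !andbT ltr_pdivlMr.
transitivity ((expR (- Num.max 0 (a * rate)))%:E); first exact: expo_ray.
congr (expR _)%:E; rewrite mulNr maxr_pMr ?ltW// mulr0 mulrC; congr (- Num.max _ _).
Qed.

(** [S] is picked when the uniform number [expR (- x)] lies in the interval of length one over
    ['C(N, m)] attached to its index in the enumeration. *)
Lemma expo_pick_set (R : realType) N m (S : {set 'I_N}) : (m <= N)%N ->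
  expo [set x : R | pick_set N m x = S] = (if #|S| == m then ('C(N, m)%:R)^-1 else 0)%:E.
Proof.
move=> mN; have mS : measurable [set x : R | pick_set N m x = S].
  by apply: (@dmeas_pick_set R _ R id).
case: eqVneq => Sm; last first.
  rewrite (_ : [set _ | _] = set0) ?measure0//; apply/seteqP; split=> // x /= E.
  by move: Sm; rewrite -E card_pick_set ?eqxx.
set C := 'C(N, m); pose l := enum [set S : {set 'I_N} | #|S| == m]%SET.
have C0 : (0 < C%:R :> R) by rewrite ltr0n bin_gt0.
have sl : size l = C by rewrite -cardE card_draws card_ord.
have Sl : S \in l by rewrite mem_enum inE Sm.
pose i := index S l.
have iC : (i < C)%N by rewrite -sl index_mem.
rewrite -unif_neg_ln//.
rewrite (@unif_eq_inside R _ `[(i%:R / C%:R), (i.+1%:R / C%:R)[%classic)//.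
- rewrite unif_itv.
  + by rewrite -mulrBl -natrB// subSnn mul1r.
  + by rewrite divr_ge0// ltW.
  + by rewrite ler_pM2r ?invr_gt0// ler_nat.
  + by rewrite ler_pdivrMr// mul1r ler_nat.
- by apply: measurable_preimT => //; exact: measurableT_comp (@measurable_ln R).
move=> x /andP[x0 x1] /=; rewrite in_itv/= /pick_set -/l opprK lnK//.
have xC : x * C%:R < C%:R by rewrite gtr_pMl.
have xC0 : 0 <= x * C%:R by rewrite mulr_ge0// ltW.
rewrite ler_pdivrMr// ltr_pdivlMr// -truncn_eq//.
have tC : (Num.truncn (x * C%:R) < size l)%N.
  by rewrite sl ltnNge truncn_ge_nat// -ltNge.
split=> [E|/eqP ->]; last by rewrite /i nth_index.
apply/eqP/esym; rewrite /i -E index_uniq//; exact: enum_uniq.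
Qed.

Section raw_law.
Context (R : realType).
Local Notation T := (seqspace clock R).
Variable P : probability T R.
Hypothesis Piid : iid_exponential P.

Definition source_clock N (s : source N) : clock :=
  match s with
  | Gap k => gap_clock k
  | Sampled k => sample_clock k
  | Mark k => mark_clock k
  | Work k => row_clock 0 (inl k)
  | Residual v j => row_clock 0 (inr (val v, j))
  end.

Lemma source_clock_inj N : injective (@source_clock N).
Proof.
move=> [k|k|k|k|v j] [k'|k'|k'|k'|v' j'] //= [] //; try by move=> ->.
by move=> /val_inj -> ->.
Qed.

Lemma source_events_clock rate N m (s : source N) (E : set T) :
  source_events (raw_input rate N m : T -> _) s E ->
  exists2 D : set R, measurable D & E = [set w | D (w (source_clock s))].
Proof.
case: s => [k|k|k|k|v j] /= [D mD <-]; rewrite setTI.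
- exists [set x | D (x / rate)] => //.
  by apply: (measurable_preimT (f := fun x : R => x / rate)) => //; exact: measurable_funM.
- exists [set x | D (pick_set N m x)] => //.
  have := @dmeas_comp _ R _ _ _ (fun S => `[< D S >]) (@dmeas_pick_set R _ R id N m _) => /(_ (@measurable_id _ _ _)) /(_ true).
  by congr measurable; apply/seteqP; split=> x /= /asboolP.
- exists [set x | D (expR (- x))] => //.
  exact: (measurable_preimT (@measurable_expRN R) mD).
- by exists D.
- by exists D.
Qed.

Lemma raw_is_input rate N m : 0 < rate -> (m <= N)%N ->
  is_input rate m P (raw_input rate N m : T -> input R N).
Proof.
move=> r0 mN; have coordE c (B : set R) : measurable B -> P [set w | B (w c)] = expo B.
  exact: expo_prob_coord.
split.
- move=> s E /source_events_clock[D mD ->].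
  exact: measurable_preimT (measurable_coord _) mD.
- move=> n s E s_inj sE.
  have /choice[D DE] : forall j, exists D : set R,
      measurable D /\ E j = [set w | D (w (source_clock (s j)))].
    by move=> j; have [D mD ->] := source_events_clock (sE j); exists D.
  pose cl j := source_clock (s j).
  have cl_inj : injective cl by move=> i j /source_clock_inj/s_inj.
  (* Distinct sources read distinct clocks, so their events form one rectangle. *)
  pose B c := if [pick j | cl j == c] is Some j then D j else setT.
  have Bcl j : B (cl j) = D j.
    by rewrite /B; case: pickP => [j' /eqP/cl_inj ->//|/(_ j)]; rewrite eqxx.
  have -> : \big[setI/setT]_(j < n) E j = rect (map cl (enum 'I_n)) B.
    rewrite -big_enum -bigcap_seq; apply/seteqP; split=> w H.
      move=> c /mapP[j _ ->]; rewrite Bcl.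
      by have := H j; rewrite (DE j).2 /=; apply; rewrite mem_enum.
    move=> j _; rewrite (DE j).2 /= -Bcl; apply: H; apply: map_f; exact: mem_enum.
  rewrite Piid; last 2 first.
  + by rewrite (map_inj_uniq cl_inj) enum_uniq.
  + by move=> c; rewrite /B; case: pickP => // j _; exact: (DE j).1.
  rewrite big_map big_enum/=; apply: eq_bigr => j _.
  by rewrite Bcl (DE j).2 coordE//; exact: (DE j).1.
- move=> k A mA /=; rewrite -expo_scale//.
  apply: (coordE (gap_clock k) [set x | A (x / rate)]).
  by apply: (measurable_preimT (f := fun x : R => x / rate)) => //; exact: measurable_funM.
- move=> k S /=; rewrite -expo_pick_set//.
  apply: (coordE (sample_clock k) [set x | pick_set N m x = S]).
  exact: (@dmeas_pick_set R _ R id).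
- move=> k A mA /=; rewrite -unif_def -expo_expRN//.
  apply: (coordE (mark_clock k) [set x | A (expR (- x))]).
  exact: (measurable_preimT (@measurable_expRN R) mA).
- by move=> k A mA /=; rewrite -expo_def; exact: coordE.
- by move=> v j A mA /=; rewrite -expo_def; exact: coordE.
Qed.

End raw_law.

Lemma is_input_preserves (R : realType) rate m d (T : measurableType d)
    (P : probability T R) N (U : T -> input R N) (f : T -> T) :
  is_input rate m P U -> preserves P f -> is_input rate m P (U \o f).
Proof.
move=> [mU iU gU sU kU wU rU] [mf fP].
have lift s E : source_events (U \o f) s E ->
    exists2 E', source_events U s E' & E = f @^-1` E'.
  case: s => [k|k|k|k|v j] /= [D mD <-]; rewrite setTI.
  - by exists ((fun w => gap (U w) k) @^-1` D) => //; exists D; rewrite ?setTI.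
  - by exists ((fun w => sampled (U w) k) @^-1` D) => //; exists D; rewrite ?setTI.
  - by exists ((fun w => mark (U w) k) @^-1` D) => //; exists D; rewrite ?setTI.
  - by exists ((fun w => work (U w) k) @^-1` D) => //; exists D; rewrite ?setTI.
  - by exists ((fun w => residual (U w) v j) @^-1` D) => //; exists D; rewrite ?setTI.
have mE s D : measurable D -> source_events U s D -> P (f @^-1` D) = P D.
  by move=> mD _; exact: fP.
split.
- by move=> s E /lift[E' sE' ->]; apply: measurable_preimT => //; exact: mU sE'.
- move=> n s E sinj sE.
  have /choice[E' E'P] : forall j, exists E', source_events U (s j) E' /\ E j = f @^-1` E'.
    by move=> j; have [E' sE' ->] := lift _ _ (sE j); exists E'.
  have mE' j : measurable (E' j) by exact: mU (E'P j).1.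
  have -> : \big[setI/setT]_(j < n) E j = f @^-1` (\big[setI/setT]_(j < n) E' j).
    apply: (big_ind2 (fun A B => A = f @^-1` B)) => //.
      by move=> _ A _ B -> ->.
    by move=> j _; exact: (E'P j).2.
  rewrite fP; last by apply: bigsetI_measurable => j _.
  rewrite (iU n s E' sinj); last by move=> j; exact: (E'P j).1.
  by apply: eq_bigr => j _; rewrite (E'P j).2 fP.
- move=> k A mA; rewrite -(gU k A mA).
  apply: (fP ((fun w => gap (U w) k) @^-1` A)).
  by apply: (mU (Gap k)); exists A; rewrite ?setTI.
- move=> k S; rewrite -(sU k S).
  apply: (fP [set w | sampled (U w) k = S]).
  by apply: (mU (Sampled k)); exists [set S]; rewrite ?setTI.
- move=> k A mA; rewrite -(kU k A mA).
  apply: (fP ((fun w => mark (U w) k) @^-1` A)).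
  by apply: (mU (Mark k)); exists A; rewrite ?setTI.
- move=> k A mA; rewrite -(wU k A mA).
  apply: (fP ((fun w => work (U w) k) @^-1` A)).
  by apply: (mU (Work k)); exists A; rewrite ?setTI.
- move=> v j A mA; rewrite -(rU v j A mA).
  apply: (fP ((fun w => residual (U w) v j) @^-1` A)).
  by apply: (mU (Residual v j)); exists A; rewrite ?setTI.
Qed.

(** * Probability bounds *)

Section counting.
Context (R : realType) d (T : measurableType d) (P : probability T R).

Lemma count_markov (I : finType) (b : I -> T -> bool) (q : R) (a : nat) :
  (forall i, dmeas (b i)) -> (forall i, P [set w | b i w] <= q%:E)%E -> (0 < a)%N ->
  (P [set w | (a <= \sum_i b i w)%N] <= (#|I|%:R * q / a%:R)%:E)%E.
Proof.
move=> mb bq a0; set S := [set w | _].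
have mS : measurable S.
  apply: dmeas_boolE; apply: dmeas_comp; apply: dmeas_sum => i; exact: dmeas_comp.
have mbi i : measurable [set w | b i w] by exact: dmeas_boolE.
have a0' : (0 < a%:R :> R) by rewrite ltr0n.
rewrite EFinM lee_pdivlMr// muleC.
have -> : (a%:R%:E * P S = \int[P]_w (a%:R%:E * (\1_S w)%:E))%E.
  rewrite ge0_integralZl//; first by rewrite integral_indic// setIT.
  - by apply/measurable_EFinP; exact: measurable_indic.
apply: (@le_trans _ _ (\int[P]_w (\sum_i (\1_[set w | b i w] w)%:E))%E).
  apply: ge0_le_integral => //.
  - apply: measurable_funeM; apply/measurable_EFinP; exact: measurable_indic.
  - by apply: emeasurable_sum => i; apply/measurable_EFinP; exact: measurable_indic.
  move=> w _; rewrite sumEFin -EFinM lee_fin.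
  have -> : \sum_i \1_[set w | b i w] w = (\sum_i b i w)%:R :> R.
    by rewrite natr_sum; apply: eq_bigr => i _; rewrite indicE mem_setE.
  rewrite indicE; have [|] := boolP (w \in S); last by rewrite mulr0 ler0n.
  by rewrite inE /S /= mulr1 ler_nat.
rewrite ge0_integral_sum//; last first.
  by move=> i; apply/measurable_EFinP; exact: measurable_indic.
rewrite mulr_natl -sumr_const -sumEFin; apply: lee_sum => i _.
by rewrite integral_indic// setIT bq.
Qed.

End counting.

Section exponential_bounds.
Context {R : realType}.

Lemma expRN_sub_le (p q : R) : 0 <= p -> p <= q -> expR (- p) - expR (- q) <= q - p.
Proof.
move=> p0 pq; have -> : - q = - p + (p - q) by ring.
rewrite expRD -{1}[expR (- p)]mulr1 -mulrBr.
have h1 := expR_ge1Dx (p - q); have h2 := expR_gt0 (- p).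
have h3 : expR (- p) <= 1 by rewrite -expR0 ler_expR oppr_le0.
have h4 : expR (p - q) <= 1 by rewrite -expR0 ler_expR subr_le0.
apply: (@le_trans _ _ (1 - expR (p - q))); last by lra.
by rewrite ler_piMl// subr_ge0.
Qed.

Lemma expo_itv_le (a b : R) : a <= b -> (expo `]a, b]%classic <= (b - a)%:E)%E.
Proof.
move=> ab.
have E : expo `]a, +oo[%classic = (expo `]a, b]%classic + expo `]b, +oo[%classic)%E.
  have -> : `]a, +oo[%classic = `]a, b]%classic `|` `]b, +oo[%classic.
    apply/seteqP; split=> x /=; rewrite !in_itv/= !andbT.
      by move=> ->; have [xb|xb] := leP x b; [left|right].
    by move=> [/andP[]//|]; exact: le_lt_trans.
  apply: measureU => //; apply/seteqP; split => // x [] /=; rewrite !in_itv/= andbT.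
  by move=> /andP[_ xb]; rewrite ltNge xb.
have fin : expo `]a, b]%classic \is a fin_num by exact: fin_num_measure.
move: E; rewrite !expo_ray -(fineK fin) -EFinD => -[E].
rewrite lee_fin.
have h : expR (- Num.max 0 a) - expR (- Num.max 0 b) <= Num.max 0 b - Num.max 0 a.
  apply: expRN_sub_le; first by rewrite le_max lexx.
  by rewrite ge_max !le_max lexx ab !orbT.
apply: (@le_trans _ _ (Num.max 0 b - Num.max 0 a)); first by lra.
have [b0|b0] := leP 0 b; have [a0|a0] := leP 0 a; lra.
Qed.

(** The clock has to fall in a window of length [2 * h * r], and the exponential density is at most
    1. *)
Lemma expo_close (s r a h : R) : 0 < r -> 0 <= h ->
  (expo [set x : R | (`|s + x / r - a| < h)%R] <= (2 * h * r)%:E)%E.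
Proof.
move=> r0 h0.
have -> : 2 * h * r = (a + h - s) * r - (a - h - s) * r by ring.
apply: le_trans; last first.
  by apply: expo_itv_le; rewrite ler_pM2r//; lra.
apply: le_measure; rewrite ?inE//.
  apply: dmeas_boolE; apply: dmeas_lt => //.
  apply: measurableT_comp => //; apply: measurable_funB => //.
  by apply: measurable_funD => //; exact: measurable_funM.
move=> x /=; rewrite in_itv/= ltr_norml => /andP[h1 h2].
apply/andP; split.
  by rewrite -ltr_pdivlMr//; lra.
by rewrite -ler_pdivrMr//; lra.
Qed.

Lemma expo_low (h : R) : 0 <= h -> (expo [set x : R | x <= h]%R <= h%:E)%E.
Proof.
move=> h0; have -> : [set x : R | x <= h]%R = ~` `]h, +oo[%classic.
  apply/seteqP; split=> x /=; rewrite in_itv/= andbT; first by rewrite leNgt => /negP.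
  by move/negP; rewrite -leNgt.
have -> : expo (~` `]h, +oo[%classic) = (1 - expo (`]h, +oo[%classic : set R))%E.
  exact: probability_setC.
rewrite expo_ray -EFinB lee_fin max_r//.
by have := expR_ge1Dx (- h); lra.
Qed.

End exponential_bounds.

(** * Separation of the event times *)

Section isolation.
Context (R : realType).
Local Notation T := (seqspace clock R).
Variable P : probability T R.
Hypothesis Piid : iid_exponential P.
Context (N K M m : nat) (rate delta : R).
Hypotheses (rate_gt0 : 0 < rate) (delta_gt0 : 0 < delta).
Local Notation task := (task N K M).
Local Notation U := (raw_input rate N m : T -> input R N).

Definition event_time (u : input R N) (e : 'I_K + task) : R :=
  match e with inl k => arrival_time u k | inr c => death u c end.

Lemma measurable_event_time e : measurable_fun setT (fun w => event_time (U w) e).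
Proof.
have mU := dmeas_raw_input (R := R) rate N m.
by case: e => [k|c] /=; [exact: measurable_arrival_time|exact: measurable_death].
Qed.

Definition close_events (e e' : 'I_K + task) (w : T) : bool :=
  `|event_time (U w) e - event_time (U w) e'| < delta.

Lemma dmeas_close_events e e' : dmeas (close_events e e').
Proof.
apply: dmeas_lt => //; apply: measurableT_comp => //.
by apply: measurable_funB; exact: measurable_event_time.
Qed.

Lemma close_eventsC e e' w : close_events e e' w = close_events e' e w.
Proof. by rewrite /close_events distrC. Qed.

(* Given all other clocks, an event time is an affine function of one clock
   that does not affect the other event time. *)
Lemma close_events_clock c r e e' : 0 < r -> r <= 1 + rate ->
  (forall w x, event_time (U (upd w c x)) e' = event_time (U w) e') ->
  (forall w, exists s, forall x, event_time (U (upd w c x)) e = s + x / r) ->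
  (P [set w | close_events e e' w] <= (2 * delta * (1 + rate))%:E)%E.
Proof.
move=> r0 r1 He' He; apply: (prob_le_coord Piid (c := c)).
- exact: dmeas_boolE (dmeas_close_events e e').
- by rewrite lee_fin !mulr_ge0 ?ltW// addr_gt0.
move=> w _; have [s sE] := He w.
apply: (@le_trans _ _ (2 * delta * r)%:E); last first.
  by rewrite lee_fin ler_pM2l// mulr_gt0.
have := @expo_close R s r (event_time (U w) e') delta r0 (ltW delta_gt0).
congr (expo _ <= _)%E; apply/seteqP; split=> x /=;
  by rewrite /close_events He' sE.
Qed.

Lemma birth_upd_row w j c x (c0 : task) :
  birth (U (upd w (row_clock j c) x)) c0 = birth (U w) c0.
Proof. by case: c0 => [k|vj] //=; apply: eq_bigr. Qed.

Lemma close_events_le e e' : e != e' ->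
  (P [set w | close_events e e' w] <= (2 * delta * (1 + rate))%:E)%E.
Proof.
have r1 : 1 <= 1 + rate by rewrite lerDl ltW.
(* The duration clock of [c] moves its death and no other event time that is an arrival or the death
   of another task. *)
have death_arrival (c : task) e0 : e0 != inr c ->
    (P [set w | close_events (inr c) e0 w] <= (2 * delta * (1 + rate))%:E)%E.
  move=> ne; apply: (@close_events_clock (row_clock 0 (tcode c)) 1) => //.
    move=> w x; case: e0 ne => [k|c0] ne /=; first by apply: eq_bigr.
    rewrite /death birth_upd_row; congr +%R.
    have : row_clock 0 (tcode c0) != row_clock 0 (tcode c).
      by apply: contra ne => /eqP [] /tcode_inj ->.
    by case: (c0) => [k|[v j]] /= /negbTE h; rewrite /upd h.
  move=> w; exists (birth (U w) c) => x; rewrite divr1 /= /death birth_upd_row; congr +%R.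
  by case: (c) => [k|[v j]] /=; rewrite /upd eqxx.
(* The last gap before the later arrival does not affect the earlier one. *)
have arrivals (k k' : 'I_K) : (k < k')%N ->
    (P [set w | close_events (inl k') (inl k) w] <= (2 * delta * (1 + rate))%:E)%E.
  move=> kk'; apply: (@close_events_clock (gap_clock k') rate) => //.
  - by rewrite lerDr.
  - move=> w x /=; apply: eq_bigr => i _ /=; rewrite /upd; case: eqP => // -[ik].
    by have := ltn_ord i; rewrite ltnS ik leqNgt kk'.
  move=> w; exists (\sum_(i < k') w (gap_clock i) / rate) => x /=.
  rewrite /arrival_time big_ord_recr/= /upd eqxx; congr (_ + _).
  apply: eq_bigr => i _; case: eqP => // -[ik].
  by have := ltn_ord i; rewrite ik ltnn.
case: e e' => [k|c] [k'|c'] ne.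
- have [kk'|kk'|/val_inj kk'] := ltngtP k k'.
  + under eq_set do rewrite close_eventsC; exact: arrivals.
  + exact: arrivals.
  + by rewrite kk' eqxx in ne.
- under eq_set do rewrite close_eventsC; exact: death_arrival.
- by apply: death_arrival.
- by apply: death_arrival; rewrite eq_sym.
Qed.

Definition crowded (w : T) : bool :=
  (1 <= \sum_(ee : ('I_K + task) * ('I_K + task)) ((ee.1 != ee.2) && close_events ee.1 ee.2 w))%N.

Lemma dmeas_crowded : dmeas crowded.
Proof.
apply: dmeas_comp; apply: dmeas_sum => ee; apply: dmeas_comp.
by apply: (dmeas2 andb); [exact: dmeas_cst|exact: dmeas_close_events].
Qed.

Lemma crowded_le : (P [set w | crowded w] <=
  ((#|{: 'I_K + task}| ^ 2)%:R * (2 * delta * (1 + rate)))%:E)%E.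
Proof.
have c0 : 0 <= 2 * delta * (1 + rate) by rewrite !mulr_ge0 ?ltW// addr_gt0.
have := @count_markov R _ T P _ (fun ee w => (ee.1 != ee.2) && close_events ee.1 ee.2 w)
  (2 * delta * (1 + rate)) 1.
rewrite divr1 card_prod; apply => // [ee|[e e'] /=].
  by apply: (dmeas2 andb); [exact: dmeas_cst|exact: dmeas_close_events].
have [_|ne] := eqVneq e e'; last exact: close_events_le.
by rewrite (_ : [set _ | _] = set0) ?measure0 ?lee_fin//; apply/seteqP; split.
Qed.

Lemma not_crowded w e e' a : ~~ crowded w -> a < event_time (U w) e <= a + delta ->
  a < event_time (U w) e' <= a + delta -> e = e'.
Proof.
rewrite /crowded -leqNgt leqn0 sum_nat_eq0 => /forallP/(_ (e, e')) /=.
rewrite eqb0 negb_and negbK => /orP[/eqP//|/negP nc] /andP[h1 h2] /andP[h3 h4].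
by exfalso; apply: nc; rewrite /close_events ltr_norml; apply/andP; split; lra.
Qed.

End isolation.

(** * The number of arrivals before a given time *)

Section arrivals_rate.
Context (R : realType).
Local Notation T := (seqspace clock R).
Variable P : probability T R.
Hypothesis Piid : iid_exponential P.
Context (N m : nat) (rate : R).
Hypothesis rate_gt0 : 0 < rate.
Local Notation U := (raw_input rate N m : T -> input R N).

(* If the first [k] interarrival times add up to at most [t], then at least half
   of them are at most [2 t / k]. *)
Definition hurried (k : nat) (t : R) (w : T) : bool :=
  (k <= 2 * \sum_(i < k) (w (gap_clock i) <= 2 * t / k%:R * rate)%R)%N.

Lemma dmeas_hurried k t : dmeas (hurried k t).
Proof.
apply: (dmeas_comp (f := fun w : T => \sum_(i < k) (w (gap_clock i) <= 2 * t / k%:R * rate)%R)%N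
  (fun s => k <= 2 * s)%N).
apply: dmeas_sum => i; apply: dmeas_comp; apply: dmeas_le => //.
exact: measurable_coord.
Qed.

Lemma hurried_le k t : (0 < k)%N -> 0 <= t ->
  (P [set w | hurried k t w] <= (4 * t * rate / k%:R)%:E)%E.
Proof.
move=> k0 t0; have k0' : (0 < k%:R :> R) by rewrite ltr0n.
set h := 2 * t / k%:R * rate.
have h0 : 0 <= h by rewrite mulr_ge0 ?divr_ge0 ?mulr_ge0 ?ler0n// ltW.
(* Half of [k], rounded up, is the integer threshold for the number of short gaps. *)
have /= H := @count_markov R _ T P 'I_k (fun i w => w (gap_clock i) <= h) h (uphalf k).
have -> : [set w : T | hurried k t w] =
    [set w : T | (uphalf k <= \sum_(i < k) (w (gap_clock i) <= h)%R)%N].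
  apply/seteqP; split=> w /=; rewrite /hurried -/h leq_uphalf_double -mul2n; exact.
apply: le_trans (H _ _ _) _.
- by move=> i; apply: dmeas_le => //; exact: measurable_coord.
- move=> i; apply: le_trans (expo_low h0).
  rewrite (expo_prob_coord Piid (gap_clock i) (B := [set x | x <= h]))//.
  by apply: dmeas_boolE; exact: dmeas_le.
- by rewrite uphalf_gt0.
rewrite card_ord lee_fin ler_pdivrMr ?ltr0n ?uphalf_gt0//.
have k2 : k%:R <= 2 * (uphalf k)%:R :> R.
  by rewrite -natrM ler_nat mul2n -leq_uphalf_double.
have -> : k%:R * h = 2 * t * rate by rewrite /h; field; rewrite gt_eqF.
rewrite [leRHS]mulrAC ler_pdivlMr//.
have tr0 : 0 <= t * rate by rewrite mulr_ge0// ltW.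
have := ler_wpM2l tr0 k2; lra.
Qed.

Lemma hurriedP k t w : 0 < t -> (forall j, 0 < w (gap_clock j)) ->
  arrival_time (U w) k <= t -> hurried k.+1 t w.
Proof.
move=> t0 w0 At; rewrite /hurried; set h := 2 * t / k.+1%:R.
have k0 : (0 < k.+1%:R :> R) by rewrite ltr0n.
have h0 : 0 < h by rewrite !mulr_gt0// invr_gt0.
(* The number of short gaps; each of the others lasts longer than [h], and their total is at most
   [t]. *)
pose s := (\sum_(i < k.+1) (w (gap_clock i) <= h * rate)%R)%N.
have sk : (s <= k.+1)%N.
  by rewrite -[k.+1]card_ord -sum1_card; apply: leq_sum => i _; case: (_ <= _).
have : (k.+1 - s)%:R * h <= t.
  apply: le_trans At; rewrite /arrival_time natrB// -[k.+1%:R]mulr1.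
  have -> : k.+1%:R * 1 - s%:R = \sum_(i < k.+1) (1 - (w (gap_clock i) <= h * rate)%R%:R) :> R.
    rewrite big_split/= sumrN sumr_const card_ord mulr_natl; congr (_ - _).
    by rewrite natr_sum.
  rewrite big_distrl/=; apply: ler_sum => i _.
  have [_|hi] := leP (w (gap_clock i)) (h * rate); first by rewrite subrr mul0r divr_ge0// ltW.
  by rewrite subr0 mul1r ler_pdivlMr// ltW.
rewrite -/s natrB// => H.
rewrite -(ler_nat R) natrM.
have : (k.+1%:R - s%:R) * (2 * t) <= t * k.+1%:R.
  by move: H; rewrite /h mulrA ler_pdivrMr.
move=> H2; rewrite -(ler_pM2l t0); lra.
Qed.

End arrivals_rate.

(** * Samples that miss the least loaded pools *)

Section sampling.
Context (R : realType).

(** Factor by factor, [(a - i) / (b - i)] is at most [a / b]. *)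
Lemma bin_ratio (a b m : nat) : (a <= b)%N -> ('C(a, m) * b ^ m <= 'C(b, m) * a ^ m)%N.
Proof.
move=> ab; rewrite -(leq_pmul2r (fact_gt0 m)).
rewrite [leqLHS]mulnAC [leqRHS]mulnAC !bin_ffact.
elim: m => // m IH; rewrite !ffactnSr !expnSr.
rewrite [leqLHS]mulnACA [leqRHS]mulnACA; apply: leq_mul => //.
rewrite !mulnBl (mulnC b a); apply: leq_sub2l.
by rewrite leq_mul2l ab orbT.
Qed.

Lemma expo_pick_family N m (F : {set {set 'I_N}}) : (m <= N)%N ->
  (expo [set x : R | pick_set N m x \in F] =
   (#|[set S in F | #|S| == m]%SET|%:R / 'C(N, m)%:R)%:E)%E.
Proof.
move=> mN.
have mpick S : measurable [set x : R | pick_set N m x = S].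
  exact: (@dmeas_pick_set R _ R id).
rewrite (_ : [set _ | _] = \bigcup_(S in [set` enum F]) [set x : R | pick_set N m x = S]); last first.
  apply/seteqP; split=> x /=; first by move=> xF; exists (pick_set N m x) => //=; rewrite mem_enum.
  by move=> [S /=]; rewrite mem_enum => SF ->.
rewrite measure_fin_bigcup//; last by move=> S S' _ _ [x [/= -> ->]].
rewrite (eq_fsbigr (fun S : {set 'I_N} => (if #|S| == m then ('C(N, m)%:R)^-1 else 0)%:E)); last first.
  by move=> S _; exact: expo_pick_set.
rewrite -fsbig_seq ?enum_uniq// big_enum/= sumEFin -big_mkcondr/=; congr EFin.
rewrite mulr_natl -sumr_const; apply: eq_bigl => S.
by rewrite inE.
Qed.

(** [Z] consists of the first [n.+1] pools in increasing order of load. If [S] contained a pool [s]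
    of [Z], the pools strictly lower than [s] would all lie in [Z] without [s], hence be at most
    [n]. *)
Lemma least_loaded_missed N n (y : 'I_N -> nat) : (n < N)%N -> exists2 Z : {set 'I_N},
  #|Z| = n.+1 & forall S : {set 'I_N},
    (n < #|[set w | [forall (v | v \in S), y w < y v]%N]%SET|)%N -> S \subset (~: Z)%SET.
Proof.
move=> nN.
pose r (v w : 'I_N) := (y v <= y w)%N.
have rT : total r by move=> v w; exact: leq_total.
have rtr : transitive r by move=> b a c; exact: leq_trans.
pose l := sort r (enum 'I_N).
have szl : size l = N by rewrite size_sort size_enum_ord.
have ul : uniq l by rewrite sort_uniq enum_uniq.
have sl : sorted r l by exact: sort_sorted.
exists [set v in take n.+1 l]%SET.
  by rewrite cardsE (card_uniqP (take_uniq _ ul)) size_takel ?szl.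
move=> S; apply: contraTT => /subsetPn[s sS]; rewrite !inE negbK => sl'.
rewrite -leqNgt -ltnS.
have <- : #|take n.+1 l| = n.+1.
  by rewrite (card_uniqP (take_uniq _ ul)) size_takel ?szl.
apply: proper_card; apply/properP; split.
  apply/fintype.subsetP => w; rewrite inE => /forall_inP/(_ s sS) ws.
  move: sl; rewrite (sorted_pairwise rtr) -{1}(cat_take_drop n.+1 l) pairwise_cat.
  move=> /and3P[/allrelP lo _ _].
  have : w \in take n.+1 l ++ drop n.+1 l by rewrite cat_take_drop mem_sort mem_enum.
  rewrite mem_cat => /orP[//|wd]; have := lo _ _ sl' wd.
  by rewrite /r leqNgt ws.
exists s => //; rewrite inE; apply/forall_inP => /(_ s sS); by rewrite ltnn.
Qed.

(** The probability of avoiding a fixed set of [n.+1] pools is at most the [m]-th power of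
    [1 - n.+1 / N], which is bounded by an exponential. *)
Lemma expo_missed N m n (y : 'I_N -> nat) : (m <= N)%N ->
  (expo [set x : R | (n < #|[set w | [forall (v | v \in pick_set N m x),
      y w < y v]%N]%SET|)%N] <= (expR (- (n.+1%:R * m%:R / N%:R)))%:E)%E.
Proof.
move=> mN; have [Nn|nN] := leqP N n.
  rewrite (_ : [set _ | _] = set0) ?measure0 ?lee_fin ?expR_ge0//.
  apply/seteqP; split=> // x /=; rewrite ltnNge.
  by rewrite (leq_trans (max_card _))// card_ord.
have [Z Zn ZP] := least_loaded_missed y nN.
have N0 : (0 < N)%N by exact: leq_ltn_trans nN.
have C0 : (0 < 'C(N, m)%:R :> R) by rewrite ltr0n bin_gt0.
have N0' : (0 < N%:R :> R) by rewrite ltr0n.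
pose F := [set S : {set 'I_N} | S \subset ~: Z]%SET.
apply: (@le_trans _ _ (expo [set x : R | pick_set N m x \in F])).
  apply: le_measure; rewrite ?inE.
  - apply: dmeas_boolE; apply: (dmeas_comp (f := fun x : R => pick_set N m x)
      (fun S : {set 'I_N} => n < #|[set w | [forall (v | v \in S), y w < y v]%N]%SET|)%N).
    exact: (@dmeas_pick_set R _ R id).
  - apply: dmeas_boolE; apply: (dmeas_comp (f := fun x : R => pick_set N m x)
      (fun S : {set 'I_N} => S \in F)).
    exact: (@dmeas_pick_set R _ R id).
  - by move=> x /= /ZP; rewrite inE.
rewrite expo_pick_family// lee_fin ler_pdivrMr//.
have -> : [set S in F | #|S| == m]%SET =
    [set S : {set 'I_N} | (S \subset ~: Z) && (#|S| == m)]%SET.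
  by apply/setP => S; rewrite !inE.
rewrite cards_draws cardsCs finset.setCK card_ord Zn.
have h := bin_ratio m (leq_subr n.+1 N).
have h' : 'C(N - n.+1, m)%:R * N%:R ^+ m <= 'C(N, m)%:R * (N - n.+1)%:R ^+ m :> R.
  by rewrite -!natrX -!natrM ler_nat.
rewrite -(ler_pM2r (exprn_gt0 m N0')); apply: le_trans h' _.
rewrite [leRHS]mulrAC [leRHS]mulrC ler_pM2l//.
have -> : expR (- (n.+1%:R * m%:R / N%:R)) = expR (- (n.+1%:R / N%:R)) ^+ m :> R.
  by rewrite -expRM_natl; congr expR; ring.
rewrite -exprMn; apply: lerXn2r; rewrite ?nnegrE ?mulr_ge0 ?expR_ge0 ?ler0n//.
rewrite natrB//; have := expR_ge1Dx (- (n.+1%:R / N%:R) : R).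
by move=> /(ler_wpM2r (ltW N0')); rewrite mulrBl mul1r divfK ?gt_eqF.
Qed.

End sampling.

Section bad_arrivals.
Context (R : realType).
Local Notation T := (seqspace clock R).
Variable P : probability T R.
Hypothesis Piid : iid_exponential P.
Context (B : capacity) (N m n : nat) (rate : R) (Pi : scheme R) (x : config N).
Hypothesis mN : (m <= N)%N.
Local Notation U := (raw_input rate N m : T -> input R N).
Local Notation q := (expR (- (n.+1%:R * m%:R / N%:R)) : R).

(** The state found by arrival [k] does not depend on its own sample; conditioning on the other
    clocks therefore leaves a fixed configuration in [bad_le]. *)
Lemma seen_upd_sample k w z :
  seen B Pi x (U (upd w (sample_clock k) z)) k = seen B Pi x (U w) k.
Proof.
have placE l : (l <= k)%N -> placements B Pi x (U (upd w (sample_clock k) z)) l =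
    placements B Pi x (U w) l.
  elim: l => // l IH lk; rewrite /= IH ?(ltnW lk)//; congr rcons.
  rewrite /place size_placements.
  have -> : sampled (U (upd w (sample_clock k) z)) l = sampled (U w) l.
    rewrite /= /upd (_ : (sample_clock l == sample_clock k) = false)//.
    by apply/eqP => -[lk']; rewrite lk' ltnn in lk.
  by [].
by rewrite /seen placE.
Qed.

Lemma bad_le k : (P [set w | bad B n Pi x (U w) k] <= q%:E)%E.
Proof.
apply: (prob_le_coord Piid (c := sample_clock k)).
- by apply: dmeas_boolE; apply: dmeas_bad; exact: dmeas_raw_input.
- by rewrite lee_fin expR_ge0.
move=> w _; have H := @expo_missed R N m n (seen B Pi x (U w) k) mN.
have E z : bad B n Pi x (U (upd w (sample_clock k) z)) k = (n < #|[set w' |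
    [forall (v | v \in pick_set N m z), seen B Pi x (U w) k w' < seen B Pi x (U w) k v]%N]%SET|)%N.
  by rewrite /bad seen_upd_sample /= /upd eqxx.
by under eq_set do rewrite /= E.
Qed.

Definition many_bad (k : nat) (w : T) : bool :=
  (n < \sum_(i < k) bad B n Pi x (U w) i)%N.

Lemma dmeas_many_bad k : dmeas (many_bad k).
Proof.
apply: (dmeas_comp (f := fun w : T => \sum_(i < k) bad B n Pi x (U w) i)%N (fun s => n < s)%N).
apply: dmeas_sum => i; apply: dmeas_comp; apply: dmeas_bad; exact: dmeas_raw_input.
Qed.

Lemma many_bad_le k :
  (P [set w | many_bad k w] <= (k%:R * q / n.+1%:R)%:E)%E.
Proof.
have := @count_markov R _ T P 'I_k (fun i w => bad B n Pi x (U w) i) q n.+1.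
rewrite card_ord; apply => //.
  by move=> i; apply: dmeas_bad; exact: dmeas_raw_input.
by move=> i; exact: bad_le.
Qed.

End bad_arrivals.

(** * Convergence *)

Lemma cvge0_le (R : realType) (f : nat -> \bar R) : (forall n, (0 <= f n)%E) ->
  (forall e : R, 0 < e -> \forall n \near \oo, (f n <= e%:E)%E) ->
  f n @[n --> \oo] --> (0 : \bar R).
Proof.
move=> f0 fe; apply/fine_cvgP; split.
  near=> n; rewrite ge0_fin_numE//; apply: (@le_lt_trans _ _ 1%:E); last exact: ltry.
  by near: n; exact: fe.
apply/cvgr0Pnorm_le => e e0; near=> n.
have fn : (f n <= e%:E)%E by near: n; exact: fe.
rewrite /= ger0_norm ?fine_ge0// -lee_fin fineK//.
by rewrite ge0_fin_numE//; apply: le_lt_trans fn _; exact: ltry.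
Unshelve. all: by end_near.
Qed.

(** * The two regimes for the sample size *)

Section sample_size.
Context (R : realType) (d : nat -> nat) (g : nat -> R).
Hypothesis hginfty : g N @[N --> \oo] --> +oo.

Lemma expRN_le_inv (x : R) : 0 < x -> expR (- x) <= x^-1.
Proof.
move=> x0; rewrite expRN lef_pV2 ?posrE ?expR_gt0//.
by have := expR_ge1Dx x; lra.
Qed.

Lemma sample_size_linear (c e : R) : 0 < c -> 0 < e ->
  g =Theta_\oo (fun N : nat => N%:R : R) -> d N @[N --> \oo] --> \oo ->
  \forall N \near \oo, N%:R / g N * expR (- (c * (g N * (d N)%:R / N%:R))) <= e.
Proof.
move=> c0 e0; rewrite eqThetaE qualifE => /asboolP[[k1 k2] /= /andP[k10 k20] gN] dN.
have gpos : \forall N \near \oo, 0 < g N by move/cvgryPgt : hginfty => /(_ 0).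
near=> N; have g0 : 0 < g N by near: N.
have N0 : (0 < N)%N by near: N; exact: nbhs_infty_gt.
have N0' : (0 < N%:R :> R) by rewrite ltr0n.
have k1N : k1 * N%:R <= g N.
  have : k1 * `|N%:R| <= `|g N| /\ `|g N| <= k2 * `|N%:R| by near: N.
  by rewrite !gtr0_norm// => -[].
(* The value of [d N] at which the bound [k1^-1 * (c * k1 * d N)^-1] equals [e]. *)
pose D := (c * k1 * k1 * e)^-1.
have D0 : 0 < D by rewrite invr_gt0 !mulr_gt0.
have dD : D <= (d N)%:R.
  apply: (@le_trans _ _ (Num.truncn D).+1%:R); first by rewrite ltW// truncnS_gt.
  by rewrite ler_nat; near: N; move/cvgnyPge : dN; exact.
have d0 : 0 < (d N)%:R :> R by exact: lt_le_trans dD.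
set x := c * _; have xk : c * k1 * (d N)%:R <= x.
  rewrite /x -mulrA ler_pM2l// mulrAC ler_pM2r// ler_pdivlMr//.
have x1 : 0 < c * k1 * (d N)%:R by rewrite !mulr_gt0.
apply: (@le_trans _ _ (k1^-1 * (c * k1 * (d N)%:R)^-1)).
  apply: ler_pM; [by rewrite divr_ge0// ltW|exact: expR_ge0| |].
    by rewrite ler_pdivrMr// mulrC ler_pdivlMr// mulrC.
  apply: le_trans (expRN_le_inv (lt_le_trans x1 xk)) _.
  by rewrite lef_pV2 ?posrE// (lt_le_trans x1).
rewrite -invfM invf_ple ?posrE// ?mulr_gt0//.
have -> : k1 * (c * k1 * (d N)%:R) = (c * k1 * k1) * (d N)%:R by ring.
rewrite -[leLHS]mulr1.
have -> : e^-1 * 1 = (c * k1 * k1) * D by rewrite /D; field; rewrite !gt_eqF.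
by rewrite ler_pM2l ?mulr_gt0.
Unshelve. all: by end_near.
Qed.

Lemma sample_size_sublinear (c e : R) : 0 < c -> 0 < e ->
  g =o_\oo (fun N : nat => N%:R : R) ->
  (d N)%:R * (N%:R / g N * ln (N%:R / g N))^-1 @[N --> \oo] --> +oo ->
  \forall N \near \oo, N%:R / g N * expR (- (c * (g N * (d N)%:R / N%:R))) <= e.
Proof.
move=> c0 e0 /eqoP go dN.
have gpos : \forall N \near \oo, 0 < g N by move/cvgryPgt : hginfty => /(_ 0).
(* With [g N <= s * N] the ratio [rho = N / g N] is at least 2, so its logarithm is positive, and
   its inverse is at most [e]. *)
pose s := Num.min e 2^-1.
have s0 : 0 < s by rewrite lt_min e0 invr_gt0 ltr0n.
near=> N; have g0 : 0 < g N by near: N.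
have N0 : (0 < N)%N by near: N; exact: nbhs_infty_gt.
have N0' : (0 < N%:R :> R) by rewrite ltr0n.
have gs : g N <= s * N%:R.
  have : `|g N| <= s * `|N%:R| by near: N; exact: go.
  by rewrite !gtr0_norm.
(* The factor 2 makes the exponential at most [rho ^- 2], so one power of [rho^-1] is left after
   multiplication by [rho]. *)
have dW : 2 / c <= (d N)%:R * (N%:R / g N * ln (N%:R / g N))^-1.
  by near: N; move/cvgryPge : dN; exact.
set rho := N%:R / g N in dW *.
have rho0 : 0 < rho by rewrite divr_gt0.
have rhoV : rho^-1 <= s by rewrite invf_div ler_pdivrMr.
have rho2 : 2 <= rho.
  rewrite -[rho]invrK -[2]invrK lef_pV2 ?posrE ?invr_gt0//.
  by apply: le_trans rhoV _; rewrite ge_min lexx orbT.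
have ln0 : 0 < ln rho by rewrite ln_gt0//; lra.
have -> : g N * (d N)%:R / N%:R = (d N)%:R / rho.
  by rewrite /rho; field; rewrite !gt_eqF.
have rl0 : 0 < rho * ln rho by exact: mulr_gt0.
move: dW; rewrite ler_pdivlMr// => dW.
have : 2 * ln rho <= c * ((d N)%:R / rho).
  rewrite mulrA ler_pdivlMr//.
  have -> : 2 * ln rho * rho = c * (2 / c * (rho * ln rho)) by field; rewrite gt_eqF.
  by rewrite ler_pM2l.
move=> H; apply: (@le_trans _ _ (rho * expR (- (2 * ln rho)))).
  by rewrite ler_pM2l// ler_expR lerN2.
have -> : expR (- (2 * ln rho)) = rho^-1 * rho^-1.
  rewrite (_ : - (2 * ln rho) = - ln rho + - ln rho); last by ring.
  by rewrite expRD expRN lnK ?posrE.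
rewrite mulrA divff ?gt_eqF// mul1r; apply: le_trans rhoV _.
by rewrite ge_min lexx.
Unshelve. all: by end_near.
Qed.

End sample_size.

Section positive_part.
Context (R : realType).
Local Notation T := (seqspace clock R).

(** Changes clocks on a null event only; the pathwise bounds then hold for every [w], not just
    almost surely. *)
Definition make_pos (w : T) : T := fun c => if 0 < w c then w c else 1.

Lemma make_pos_gt0 w c : 0 < make_pos w c.
Proof. by rewrite /make_pos; case: ifP. Qed.

Lemma preserves_make_pos (P : probability T R) :
  iid_exponential P -> preserves P make_pos.
Proof.
move=> Piid; apply: (preserves_coordwise Piid (f := fun x : R => if 0 < x then x else 1)).
  apply: measurable_fun_ifT => //; exact: measurable_fun_ltr.
move=> A mA.
have mf : measurable_fun setT (fun x : R => if 0 < x then x else 1).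
  by apply: measurable_fun_ifT => //; exact: measurable_fun_ltr.
have mfA := measurable_preimT mf mA.
rewrite -unif_neg_ln// -[RHS]unif_neg_ln//.
have mln : measurable_fun setT (fun x : R => - ln x).
  exact: measurableT_comp (@measurable_ln R).
apply: unif_eq_inside; [exact: measurable_preimT mfA|exact: measurable_preimT mA|].
by move=> x /andP[x0 x1] /=; rewrite oppr_gt0 ln_lt0// x0.
Qed.

End positive_part.

Section deviation.
Context (R : realType).
Local Notation T := (seqspace clock R).
Variable P : probability T R.
Hypothesis Piid : iid_exponential P.
Context (B : capacity) (N K M m J : nat) (rate delta : R).
Context (Pi1 Pi2 : scheme R) (d : nat -> nat) (x1 x2 : config N).

Definition input1 (w : T) : input R N :=
  system N K M J rate delta N (remix B K M m J rate delta Pi1 Pi2 x1 x2 (make_pos w)).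
Definition input2 (w : T) : input R N :=
  system N K M J rate delta m (make_pos w).

Hypotheses (rate_gt0 : 0 < rate) (delta_gt0 : 0 < delta).
Hypotheses (N_gt0 : (0 < N)%N) (JSQ1 : is_JSQ Pi1) (JSQ2 : is_JSQd d Pi2).
Hypotheses (m_gt0 : (0 < m)%N) (mN : (m <= N)%N).
Hypotheses (xM1 : forall w, (x1 w <= M)%N) (xM2 : forall w, (x2 w <= M)%N).

Lemma input1_law : is_input rate N P input1.
Proof.
apply: (@is_input_preserves _ _ _ _ _ _ _ (raw_input rate N N : T -> _)
  (fun w => sweeps rate delta (tcodes N K M) J
     (remix B K M m J rate delta Pi1 Pi2 x1 x2 (make_pos w)))).
  exact: raw_is_input.
apply: (@preserves_comp _ _ _ _ (sweeps rate delta (tcodes N K M) J : T -> T)).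
  exact: preserves_sweeps.
apply: (@preserves_comp _ _ _ _ (remix B K M m J rate delta Pi1 Pi2 x1 x2 : T -> T)).
  exact: preserves_remix.
exact: preserves_make_pos.
Qed.

(** The second system is the raw input at [forward w]. As [forward] preserves [P], the bounds proved
    for raw clocks carry over. *)
Let forward (w : T) : T := sweeps rate delta (tcodes N K M) J (make_pos w).

Let preserves_forward : preserves P forward.
Proof.
apply: (@preserves_comp _ _ _ _ (sweeps rate delta (tcodes N K M) J : T -> T)).
  exact: preserves_sweeps.
exact: preserves_make_pos.
Qed.

Lemma input2_law : is_input rate m P input2.
Proof.
apply: (@is_input_preserves _ _ _ _ _ _ _ (raw_input rate N m : T -> _) forward).
  exact: raw_is_input.
exact: preserves_forward.
Qed.

Hypotheses (cap1 : within_capacity B x1) (cap2 : within_capacity B x2)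
  (occ : same_occupancy x1 x2).

Lemma occupancy_close n k (t0 : R) i w t : (k <= K)%N -> t0 <= grid delta J -> (0 < i)%N ->
  ~~ crowded N K M m rate delta (forward w) ->
  ~~ hurried rate k.+1 (t0 + 1) (forward w) ->
  ~~ @many_bad R B N m n rate Pi2 x2 k (forward w) ->
  0 <= t <= t0 ->
  `| (occupancy B Pi1 x1 (input1 w) i t)%:R - (occupancy B Pi2 x2 (input2 w) i t)%:R |
    <= (i * (n + n))%:R :> R.
Proof.
move=> kK t0J i0 nc nh nb /andP[t_ge0 tt0].
have w0 := make_pos_gt0 w.
have u2E : input2 w = raw_input rate N m (forward w) by [].
have gap0 c : 0 < gap (input2 w) c by exact: system_gap_gt0.
(* Arrival [k] is a sum of [k.+1] gaps. The margin 1 provides the positive horizon of [hurriedP]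
   even when [t0] is 0. *)
have Ak : t0 < arrival_time (input2 w) k.
  rewrite ltNge; apply: contra nh => h.
  apply: (@hurriedP _ N m rate rate_gt0).
  - by apply: (le_lt_trans (le_trans t_ge0 tt0)); rewrite ltrDl.
  - by move=> j; rewrite /forward sweeps_gap.
  - by apply: le_trans h _; rewrite lerDl.
(* Arrivals from [k] on come after [t], so only the first [k] can count as bad. *)
have nbn : (nbad B K n Pi2 x2 (input2 w) t <= n)%N.
  move: nb; rewrite /many_bad -leqNgt; apply: leq_trans.
  rewrite /nbad -(big_mkord xpredT (fun j =>
    (((arrival_time (input2 w) j <= t)%R && bad B n Pi2 x2 (input2 w) j) : nat))).
  rewrite (big_cat_nat (n := k))//= [X in (_ + X)%N]big_nat_cond.
  rewrite [X in (_ + X)%N]big1 ?addn0; last first.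
    move=> j; rewrite andbT => /andP[kj _]; have Aj : t < arrival_time (input2 w) j.
      apply: le_lt_trans tt0 (lt_le_trans Ak _).
      by move: kj; rewrite leq_eqVlt => /orP[/eqP ->//|kj]; exact/ltW/arrival_time_lt.
    by rewrite leNgt Aj.
  by rewrite big_mkord; apply: leq_sum => j _; case: (_ <= t).
have gE j : grid delta j.+1 = grid delta j + delta by exact: gridS.
have H := @coupling_bound R B N K M n m J rate delta Pi1 Pi2 d x1 x2 rate_gt0 delta_gt0
  N_gt0 JSQ1 JSQ2 m_gt0 mN xM1 xM2 (make_pos w) t i w0 cap1 cap2 occ.
have [] := H _ _ _ _ _ i0.
- move=> j k1 k2 jJ; rewrite gE => h1 h2.
  by have := not_crowded nc (e := inl k1) (e' := inl k2) h1 h2 => -[].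
- move=> j k1 c jJ; rewrite gE => h1 h2.
  by have := not_crowded nc (e := inl k1) (e' := inr c) h1 h2.
- move=> j c c' jJ; rewrite gE => h1 h2.
  by have := not_crowded nc (e := inr c) (e' := inr c') h1 h2 => -[].
- by rewrite t_ge0 (le_trans tt0).
- apply: (le_lt_trans tt0); apply: (lt_le_trans Ak).
  move: kK; rewrite leq_eqVlt => /orP[/eqP -> //|kK].
  exact/ltW/arrival_time_lt.
rewrite -/(input1 w) -/(input2 w) => h1 h2.
have nn : (i * (n + nbad B K n Pi2 x2 (input2 w) t) <= i * (n + n))%N.
  by rewrite leq_mul2l leq_add2l nbn orbT.
have {}h1 := leq_trans h1 (leq_add (leqnn _) nn).
have {}h2 := leq_trans h2 (leq_add (leqnn _) nn).
move: h1 h2; rewrite -!(ler_nat R) !natrD => h1 h2.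
by rewrite ler_norml; apply/andP; split; lra.
Qed.

Definition deviation (gN t0 : R) (i : nat) (w : T) : \bar R :=
  ereal_sup [set (gN^-1 *
     `| (occupancy B Pi1 x1 (input1 w) i t)%:R
      - (occupancy B Pi2 x2 (input2 w) i t)%:R |)%:E | t in `[0, t0]].

Lemma deviation_le n k (t0 e gN : R) i : (k <= K)%N -> 0 <= t0 -> t0 <= grid delta J ->
  (0 < i)%N -> 0 < gN -> (i * (n + n))%:R <= e * gN ->
  (mu_ext P [set w | e%:E < deviation gN t0 i w] <=
   ((#|{: 'I_K + task N K M}| ^ 2)%:R * (2 * delta * (1 + rate)) +
    4 * (t0 + 1) * rate / k.+1%:R +
    k%:R * expR (- (n.+1%:R * m%:R / N%:R)) / n.+1%:R)%:E)%E.
Proof.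
move=> kK t00 t0J i0 g0 ng.
pose A1 : set T := [set w | crowded N K M m rate delta w].
pose A2 : set T := [set w | hurried rate k.+1 (t0 + 1) w].
pose A3 : set T := [set w | @many_bad R B N m n rate Pi2 x2 k w].
have m1 : measurable A1 by apply: dmeas_boolE; exact: dmeas_crowded.
have m2 : measurable A2 by apply: dmeas_boolE; exact: dmeas_hurried.
have m3 : measurable A3 by apply: dmeas_boolE; exact: dmeas_many_bad.
have m12 : measurable (A1 `|` A2) by exact: measurableU.
have m123 : measurable (A1 `|` A2 `|` A3) by exact: measurableU.
have mG : measurable (forward @^-1` (A1 `|` A2 `|` A3)).
  exact: measurable_preimT preserves_forward.1 m123.
(* The event for the supremum over all times is enclosed in a measurable one, on which the outer
   measure is [P]. *)
apply: (@le_trans _ _ (mu_ext P (forward @^-1` (A1 `|` A2 `|` A3)))).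
  apply: le_mu_ext => w /=; apply: contraPP => /not_orP[/not_orP[/negP n1 /negP n2] /negP n3].
  apply/negP; rewrite -leNgt; apply: ub_ereal_sup => _ [t /= t0t <-].
  rewrite lee_fin mulrC ler_pdivrMr//; apply: le_trans ng.
  by apply: (occupancy_close (k := k) (t0 := t0)) => //; move: t0t; rewrite in_itv.
have -> : mu_ext P (forward @^-1` (A1 `|` A2 `|` A3)) = P (A1 `|` A2 `|` A3).
  exact: etrans (measurable_mu_extE P mG) (preserves_forward.2 _ m123).
apply: (le_trans (measureU2 _ _ _)) => //; rewrite EFinD; apply: leeD; last first.
  exact: many_bad_le.
apply: (le_trans (measureU2 _ _ _)) => //; rewrite EFinD; apply: leeD.
  exact: crowded_le.
by apply: hurried_le => //; rewrite addr_ge0.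
Qed.

End deviation.

(** * Scales that depend on the number of pools only *)

Section scales.
Context (R : realType) (rate : nat -> R) (x1 x2 : forall N : nat, config N).

(** About [M0 * N] arrivals are needed, with [M0] depending on the time horizon and the tolerance;
    [N * N] eventually exceeds them all. *)
Definition horizon (N : nat) : nat := (N * N)%N.
Definition max_tasks (N : nat) : nat := (\max_(v < N) maxn (x1 N v) (x2 N v))%N.
(** Chosen so that the bound of [crowded_le] is at most [N%:R^-1]; the successor keeps the
    denominator positive. *)
Definition cell_width (N : nat) : R :=
  (N%:R * (2 * (1 + rate N)) *
    (#|{: 'I_(horizon N) + task N (horizon N) (max_tasks N)}| ^ 2).+1%:R)^-1.
Definition cells (N : nat) : nat := (Num.truncn (N%:R / cell_width N)).+1.

Hypothesis hrate : forall N : nat, (0 < N)%N -> 0 < rate N.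

Lemma cell_width_gt0 N : (0 < N)%N -> 0 < cell_width N.
Proof.
move=> N0; rewrite invr_gt0 !mulr_gt0 ?ltr0n// addr_gt0// hrate//.
Qed.

Lemma grid_cells N : (0 < N)%N -> N%:R <= grid (cell_width N) (cells N).
Proof.
move=> N0; have d0 := cell_width_gt0 N0.
by rewrite /grid -ler_pdivrMr// ltW// truncnS_gt.
Qed.

Lemma crowding_small N : (0 < N)%N ->
  (#|{: 'I_(horizon N) + task N (horizon N) (max_tasks N)}| ^ 2)%:R *
    (2 * cell_width N * (1 + rate N)) <= N%:R^-1.
Proof.
move=> N0; rewrite /cell_width; set q := (_ ^ 2)%N.
have r0 : 0 < 1 + rate N by rewrite addr_gt0// hrate.
have N0' : 0 < N%:R :> R by rewrite ltr0n.
have q1 : 0 < q.+1%:R :> R by rewrite ltr0n.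
have -> : q%:R * (2 * (N%:R * (2 * (1 + rate N)) * q.+1%:R)^-1 * (1 + rate N)) =
    N%:R^-1 * (q%:R / q.+1%:R) by field; rewrite !gt_eqF.
rewrite ler_piMr ?invr_ge0 ?ler0n// ler_pdivrMr// mul1r ler_nat.
exact: leqnSn.
Qed.

End scales.

Theorem theorem3p1 (R : realType)
    (B : capacity) (rate : nat -> R) (lam : R)
    (d : nat -> nat) (g : nat -> R)
    (JSQ JSQd : scheme R) (x1 x2 : forall N : nat, config N)
    (hB : forall b : nat, B = Some b -> (1 <= b)%N)
    (hrate : forall N : nat, (0 < N)%N -> 0 < rate N)
    (hlam : rate N / N%:R @[N --> \oo] --> lam)
    (hlam0 : 0 < lam)
    (hlamB : forall b : nat, B = Some b -> lam <= b%:R)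
    (hd : forall N : nat, (0 < N)%N -> (1 <= d N <= N)%N)
    (hg0 : forall N : nat, (0 < N)%N -> 0 <= g N)
    (hginfty : g N @[N --> \oo] --> +oo)
    (hgN : forall N : nat, (0 < N)%N -> g N <= N%:R)
    (hJSQ : is_JSQ JSQ)
    (hJSQd : is_JSQd d JSQd)
    (hx1 : forall N : nat, within_capacity B (x1 N))
    (hx2 : forall N : nat, within_capacity B (x2 N))
    (hx : forall N : nat, same_occupancy (x1 N) (x2 N))
    (h : (g =Theta_\oo (fun N : nat => N%:R : R) /\ d N @[N --> \oo] --> \oo)
      \/ (g =o_\oo (fun N : nat => N%:R : R) /\
          (d N)%:R * (N%:R / g N * ln (N%:R / g N))^-1 @[N --> \oo] --> +oo)) :
  alike g rate B JSQ JSQd x1 x2.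
Proof.
have [P Piid] := @exponential_iid R clock.
pose K N := horizon N; pose M N := max_tasks x1 x2 N.
pose delta N := cell_width rate x1 x2 N; pose J N := cells rate x1 x2 N.
pose U1 N := input1 B (K N) (M N) (d N) (J N) (rate N) (delta N) JSQ JSQd (x1 N) (x2 N).
pose U2 N := @input2 R N (K N) (M N) (d N) (J N) (rate N) (delta N).
have xM1 N w : (x1 N w <= M N)%N.
  exact: leq_trans (leq_maxl _ (x2 N w)) (leq_bigmax (F := fun v => maxn (x1 N v) (x2 N v)) w).
have xM2 N w : (x2 N w <= M N)%N.
  exact: leq_trans (leq_maxr (x1 N w) _) (leq_bigmax (F := fun v => maxn (x1 N v) (x2 N v)) w).
have tail (c e : R) : 0 < c -> 0 < e ->
    \forall N \near \oo, N%:R / g N * expR (- (c * (g N * (d N)%:R / N%:R))) <= e.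
  move=> c0 e0; case: h => -[h1 h2].
    exact: sample_size_linear.
  exact: sample_size_sublinear.
exists _, (seqspace clock R), P, U1, U2; split.
  move=> N N0; have /andP[d0 dN] := hd N N0.
  have r0 := hrate _ N0; have dl0 := cell_width_gt0 x1 x2 hrate N0.
  have [-> _] := hJSQ N N0; have [-> _] := hJSQd N N0.
  split; [exact: input1_law|exact: input2_law].
move=> t0 i t00 i0 e e0.
apply: cvge0_le => [N|eta eta0].
  by apply: mu_ext_ge0 => X; exact: measure_ge0.
(* With [n <= c * g N] the deviation bound [i * (n + n)] is at most [e * g N]. *)
pose c := e / (2 * i%:R).
have c0 : 0 < c by rewrite divr_gt0// mulr_gt0// ltr0n.
(* Eventually [rate N <= (lam + 1) * N], so with [k = M0 * N] the bound of [hurried_le] is at most a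
   third of [eta]. *)
pose M0 := (Num.truncn (4 * (t0 + 1) * (lam + 1) / (eta / 3))).+1.
have eta3 : 0 < eta / 3 by rewrite divr_gt0.
have M00 : 0 < M0%:R :> R by rewrite ltr0n.
have M0le : 4 * (t0 + 1) * (lam + 1) <= eta / 3 * M0%:R.
  by rewrite [leRHS]mulrC -ler_pdivrMr// ltW// truncnS_gt.
have gpos : \forall N \near \oo, 0 < g N by move/cvgryPgt : hginfty => /(_ 0).
(* The bad-arrival term is at most [M0 / c] times this quantity, hence the threshold. *)
have tl : \forall N \near \oo,
    N%:R / g N * expR (- (c * (g N * (d N)%:R / N%:R))) <= eta / 3 * c / M0%:R.
  by apply: tail => //; rewrite divr_gt0// mulr_gt0.
near=> N.
have N0 : (0 < N)%N by near: N; exact: nbhs_infty_gt.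
have N0' : 0 < N%:R :> R by rewrite ltr0n.
have /andP[d0 dN] := hd N N0.
have r0 := hrate _ N0; have dl0 := cell_width_gt0 x1 x2 hrate N0.
have g0 : 0 < g N by near: N.
pose n := Num.truncn (c * g N); pose k := (M0 * N)%N.
have cg0 : 0 < c * g N by rewrite mulr_gt0.
have kK : (k <= K N)%N.
  by rewrite /K /horizon leq_mul2r; apply/orP; right; near: N; exact: nbhs_infty_ge.
have t0J : t0 <= grid (delta N) (J N).
  apply: le_trans (grid_cells x1 x2 hrate N0).
  by near: N; exact: nbhs_infty_ger.
have ng : (i * (n + n))%:R <= e * g N.
  have nc : n%:R <= c * g N by rewrite /n truncn_le// ltW.
  have -> : e * g N = i%:R * (2 * (c * g N)).
    by rewrite /c; field; rewrite pnatr_eq0 -lt0n.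
  by rewrite natrM natrD ler_pM2l ?ltr0n//; lra.
have := deviation_le Piid r0 dl0 N0 hJSQ hJSQd d0 dN (xM1 N) (xM2 N) (hx1 N) (hx2 N) (hx N)
  kK t00 t0J i0 g0 ng.
move=> /le_trans; apply; rewrite lee_fin.
have -> : eta = eta / 3 + eta / 3 + eta / 3 by field.
apply: lerD; first apply: lerD.
- apply: le_trans (crowding_small x1 x2 hrate N0) _.
  rewrite -[leRHS]invrK lef_pV2 ?posrE ?invr_gt0//.
  by near: N; exact: nbhs_infty_ger.
- rewrite ler_pdivrMr ?ltr0n//.
  have rl : rate N <= (lam + 1) * N%:R.
    by rewrite -ler_pdivrMr//; near: N; move/cvgr_le : hlam; apply; rewrite ltrDl.
  apply: (@le_trans _ _ (eta / 3 * (M0%:R * N%:R))); last first.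
    by rewrite ler_pM2l// -natrM ler_nat leqnSn.
  have t1 : 0 <= 4 * (t0 + 1) by rewrite mulr_ge0// addr_ge0.
  apply: le_trans (ler_wpM2l t1 rl) _.
  by rewrite !mulrA ler_pM2r// -!mulrA in M0le *.
have n1 : c * g N <= n.+1%:R by rewrite ltW// truncnS_gt.
have q1 : expR (- (n.+1%:R * (d N)%:R / N%:R)) <= expR (- (c * (g N * (d N)%:R / N%:R))).
  rewrite ler_expR lerN2 !mulrA ler_pM2r ?invr_gt0//.
  by apply: ler_wpM2r.
apply: (@le_trans _ _ (k%:R * expR (- (c * (g N * (d N)%:R / N%:R))) / (c * g N))).
  apply: ler_pM; rewrite ?mulr_ge0 ?expR_ge0 ?invr_ge0 ?ler0n//.
    by rewrite ler_wpM2l.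
  by rewrite lef_pV2 ?posrE// ltr0n.
rewrite /k natrM.
have tN : N%:R / g N * expR (- (c * (g N * (d N)%:R / N%:R))) <= eta / 3 * c / M0%:R.
  by near: N.
set E := expR _ in tN *.
have -> : M0%:R * N%:R * E / (c * g N) = M0%:R / c * (N%:R / g N * E).
  by field; rewrite !gt_eqF.
have Mc : 0 <= M0%:R / c by rewrite divr_ge0// ltW.
apply: le_trans (ler_wpM2l Mc tN) _.
rewrite le_eqVlt; apply/orP; left; apply/eqP; field; rewrite !gt_eqF//.
Unshelve. all: by end_near.
Qed.
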